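(* (1) For every $s\geqslant0$ and every formula $\varphi$ of $TI_s$: if $TI_s\vdash\varphi$ then $SLP_s\vdash int(\bar\varphi)$, where $\bar\varphi$ is the universal closure of $\varphi$. (2) For every formula $\varphi$ of $TI$: if $TI\vdash\varphi$ then $SLP\vdash int(\bar\varphi)$.
   Context: Classical theory $TI$: variables $x^n$ of each type $n\geqslant0$; $0,S,+,\cdot$ on type 0; predicates $=_n$, $\in_n$ ($t\in_n\tau$ with $t$ of type $n$, $\tau$ of type $n+1$); type-0 terms built from variables and $0$ with $S,+,\cdot$, higher-type terms are variables. $srt(\varphi)$ = maximal type of free variables. Axioms (classical logic with equality): successor/addition/multiplication axioms of Peano arithmetic, induction on type 0 for all formulas, comprehension $\exists x^{n+1}\forall z^n(z\in x\equiv\varphi(z))$ for $srt(\varphi)\leqslant n+1$, $x$ not free in $\varphi$, extensionality $\forall z^n(z\in x^{n+1}\equiv z\in y^{n+1})\supset x=y$. $TI_s$: fragment with types $\leqslant s$. Intuitionistic theory $SLP=LP+(LL)+(C)+(BI)$ and its fragments $SLP_s$ (types $\leqslant s$; all schemas restricted to the language $LP_s$). Language $L$: number variables $x,y,\dots$; for $n\geqslant1$ variables $F^n$ ($n$-functionals), $A^n$ (lawlike), $\mathcal F^n$ (lawless) of type $n$; constants $0,K^n$; symbols $S,+,\cdot,N^n$, and application $Z(t)$ lowering type by one (a 1-functional applied to a term is a term); atomic formulas $t=_0\tau$, $Z=_nV$. $LP$ adds atomic formulas $\vdash_z\varphi(\bar X)$ for formulas $\varphi$ of $L$. $sort(\varphi)$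 = maximal type of free variables. $LP$: intuitionistic logic with equality; Peano axioms for $S,+,\cdot$; induction for all formulas; $K^{n+1}(x)=K^n$ ($K^0:=0$), $\neg(N^n(F)=K^n)$, $N^{n+1}(F)(x)=N^n(F(x))$, $N^n(F)=N^n(G)\supset F=G$; $\exists A^1\forall x(A(x)=t)$ for terms $t$ with only number and lawlike 1-functional variables; (CS1) $(\vdash_z\varphi)\vee\neg(\vdash_z\varphi)$, (CS2) $(\vdash_z\varphi)\supset(\vdash_{z+y}\varphi)$, (CS3) $\exists z(\vdash_z\varphi)\equiv\varphi$ ($\varphi$ in $L$). (LL): (LL1) $\exists\mathcal F^n(\forall y\leqslant x)(\mathcal F(y)=F^n(y))$; (LL2) $\mathcal F^n=\mathcal G^n\vee\mathcal F^n\neq\mathcal G^n$; (LL3) $\varphi(\mathcal H^n)\supset\exists x\forall\mathcal G^n[(\forall y<x)(\mathcal G(y)=\mathcal H(y))\supset\varphi(\mathcal G)]$ for $\varphi$ in $LP$, $sort(\varphi)\leqslant n$, no free $F^n$ or $\mathcal F^n$-type variables other than $\mathcal H^n$. (C): (C1) $\forall x\exists y\varphi(x,y)\supset\exists F^m\forall x\varphi(x,F(x)(0)^{m-1})$ for $m\geqslant\max(sort\varphi,1)$; (C2) $\forall x\exists!G^n\varphi(x,G)\supset\exists F^m\forall x\varphi(x,F(x)(0)^{m-n-1})$ for $m\geqslant\max(sort\varphi,n+1)$, where $F(0)^k$ is $F(0)\cdots(0)$ ($k$ times). (BI) bar induction: with $y$ ranging over codes of finite sequences of numbers, $*$ concatenation,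 $\bar F(x)=\langle F(0),\dots,F(x-1)\rangle$: $\forall F^1\exists x\varphi(\bar F(x))\wedge\forall x\forall y[\varphi(y)\supset\varphi(y*\langle x\rangle)]\wedge\forall y[\forall x\psi(y*\langle x\rangle)\supset\psi(y)]\wedge\forall y[\varphi(y)\supset\psi(y)]\supset\psi(\langle\rangle)$. Translation $int(\varphi)=((\varphi^* )')^-$. (i) $\approx_n$: $x^0\approx_0y^0$ is $x=y$; $x^{n+1}\approx_{n+1}y^{n+1}$ is $(\forall z^n\in x)(\exists u^n\in y)(z\approx_nu)\wedge(\forall z^n\in y)(\exists u^n\in x)(z\approx_nu)$; $(t=_n\tau)^*$ is $t\approx_n\tau$, $(t\in_n\tau)^*$ is $(\exists z^n\in\tau)(z\approx_nt)$, $*$ commutes with $\bot$, connectives, quantifiers. (ii) $'$: type-0 variable $x_i^0\mapsto x_i$ (numerical terms otherwise unchanged), $x_i^n\mapsto F_i^n$ for $n\geqslant1$; $(t=_n\tau)'$ is $t'=_n\tau'$; $(t\in_0\tau)'$ is $\exists y[\tau'(y)=S(t')]$; $(t\in_n\tau)'$ ($n\geqslant1$) is $\exists y[\tau'(y)=N^n(t')]$; $'$ commutes with $\bot$, connectives and quantifiers. (iii) $^-$ on $SLP$-formulas: atomic $\varphi\mapsto\neg\neg\varphi$; $\bot^-=\bot$; commutes with $\wedge,\supset,\forall$; $(\psi\vee\chi)^-=\neg(\neg\psi^-\wedge\neg\chi^-)$; $(\exists X\psi)^-=\neg\forall X\neg\psi^-$. *)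

(* Defs.v *)
From Stdlib Require Import Arith List Bool.
Import ListNotations.

Record Lang := mkLang {
  L_Var : Type;
  L_Tm : L_Var -> Type;            (* terms substitutable for a variable *)
  L_Fm : Type;
  L_adm : forall x, L_Tm x -> Prop; (* which terms may instantiate x *)
  L_bot : L_Fm;
  L_imp : L_Fm -> L_Fm -> L_Fm;
  L_and : L_Fm -> L_Fm -> L_Fm;
  L_or : L_Fm -> L_Fm -> L_Fm;
  L_all : L_Var -> L_Fm -> L_Fm;
  L_ex : L_Var -> L_Fm -> L_Fm;
  L_eq : forall x, L_Tm x -> L_Tm x -> L_Fm;   (* equality at the sort of x *)
  L_subst : forall x, L_Tm x -> L_Fm -> L_Fm;
  L_freefor : forall x, L_Tm x -> L_Fm -> Prop;
  L_free : L_Var -> L_Fm -> Prop }.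

(* [Prf L cl inL Ax A]: A is derivable from the axioms [Ax]; every formula
   in the derivation belongs to the language [inL]. *)
Inductive Prf (L : Lang) (cl : bool) (inL : L_Fm L -> Prop)
          (Ax : L_Fm L -> Prop) : L_Fm L -> Prop :=
| p_ax A : Ax A -> inL A -> Prf L cl inL Ax A
| p_K A B : inL (L_imp L A (L_imp L B A)) ->
    Prf L cl inL Ax (L_imp L A (L_imp L B A))
| p_S A B C :
    inL (L_imp L (L_imp L A (L_imp L B C))
           (L_imp L (L_imp L A B) (L_imp L A C))) ->
    Prf L cl inL Ax (L_imp L (L_imp L A (L_imp L B C))
           (L_imp L (L_imp L A B) (L_imp L A C)))
| p_andE1 A B : inL (L_imp L (L_and L A B) A) ->
    Prf L cl inL Ax (L_imp L (L_and L A B) A)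
| p_andE2 A B : inL (L_imp L (L_and L A B) B) ->
    Prf L cl inL Ax (L_imp L (L_and L A B) B)
| p_andI A B : inL (L_imp L A (L_imp L B (L_and L A B))) ->
    Prf L cl inL Ax (L_imp L A (L_imp L B (L_and L A B)))
| p_orI1 A B : inL (L_imp L A (L_or L A B)) ->
    Prf L cl inL Ax (L_imp L A (L_or L A B))
| p_orI2 A B : inL (L_imp L B (L_or L A B)) ->
    Prf L cl inL Ax (L_imp L B (L_or L A B))
| p_orE A B C :
    inL (L_imp L (L_imp L A C) (L_imp L (L_imp L B C) (L_imp L (L_or L A B) C))) ->
    Prf L cl inL Ax
      (L_imp L (L_imp L A C) (L_imp L (L_imp L B C) (L_imp L (L_or L A B) C)))
| p_efq A : inL (L_imp L (L_bot L) A) -> Prf L cl inL Ax (L_imp L (L_bot L) A)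
| p_dne A : cl = true ->
    inL (L_imp L (L_imp L (L_imp L A (L_bot L)) (L_bot L)) A) ->
    Prf L cl inL Ax (L_imp L (L_imp L (L_imp L A (L_bot L)) (L_bot L)) A)
| p_allE x t A : L_adm L x t -> L_freefor L x t A ->
    inL (L_imp L (L_all L x A) (L_subst L x t A)) ->
    Prf L cl inL Ax (L_imp L (L_all L x A) (L_subst L x t A))
| p_exI x t A : L_adm L x t -> L_freefor L x t A ->
    inL (L_imp L (L_subst L x t A) (L_ex L x A)) ->
    Prf L cl inL Ax (L_imp L (L_subst L x t A) (L_ex L x A))
| p_eqrefl x t : inL (L_eq L x t t) -> Prf L cl inL Ax (L_eq L x t t)
| p_eqsub x t u A : L_freefor L x t A -> L_freefor L x u A ->
    inL (L_imp L (L_eq L x t u) (L_imp L (L_subst L x t A) (L_subst L x u A))) ->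
    Prf L cl inL Ax
      (L_imp L (L_eq L x t u) (L_imp L (L_subst L x t A) (L_subst L x u A)))
| p_mp A B : Prf L cl inL Ax A -> Prf L cl inL Ax (L_imp L A B) -> inL B ->
    Prf L cl inL Ax B
| p_gen x A B : Prf L cl inL Ax (L_imp L B A) -> ~ L_free L x B ->
    inL (L_imp L B (L_all L x A)) -> Prf L cl inL Ax (L_imp L B (L_all L x A))
| p_exE x A B : Prf L cl inL Ax (L_imp L A B) -> ~ L_free L x B ->
    inL (L_imp L (L_ex L x A) B) -> Prf L cl inL Ax (L_imp L (L_ex L x A) B).

Inductive tmT : nat -> Type :=
| tvar (n i : nat) : tmT n
| tzero : tmT 0
| tsucc : tmT 0 -> tmT 0
| tplus : tmT 0 -> tmT 0 -> tmT 0
| ttimes : tmT 0 -> tmT 0 -> tmT 0.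

Definition varT := (nat * nat)%type.   (* (type, index) *)

Inductive fmT : Type :=
| fEq (n : nat) (t u : tmT n)
| fIn (n : nat) (t : tmT n) (u : tmT (S n))
| fBot
| fAnd (A B : fmT) | fOr (A B : fmT) | fImp (A B : fmT)
| fAll (v : varT) (A : fmT) | fEx (v : varT) (A : fmT).

Definition varT_eqb (v w : varT) : bool :=
  Nat.eqb (fst v) (fst w) && Nat.eqb (snd v) (snd w).

Fixpoint fvtT {n} (t : tmT n) : list varT :=
  match t with
  | tvar m i => [(m, i)]
  | tzero => []
  | tsucc a => fvtT a
  | tplus a b => fvtT a ++ fvtT b
  | ttimes a b => fvtT a ++ fvtT b
  end.

Fixpoint fvT (A : fmT) : list varT :=
  match A with
  | fEq _ t u => fvtT t ++ fvtT u
  | fIn _ t u => fvtT t ++ fvtT u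
  | fBot => []
  | fAnd A B | fOr A B | fImp A B => fvT A ++ fvT B
  | fAll v B | fEx v B => filter (fun w => negb (varT_eqb w v)) (fvT B)
  end.

Fixpoint substtT (v : varT) (s : tmT (fst v)) {m} (t : tmT m) {struct t} : tmT m :=
  match t in tmT m return tmT m with
  | tvar m i =>
      match Nat.eq_dec (fst v) m with
      | left e => if Nat.eqb (snd v) i then eq_rect (fst v) tmT s m e else tvar m i
      | right _ => tvar m i
      end
  | tzero => tzero
  | tsucc a => tsucc (substtT v s a)
  | tplus a b => tplus (substtT v s a) (substtT v s b)
  | ttimes a b => ttimes (substtT v s a) (substtT v s b)
  end.

Fixpoint substT (v : varT) (s : tmT (fst v)) (A : fmT) : fmT :=
  match A with
  | fEq n t u => fEq n (substtT v s t) (substtT v s u)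
  | fIn n t u => fIn n (substtT v s t) (substtT v s u)
  | fBot => fBot
  | fAnd A B => fAnd (substT v s A) (substT v s B)
  | fOr A B => fOr (substT v s A) (substT v s B)
  | fImp A B => fImp (substT v s A) (substT v s B)
  | fAll w B => if varT_eqb w v then fAll w B else fAll w (substT v s B)
  | fEx w B => if varT_eqb w v then fEx w B else fEx w (substT v s B)
  end.

Fixpoint freeforT (v : varT) (s : tmT (fst v)) (A : fmT) : Prop :=
  match A with
  | fEq _ _ _ | fIn _ _ _ | fBot => True
  | fAnd A B | fOr A B | fImp A B => freeforT v s A /\ freeforT v s B
  | fAll w B | fEx w B =>
      if varT_eqb w v then True
      else (In v (fvT B) -> ~ In w (fvtT s)) /\ freeforT v s B
  end.

Definition LTI : Lang := {|
  L_Var := varT; L_Tm := fun v => tmT (fst v); L_Fm := fmT;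
  L_adm := fun _ _ => True;
  L_bot := fBot; L_imp := fImp; L_and := fAnd; L_or := fOr;
  L_all := fAll; L_ex := fEx;
  L_eq := fun v t u => fEq (fst v) t u;
  L_subst := substT; L_freefor := freeforT;
  L_free := fun v A => In v (fvT A) |}.

Fixpoint tyT {n} (t : tmT n) : nat :=
  match t with
  | tvar m _ => m
  | tzero => 0
  | tsucc a => tyT a
  | tplus a b => Nat.max (tyT a) (tyT b)
  | ttimes a b => Nat.max (tyT a) (tyT b)
  end.

Fixpoint tyFT (A : fmT) : nat :=
  match A with
  | fEq n t u => Nat.max n (Nat.max (tyT t) (tyT u))
  | fIn n t u => Nat.max (S n) (Nat.max (tyT t) (tyT u))
  | fBot => 0
  | fAnd A B | fOr A B | fImp A B => Nat.max (tyFT A) (tyFT B)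
  | fAll v B | fEx v B => Nat.max (fst v) (tyFT B)
  end.

Definition inTI (s : nat) (A : fmT) : Prop := tyFT A <= s.

Definition srtT (A : fmT) : nat := fold_right (fun v m => Nat.max (fst v) m) 0 (fvT A).

Definition notT (A : fmT) : fmT := fImp A fBot.
Definition iffT (A B : fmT) : fmT := fAnd (fImp A B) (fImp B A).
Definition tv0 (i : nat) : tmT 0 := tvar 0 i.

Inductive AxTI : fmT -> Prop :=
| axT_succ0 i : AxTI (notT (fEq 0 (tsucc (tv0 i)) tzero))
| axT_succinj i j :
    AxTI (fImp (fEq 0 (tsucc (tv0 i)) (tsucc (tv0 j))) (fEq 0 (tv0 i) (tv0 j)))
| axT_plus0 i : AxTI (fEq 0 (tplus (tv0 i) tzero) (tv0 i))
| axT_plusS i j :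
    AxTI (fEq 0 (tplus (tv0 i) (tsucc (tv0 j))) (tsucc (tplus (tv0 i) (tv0 j))))
| axT_times0 i : AxTI (fEq 0 (ttimes (tv0 i) tzero) tzero)
| axT_timesS i j :
    AxTI (fEq 0 (ttimes (tv0 i) (tsucc (tv0 j))) (tplus (ttimes (tv0 i) (tv0 j)) (tv0 i)))
| axT_ind i A :
    AxTI (fImp (fAnd (substT (0, i) tzero A)
                     (fAll (0, i) (fImp A (substT (0, i) (tsucc (tv0 i)) A))))
               (fAll (0, i) A))
| axT_comp n a b A :
    srtT A <= S n -> ~ In (S n, a) (fvT A) ->
    AxTI (fEx (S n, a) (fAll (n, b) (iffT (fIn n (tvar n b) (tvar (S n) a)) A)))
| axT_ext n a b c :
    AxTI (fImp (fAll (n, c) (iffT (fIn n (tvar n c) (tvar (S n) a))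
                                  (fIn n (tvar n c) (tvar (S n) b))))
               (fEq (S n) (tvar (S n) a) (tvar (S n) b))).

Definition ProvTI_s (s : nat) (A : fmT) : Prop := Prf LTI true (inTI s) AxTI A.
Definition ProvTI (A : fmT) : Prop := Prf LTI true (fun _ => True) AxTI A.

(* kinds of functional variables: F^n (general), A^n (lawlike), lawless *)
Inductive vkind := kGen | kLaw | kLL.

Definition vkind_eqb (k k' : vkind) : bool :=
  match k, k' with
  | kGen, kGen | kLaw, kLaw | kLL, kLL => true
  | _, _ => false
  end.

(* [VN i] : number variable x_i;  [VF k n i] : variable of kind k and type n+1 *)
Inductive lvar := VN (i : nat) | VF (k : vkind) (n i : nat).

Definition lsort (x : lvar) : nat := match x with VN _ => 0 | VF _ n _ => S n end.
Definition lidx (x : lvar) : nat := match x with VN i => i | VF _ _ i => i end.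

Definition lvar_eqb (x y : lvar) : bool :=
  match x, y with
  | VN i, VN j => Nat.eqb i j
  | VF k n i, VF k' n' i' => vkind_eqb k k' && Nat.eqb n n' && Nat.eqb i i'
  | _, _ => false
  end.

Inductive tmL : nat -> Type :=
| lnvar (i : nat) : tmL 0
| lfvar (k : vkind) (n i : nat) : tmL (S n)
| lzero : tmL 0
| lK (n : nat) : tmL (S n)
| lsucc : tmL 0 -> tmL 0
| lplus : tmL 0 -> tmL 0 -> tmL 0
| ltimes : tmL 0 -> tmL 0 -> tmL 0
| lN (n : nat) : tmL (S n) -> tmL (S n)
| lapp (n : nat) : tmL (S n) -> tmL 0 -> tmL n.

(* formulas of LP; [lProv z A] is  |-_z A ; formulas of L are those without lProv *)
Inductive fmL : Type :=
| lEq (n : nat) (t u : tmL n)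
| lProv (z : tmL 0) (A : fmL)
| lBot
| lAnd (A B : fmL) | lOr (A B : fmL) | lImp (A B : fmL)
| lAll (x : lvar) (A : fmL) | lEx (x : lvar) (A : fmL).

Fixpoint fvtL {n} (t : tmL n) : list lvar :=
  match t with
  | lnvar i => [VN i]
  | lfvar k m i => [VF k m i]
  | lzero => []
  | lK _ => []
  | lsucc a => fvtL a
  | lplus a b => fvtL a ++ fvtL b
  | ltimes a b => fvtL a ++ fvtL b
  | lN _ Z => fvtL Z
  | lapp _ Z a => fvtL Z ++ fvtL a
  end.

Fixpoint fvL (A : fmL) : list lvar :=
  match A with
  | lEq _ t u => fvtL t ++ fvtL u
  | lProv z B => fvtL z ++ fvL B
  | lBot => []
  | lAnd A B | lOr A B | lImp A B => fvL A ++ fvL B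
  | lAll x B | lEx x B => filter (fun w => negb (lvar_eqb w x)) (fvL B)
  end.

Fixpoint substtL (x : lvar) (s : tmL (lsort x)) {m} (t : tmL m) {struct t} : tmL m :=
  match t in tmL m return tmL m with
  | lnvar i =>
      match x as x0 return tmL (lsort x0) -> tmL 0 with
      | VN j => fun s0 => if Nat.eqb i j then s0 else lnvar i
      | VF _ _ _ => fun _ => lnvar i
      end s
  | lfvar k n i =>
      match x as x0 return tmL (lsort x0) -> tmL (S n) with
      | VN _ => fun _ => lfvar k n i
      | VF k' n' i' => fun s0 =>
          if vkind_eqb k k' && Nat.eqb i i' then
            match Nat.eq_dec n' n with
            | left e => eq_rect n' (fun q => tmL (S q)) s0 n e
            | right _ => lfvar k n i
            end
          else lfvar k n i
      end s
  | lzero => lzero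
  | lK n => lK n
  | lsucc a => lsucc (substtL x s a)
  | lplus a b => lplus (substtL x s a) (substtL x s b)
  | ltimes a b => ltimes (substtL x s a) (substtL x s b)
  | lN n Z => lN n (substtL x s Z)
  | lapp n Z a => lapp n (substtL x s Z) (substtL x s a)
  end.

Fixpoint substL (x : lvar) (s : tmL (lsort x)) (A : fmL) : fmL :=
  match A with
  | lEq n t u => lEq n (substtL x s t) (substtL x s u)
  | lProv z B => lProv (substtL x s z) (substL x s B)
  | lBot => lBot
  | lAnd A B => lAnd (substL x s A) (substL x s B)
  | lOr A B => lOr (substL x s A) (substL x s B)
  | lImp A B => lImp (substL x s A) (substL x s B)
  | lAll y B => if lvar_eqb y x then lAll y B else lAll y (substL x s B)
  | lEx y B => if lvar_eqb y x then lEx y B else lEx y (substL x s B)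
  end.

Fixpoint freeforL (x : lvar) (s : tmL (lsort x)) (A : fmL) : Prop :=
  match A with
  | lEq _ _ _ | lBot => True
  | lProv _ B => freeforL x s B
  | lAnd A B | lOr A B | lImp A B => freeforL x s A /\ freeforL x s B
  | lAll y B | lEx y B =>
      if lvar_eqb y x then True
      else (In x (fvL B) -> ~ In y (fvtL s)) /\ freeforL x s B
  end.

Fixpoint lawlikeTm {n} (t : tmL n) : bool :=
  match t with
  | lnvar _ => true
  | lfvar k _ _ => vkind_eqb k kLaw
  | lzero => true
  | lK _ => true
  | lsucc a => lawlikeTm a
  | lplus a b => lawlikeTm a && lawlikeTm b
  | ltimes a b => lawlikeTm a && lawlikeTm b
  | lN _ Z => lawlikeTm Z
  | lapp _ Z a => lawlikeTm Z && lawlikeTm a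
  end.

Fixpoint law1Tm {n} (t : tmL n) : bool :=
  match t with
  | lnvar _ => true
  | lfvar k m _ => vkind_eqb k kLaw && Nat.eqb m 0
  | lzero => true
  | lK _ => true
  | lsucc a => law1Tm a
  | lplus a b => law1Tm a && law1Tm b
  | ltimes a b => law1Tm a && law1Tm b
  | lN _ Z => law1Tm Z
  | lapp _ Z a => law1Tm Z && law1Tm a
  end.

Definition admL (x : lvar) : tmL (lsort x) -> Prop :=
  match x as x0 return tmL (lsort x0) -> Prop with
  | VN _ => fun _ => True
  | VF kGen _ _ => fun _ => True
  | VF kLaw _ _ => fun t => lawlikeTm t = true
  | VF kLL n _ => fun t => exists j, t = lfvar kLL n j
  end.

Definition LLP : Lang := {|
  L_Var := lvar; L_Tm := fun x => tmL (lsort x); L_Fm := fmL;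
  L_adm := admL;
  L_bot := lBot; L_imp := lImp; L_and := lAnd; L_or := lOr;
  L_all := lAll; L_ex := lEx;
  L_eq := fun x t u => lEq (lsort x) t u;
  L_subst := substL; L_freefor := freeforL;
  L_free := fun x A => In x (fvL A) |}.

Fixpoint isL (A : fmL) : bool :=
  match A with
  | lEq _ _ _ | lBot => true
  | lProv _ _ => false
  | lAnd A B | lOr A B | lImp A B => isL A && isL B
  | lAll _ B | lEx _ B => isL B
  end.

Fixpoint wfLP (A : fmL) : bool :=
  match A with
  | lEq _ _ _ | lBot => true
  | lProv _ B => isL B
  | lAnd A B | lOr A B | lImp A B => wfLP A && wfLP B
  | lAll _ B | lEx _ B => wfLP B
  end.

Fixpoint tytL {n} (t : tmL n) : nat :=
  match t with
  | lnvar _ => 0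
  | lfvar _ m _ => S m
  | lzero => 0
  | lK m => S m
  | lsucc a => tytL a
  | lplus a b => Nat.max (tytL a) (tytL b)
  | ltimes a b => Nat.max (tytL a) (tytL b)
  | lN m Z => Nat.max (S m) (tytL Z)
  | lapp m Z a => Nat.max (S m) (Nat.max (tytL Z) (tytL a))
  end.

Fixpoint tyFL (A : fmL) : nat :=
  match A with
  | lEq n t u => Nat.max n (Nat.max (tytL t) (tytL u))
  | lProv z B => Nat.max (tytL z) (tyFL B)
  | lBot => 0
  | lAnd A B | lOr A B | lImp A B => Nat.max (tyFL A) (tyFL B)
  | lAll x B | lEx x B => Nat.max (lsort x) (tyFL B)
  end.

Definition inLP (s : nat) (A : fmL) : Prop := wfLP A = true /\ tyFL A <= s.

Definition sortL (A : fmL) : nat := fold_right (fun x m => Nat.max (lsort x) m) 0 (fvL A).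

Fixpoint mxtL {n} (t : tmL n) : nat :=
  match t with
  | lnvar i => i
  | lfvar _ _ i => i
  | lzero => 0
  | lK _ => 0
  | lsucc a => mxtL a
  | lplus a b => Nat.max (mxtL a) (mxtL b)
  | ltimes a b => Nat.max (mxtL a) (mxtL b)
  | lN _ Z => mxtL Z
  | lapp _ Z a => Nat.max (mxtL Z) (mxtL a)
  end.

Fixpoint mxfL (A : fmL) : nat :=
  match A with
  | lEq _ t u => Nat.max (mxtL t) (mxtL u)
  | lProv z B => Nat.max (mxtL z) (mxfL B)
  | lBot => 0
  | lAnd A B | lOr A B | lImp A B => Nat.max (mxfL A) (mxfL B)
  | lAll x B | lEx x B => Nat.max (lidx x) (mxfL B)
  end.

Definition lnot (A : fmL) : fmL := lImp A lBot.
Definition liff (A B : fmL) : fmL := lAnd (lImp A B) (lImp B A).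
Definition nv (i : nat) : tmL 0 := lnvar i.

Definition lle (a b : tmL 0) (d : nat) : fmL := lEx (VN d) (lEq 0 (lplus a (nv d)) b).
Definition llt (a b : tmL 0) (d : nat) : fmL :=
  lEx (VN d) (lEq 0 (lplus (lsucc a) (nv d)) b).

Definition Kc (n : nat) : tmL n := match n with 0 => lzero | S m => lK m end.

Fixpoint app0s (k : nat) : tmL k -> tmL 0 :=
  match k with
  | 0 => fun t => t
  | S k' => fun t => app0s k' (lapp k' t lzero)
  end.

Fixpoint appz (d : nat) {j : nat} : tmL (d + j) -> tmL j :=
  match d with
  | 0 => fun t => t
  | S d' => fun t => appz d' (lapp (d' + j) t lzero)
  end.

(* Coding of finite sequences (bijective):  <> = 0,  y * <x> = S (pi(y,x)),
   with pi the Cantor pairing, 2 pi(a,b) = (a+b)(a+b+1) + 2b. *)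
Definition pairEq (a b p : tmL 0) : fmL :=
  lEq 0 (lplus p p) (lplus (ltimes (lplus a b) (lsucc (lplus a b))) (lplus b b)).

Definition BI_ax (v : nat) (phi psi : fmL) : fmL :=
  let n0 := S (Nat.max v (Nat.max (mxfL phi) (mxfL psi))) in
  let F := VF kGen 0 n0 in
  let Ft := lfvar kGen 0 n0 in
  let G := VF kGen 0 (n0 + 1) in
  let Gt := lfvar kGen 0 (n0 + 1) in
  let x := n0 + 2 in
  let y := n0 + 3 in
  let u := n0 + 4 in
  let p := n0 + 5 in
  let d := n0 + 6 in
  let at_ (A : fmL) (t : tmL 0) := substL (VN v) t A in
  (* A(y * <x>) *)
  let atSnoc (A : fmL) :=
      lEx (VN p) (lAnd (pairEq (nv y) (nv x) (nv p)) (at_ A (lsucc (nv p)))) in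
  (* A(\bar F(x)) *)
  let atBar (A : fmL) :=
      lEx G (lAnd (lEq 0 (lapp 0 Gt lzero) lzero)
              (lAnd (lAll (VN u) (lImp (llt (nv u) (nv x) d)
                        (lEx (VN p) (lAnd (pairEq (lapp 0 Gt (nv u)) (lapp 0 Ft (nv u)) (nv p))
                                          (lEq 0 (lapp 0 Gt (lsucc (nv u))) (lsucc (nv p)))))))
                    (at_ A (lapp 0 Gt (nv x))))) in
  lImp (lAnd (lAll F (lEx (VN x) (atBar phi)))
       (lAnd (lAll (VN x) (lAll (VN y) (lImp (at_ phi (nv y)) (atSnoc phi))))
       (lAnd (lAll (VN y) (lImp (lAll (VN x) (atSnoc psi)) (at_ psi (nv y))))
             (lAll (VN y) (lImp (at_ phi (nv y)) (at_ psi (nv y)))))))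
       (at_ psi lzero).

Definition LL3cond (m h : nat) (A : fmL) : Prop :=
  forall w, In w (fvL A) ->
    lsort w <= S m /\ (forall j, w <> VF kGen m j) /\ (forall j, w = VF kLL m j -> j = h).

Definition LL3_ax (m h : nat) (A : fmL) : fmL :=
  let n0 := S (Nat.max h (mxfL A)) in
  let x := n0 in let y := n0 + 1 in let g := n0 + 2 in
  lImp A (lEx (VN x) (lAll (VF kLL m g)
     (lImp (lAll (VN y) (lImp (llt (nv y) (nv x) (n0 + 3))
                              (lEq m (lapp m (lfvar kLL m g) (nv y)) (lapp m (lfvar kLL m h) (nv y)))))
           (substL (VF kLL m h) (lfvar kLL m g) A)))).

Definition C1_term (d x f : nat) : tmL 0 := app0s d (lapp d (lfvar kGen d f) (nv x)).
Definition C1_ax (d x y : nat) (A : fmL) : fmL :=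
  let f := S (Nat.max (Nat.max x y) (mxfL A)) in
  lImp (lAll (VN x) (lEx (VN y) A))
       (lEx (VF kGen d f) (lAll (VN x) (substL (VN y) (C1_term d x f) A))).

(* (C2): G of type n = S n', F of type m = S (d + n), term F(x)(0)^(m-n-1) *)
Definition C2_term (d n' x f : nat) : tmL (S n') :=
  appz d (lapp (d + S n') (lfvar kGen (d + S n') f) (nv x)).
Definition C2_ax (d n' g x : nat) (A : fmL) : fmL :=
  let f := S (Nat.max (Nat.max g x) (mxfL A)) in
  let g' := S f in
  lImp (lAll (VN x) (lEx (VF kGen n' g)
          (lAnd A (lAll (VF kGen n' g')
             (lImp (substL (VF kGen n' g) (lfvar kGen n' g') A)
                   (lEq (S n') (lfvar kGen n' g') (lfvar kGen n' g)))))))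
       (lEx (VF kGen (d + S n') f) (lAll (VN x) (substL (VF kGen n' g) (C2_term d n' x f) A))).

Inductive AxSLP : fmL -> Prop :=
| aL_succ0 i : AxSLP (lnot (lEq 0 (lsucc (nv i)) lzero))
| aL_succinj i j : AxSLP (lImp (lEq 0 (lsucc (nv i)) (lsucc (nv j))) (lEq 0 (nv i) (nv j)))
| aL_plus0 i : AxSLP (lEq 0 (lplus (nv i) lzero) (nv i))
| aL_plusS i j : AxSLP (lEq 0 (lplus (nv i) (lsucc (nv j))) (lsucc (lplus (nv i) (nv j))))
| aL_times0 i : AxSLP (lEq 0 (ltimes (nv i) lzero) lzero)
| aL_timesS i j :
    AxSLP (lEq 0 (ltimes (nv i) (lsucc (nv j))) (lplus (ltimes (nv i) (nv j)) (nv i)))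
| aL_ind i A :
    AxSLP (lImp (lAnd (substL (VN i) lzero A)
                      (lAll (VN i) (lImp A (substL (VN i) (lsucc (nv i)) A))))
                (lAll (VN i) A))
| aL_K n i : AxSLP (lEq n (lapp n (Kc (S n)) (nv i)) (Kc n))
| aL_N1 m i : AxSLP (lnot (lEq (S m) (lN m (lfvar kGen m i)) (lK m)))
| aL_N2 m i j :
    AxSLP (lEq (S m) (lapp (S m) (lN (S m) (lfvar kGen (S m) i)) (nv j))
                     (lN m (lapp (S m) (lfvar kGen (S m) i) (nv j))))
| aL_N3 m i j :
    AxSLP (lImp (lEq (S m) (lN m (lfvar kGen m i)) (lN m (lfvar kGen m j)))
                (lEq (S m) (lfvar kGen m i) (lfvar kGen m j)))
| aL_law t i : law1Tm t = true ->
    AxSLP (lEx (VF kLaw 0 (S (mxtL t)))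
             (lAll (VN i) (lEq 0 (lapp 0 (lfvar kLaw 0 (S (mxtL t))) (nv i)) t)))
| aL_CS1 z A : isL A = true -> AxSLP (lOr (lProv (nv z) A) (lnot (lProv (nv z) A)))
| aL_CS2 z y A : isL A = true ->
    AxSLP (lImp (lProv (nv z) A) (lProv (lplus (nv z) (nv y)) A))
| aL_CS3 z A : isL A = true -> ~ In (VN z) (fvL A) ->
    AxSLP (liff (lEx (VN z) (lProv (nv z) A)) A)
| aL_LL1 m a b x y : x <> y ->
    AxSLP (lEx (VF kLL m a) (lAll (VN y)
             (lImp (lle (nv y) (nv x) (S (x + y)))
                   (lEq m (lapp m (lfvar kLL m a) (nv y)) (lapp m (lfvar kGen m b) (nv y))))))
| aL_LL2 m a b :
    AxSLP (lOr (lEq (S m) (lfvar kLL m a) (lfvar kLL m b))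
               (lnot (lEq (S m) (lfvar kLL m a) (lfvar kLL m b))))
| aL_LL3 m h A : LL3cond m h A -> AxSLP (LL3_ax m h A)
| aL_C1 d x y A : x <> y -> sortL A <= S d ->
    freeforL (VN y) (C1_term d x (S (Nat.max (Nat.max x y) (mxfL A)))) A ->
    AxSLP (C1_ax d x y A)
| aL_C2 d n' g x A : sortL A <= S (d + S n') ->
    freeforL (VF kGen n' g) (C2_term d n' x (S (Nat.max (Nat.max g x) (mxfL A)))) A ->
    AxSLP (C2_ax d n' g x A)
| aL_BI v A B : AxSLP (BI_ax v A B).

Definition ProvSLP_s (s : nat) (A : fmL) : Prop := Prf LLP false (inLP s) AxSLP A.
Definition ProvSLP (A : fmL) : Prop := Prf LLP false (fun A => wfLP A = true) AxSLP A.

Fixpoint approx (n : nat) : tmT n -> tmT n -> fmT :=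
  match n with
  | 0 => fun x y => fEq 0 x y
  | S m => fun x y =>
      fAnd (fAll (m, 0) (fImp (fIn m (tvar m 0) x)
              (fEx (m, 1) (fAnd (fIn m (tvar m 1) y) (approx m (tvar m 0) (tvar m 1))))))
           (fAll (m, 0) (fImp (fIn m (tvar m 0) y)
              (fEx (m, 1) (fAnd (fIn m (tvar m 1) x) (approx m (tvar m 0) (tvar m 1))))))
  end.

Fixpoint mxT {n} (t : tmT n) : nat :=
  match t with
  | tvar _ i => i
  | tzero => 0
  | tsucc a => mxT a
  | tplus a b => Nat.max (mxT a) (mxT b)
  | ttimes a b => Nat.max (mxT a) (mxT b)
  end.

Fixpoint star (A : fmT) : fmT :=
  match A with
  | fEq n t u => approx n t u
  | fIn n t u =>
      let z := S (mxT t) in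
      fEx (n, z) (fAnd (fIn n (tvar n z) u) (approx n (tvar n z) t))
  | fBot => fBot
  | fAnd A B => fAnd (star A) (star B)
  | fOr A B => fOr (star A) (star B)
  | fImp A B => fImp (star A) (star B)
  | fAll v B => fAll v (star B)
  | fEx v B => fEx v (star B)
  end.

Fixpoint trtm {n} (t : tmT n) : tmL n :=
  match t in tmT n return tmL n with
  | tvar n i => match n return tmL n with 0 => lnvar i | S m => lfvar kGen m i end
  | tzero => lzero
  | tsucc a => lsucc (trtm a)
  | tplus a b => lplus (trtm a) (trtm b)
  | ttimes a b => ltimes (trtm a) (trtm b)
  end.

Definition trvar (v : varT) : lvar :=
  match v with (0, i) => VN i | (S m, i) => VF kGen m i end.

Fixpoint prime (A : fmT) : fmL :=
  match A with
  | fEq n t u => lEq n (trtm t) (trtm u)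
  | fIn n t u =>
      match n return tmT n -> tmT (S n) -> fmL with
      | 0 => fun t u =>
          let y := S (mxtL (trtm t)) in
          lEx (VN y) (lEq 0 (lapp 0 (trtm u) (nv y)) (lsucc (trtm t)))
      | S m => fun t u =>
          let y := S (mxtL (trtm t)) in
          lEx (VN y) (lEq (S m) (lapp (S m) (trtm u) (nv y)) (lN m (trtm t)))
      end t u
  | fBot => lBot
  | fAnd A B => lAnd (prime A) (prime B)
  | fOr A B => lOr (prime A) (prime B)
  | fImp A B => lImp (prime A) (prime B)
  | fAll v B => lAll (trvar v) (prime B)
  | fEx v B => lEx (trvar v) (prime B)
  end.

Fixpoint negt (A : fmL) : fmL :=
  match A with
  | lEq n t u => lnot (lnot (lEq n t u))
  | lProv z B => lnot (lnot (lProv z B))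
  | lBot => lBot
  | lAnd A B => lAnd (negt A) (negt B)
  | lOr A B => lnot (lAnd (lnot (negt A)) (lnot (negt B)))
  | lImp A B => lImp (negt A) (negt B)
  | lAll x B => lAll x (negt B)
  | lEx x B => lnot (lAll x (lnot (negt B)))
  end.

Definition int (A : fmT) : fmL := negt (prime (star A)).

Definition closeT (A : fmT) : fmT := fold_right fAll A (fvT A).

(* Main.v *)
(** The negative formulas of SLP are interpreted in a Kripke model whose worlds
    are contexts [G] and whose atoms hold at [G] when [G] derives them; the
    domain consists of the terms over variables of index at least [N].  With
    [N] above every index in a formula [B], substitution into [B] never
    captures, and [B] holds at [G] iff [G] derives it ([reify_reflect]).  In the
    model the bound-variable names chosen by the translation [int] disappear,
    and the truth of a TI theorem is checked as for the Gödel-Gentzen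
    translation, with [=] read as the extensional [apx].

    Comprehension is the only axiom that needs SLP proper.  Let [H] be a lawless
    functional of type [n+1].  By (LL3) and (LL1) it cannot be that [H] omits a
    given [g] of type [n] from some stage on.  By (C) there is [F] with
    [F w = N (H w)] if [|-_w phi (H w)] and [F w = K] otherwise; by (CS) the
    elements of [F] are then, up to double negation, the [g] with [phi g]. *)

From Stdlib Require Import Arith List Bool Lia Eqdep_dec.
Require Import Defs.
Import ListNotations.

Local Arguments Nat.max : simpl never.

(** * Variables and substitution *)

(** A model is used because [int] takes bound names from the indices of the terms it meets:
    [int (substT v t A)] is not literally a substitution instance of [int A], and the calculus
    relates formulas with different bound names only through proofs. A purely syntactic induction on
    derivations would carry such renamings through every quantifier rule. A threshold [N] exists
    because a derivation contains finitely many formulas; for the same reason it uses finitely many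
    types, which reduces (2) to (1).

    In comprehension the obstacle is that (C) defines a functional by cases only along a decidable
    condition, and [phi] is not decidable. By (CS1) the statement that [phi] is proved at stage [w]
    is decidable, but then a listing indexed by stages has to reach every [g], late enough, even
    when [g] is itself a functional. A lawless [H] provides such a listing up to double negation,
    which suffices since membership is translated negatively. What remains is the gap between
    literal membership in [F] and membership up to extensional equality; it closes because
    translated formulas are invariant under that equality. *)

Lemma vkind_eqb_spec k k' : reflect (k = k') (vkind_eqb k k').
Proof. destruct k, k'; constructor; congruence. Qed.

Lemma lvar_eq_dec (x y : lvar) : {x = y} + {x <> y}.
Proof. decide equality; try apply Nat.eq_dec; decide equality. Defined.

Lemma lvar_eqb_spec x y : reflect (x = y) (lvar_eqb x y).
Proof.
  destruct x as [i|k n i], y as [j|k' n' j]; simpl; try (constructor; congruence).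
  - destruct (Nat.eqb_spec i j); constructor; congruence.
  - destruct (vkind_eqb_spec k k'), (Nat.eqb_spec n n'), (Nat.eqb_spec i j);
      simpl; constructor; congruence.
Qed.

Lemma In_fv_bind x y l :
  In x (filter (fun w => negb (lvar_eqb w y)) l) <-> In x l /\ x <> y.
Proof.
  rewrite filter_In. destruct (lvar_eqb_spec x y); simpl; intuition congruence.
Qed.

Definition vt (x : lvar) : tmL (lsort x) :=
  match x with VN i => lnvar i | VF k n i => lfvar k n i end.

Lemma fvtL_vt x : fvtL (vt x) = [x].
Proof. destruct x; reflexivity. Qed.

Lemma tytL_vt x : tytL (vt x) = lsort x.
Proof. destruct x; reflexivity. Qed.

Lemma substtL_same x s : substtL x s (vt x) = s.
Proof.
  destruct x as [i|k n i]; simpl.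
  - rewrite Nat.eqb_refl; reflexivity.
  - rewrite Nat.eqb_refl. destruct (vkind_eqb_spec k k); [simpl|congruence].
    destruct (Nat.eq_dec n n); [|congruence].
    rewrite <- (eq_rect_eq_dec Nat.eq_dec); reflexivity.
Qed.

Lemma substtL_other x y s : x <> y -> substtL x s (vt y) = vt y.
Proof.
  intros H; destruct x as [i|k n i], y as [j|k' n' j]; simpl; try reflexivity.
  - destruct (Nat.eqb_spec j i); congruence.
  - destruct (vkind_eqb_spec k' k), (Nat.eqb_spec j i); simpl; try reflexivity.
    destruct (Nat.eq_dec n n'); congruence.
Qed.

Lemma fvtL_idx {n} (t : tmL n) x : In x (fvtL t) -> lidx x <= mxtL t.
Proof.
  induction t; simpl; intros H; try (rewrite in_app_iff in H);
    try (destruct H as [H|H]; subst; simpl; try lia; try tauto); intuition lia.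
Qed.

Lemma fvL_idx A x : In x (fvL A) -> lidx x <= mxfL A.
Proof.
  induction A; simpl; rewrite ?in_app_iff, ?In_fv_bind; intros H;
    repeat match goal with
    | H : _ \/ _ |- _ => destruct H
    | H : In _ (fvtL _) |- _ => apply fvtL_idx in H
    end; intuition lia.
Qed.

Lemma fvtL_sort {n} (t : tmL n) x : In x (fvtL t) -> lsort x <= tytL t.
Proof.
  induction t; simpl; intros H; try (rewrite in_app_iff in H);
    try (destruct H as [H|H]; subst; simpl; try lia; try tauto); intuition lia.
Qed.

Lemma fvL_sort A x : In x (fvL A) -> lsort x <= tyFL A.
Proof.
  induction A; simpl; rewrite ?in_app_iff, ?In_fv_bind; intros H;
    repeat match goal with
    | H : _ \/ _ |- _ => destruct H
    | H : In _ (fvtL _) |- _ => apply fvtL_sort in H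
    end; intuition lia.
Qed.

Lemma substtL_notfree x s {n} (t : tmL n) : ~ In x (fvtL t) -> substtL x s t = t.
Proof.
  induction t; intros H; try reflexivity.
  - apply (substtL_other x (VN i)). simpl in H; intuition.
  - apply (substtL_other x (VF k n i)). simpl in H; intuition.
  - simpl in *; f_equal; auto.
  - simpl in *; rewrite in_app_iff in H; f_equal; intuition.
  - simpl in *; rewrite in_app_iff in H; f_equal; intuition.
  - simpl in *; f_equal; auto.
  - simpl in *; rewrite in_app_iff in H; f_equal; intuition.
Qed.

Lemma substL_notfree x s A : ~ In x (fvL A) -> substL x s A = A.
Proof.
  induction A; simpl; rewrite ?in_app_iff, ?In_fv_bind; intros H;
    rewrite ?substtL_notfree by intuition; f_equal; intuition.
  - destruct (lvar_eqb_spec x0 x); f_equal; apply IHA; intuition congruence.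
  - destruct (lvar_eqb_spec x0 x); f_equal; apply IHA; intuition congruence.
Qed.

Lemma freeforL_notfree x s A : ~ In x (fvL A) -> freeforL x s A.
Proof.
  induction A; simpl; rewrite ?in_app_iff, ?In_fv_bind; intros H; intuition.
  - destruct (lvar_eqb_spec x0 x); intuition congruence.
  - destruct (lvar_eqb_spec x0 x); intuition congruence.
Qed.

Lemma substtL_id x {n} (t : tmL n) : substtL x (vt x) t = t.
Proof.
  induction t; try (simpl; f_equal; assumption); try reflexivity.
  - change (substtL x (vt x) (vt (VN i)) = vt (VN i)).
    destruct (lvar_eq_dec x (VN i)) as [->|H]; [apply substtL_same|apply substtL_other, H].
  - change (substtL x (vt x) (vt (VF k n i)) = vt (VF k n i)).
    destruct (lvar_eq_dec x (VF k n i)) as [->|H]; [apply substtL_same|apply substtL_other, H].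
Qed.

Lemma substL_id x A : substL x (vt x) A = A.
Proof.
  induction A; simpl; rewrite ?substtL_id; try congruence.
  - destruct lvar_eqb; congruence.
  - destruct lvar_eqb; congruence.
Qed.

Lemma freeforL_id x A : freeforL x (vt x) A.
Proof.
  induction A; simpl; auto; destruct (lvar_eqb_spec x0 x) as [|H]; auto;
    (split; [|assumption]); intros _; rewrite fvtL_vt; simpl; intuition.
Qed.

Lemma fvtL_substtL_in x s {n} (t : tmL n) u :
  In x (fvtL t) -> In u (fvtL s) -> In u (fvtL (substtL x s t)).
Proof.
  intros Hx Hu; induction t; simpl in Hx; rewrite ?in_app_iff in Hx; try (exfalso; exact Hx).
  - destruct Hx as [<-|[]]. change (lnvar i) with (vt (VN i)). now rewrite substtL_same.
  - destruct Hx as [<-|[]].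
    change (In u (fvtL (substtL (VF k n i) s (vt (VF k n i))))). now rewrite substtL_same.
  - simpl; auto.
  - simpl; rewrite in_app_iff; tauto.
  - simpl; rewrite in_app_iff; tauto.
  - simpl; auto.
  - simpl; rewrite in_app_iff; tauto.
Qed.

Lemma tytL_substtL s0 x s {n} (t : tmL n) :
  tytL s <= s0 -> tytL t <= s0 -> tytL (substtL x s t) <= s0.
Proof.
  intros Hs; induction t; intros H; try (simpl in *; lia).
  - destruct (lvar_eq_dec x (VN i)) as [->|Hn].
    + change (lnvar i) with (vt (VN i)). now rewrite substtL_same.
    + change (tytL (substtL x s (vt (VN i))) <= s0). rewrite substtL_other by assumption. simpl; lia.
  - destruct (lvar_eq_dec x (VF k n i)) as [->|Hn].
    + change (tytL (substtL (VF k n i) s (vt (VF k n i))) <= s0). now rewrite substtL_same.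
    + change (tytL (substtL x s (vt (VF k n i))) <= s0). now rewrite substtL_other by assumption.
Qed.

Lemma tyFL_substL s0 x s A :
  tytL s <= s0 -> tyFL A <= s0 -> tyFL (substL x s A) <= s0.
Proof.
  intros Hs.
  assert (Ht : forall n (t : tmL n), tytL t <= s0 -> tytL (substtL x s t) <= s0)
    by (intros; now apply tytL_substtL).
  induction A; simpl; intros H;
    try (apply Nat.max_lub_iff in H as [Ha Hb]); repeat apply Nat.max_lub; auto; try lia;
    try (apply Ht; lia);
    destruct lvar_eqb; simpl; apply Nat.max_lub; auto.
Qed.

Lemma isL_substL x s A : isL (substL x s A) = isL A.
Proof.
  induction A; simpl; try congruence; destruct lvar_eqb; simpl; congruence.
Qed.

Lemma wfLP_substL x s A : wfLP (substL x s A) = wfLP A.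
Proof.
  induction A; simpl; try congruence; try (destruct lvar_eqb; simpl; congruence).
  apply isL_substL.
Qed.

Lemma inLP_substL s0 x s A :
  tytL s <= s0 -> inLP s0 A -> inLP s0 (substL x s A).
Proof.
  intros H [H1 H2]; split; [now rewrite wfLP_substL|now apply tyFL_substL].
Qed.

(** * Parallel substitution *)

Definition val := forall x : lvar, tmL (lsort x).

Fixpoint pst (r : val) {n} (t : tmL n) : tmL n :=
  match t in tmL n return tmL n with
  | lnvar i => r (VN i)
  | lfvar k m i => r (VF k m i)
  | lzero => lzero
  | lK m => lK m
  | lsucc a => lsucc (pst r a)
  | lplus a b => lplus (pst r a) (pst r b)
  | ltimes a b => ltimes (pst r a) (pst r b)
  | lN m Z => lN m (pst r Z)
  | lapp m Z a => lapp m (pst r Z) (pst r a)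
  end.

Definition upd (r : val) (x : lvar) (t : tmL (lsort x)) : val :=
  fun y => match lvar_eq_dec x y with
           | left e => eq_rect x (fun z => tmL (lsort z)) t y e
           | right _ => r y
           end.

Lemma upd_same r x t : upd r x t x = t.
Proof.
  unfold upd; destruct (lvar_eq_dec x x); [|congruence].
  now rewrite <- (eq_rect_eq_dec lvar_eq_dec).
Qed.

Lemma upd_other r x t y : x <> y -> upd r x t y = r y.
Proof. intros; unfold upd; destruct (lvar_eq_dec x y); congruence. Qed.

(** Binders are not renamed. Capture is kept out by the indices of the values instead, as in
    [substL_psub]. *)
Fixpoint psub (r : val) (A : fmL) : fmL :=
  match A with
  | lEq n t u => lEq n (pst r t) (pst r u)
  | lProv z B => lProv (pst r z) (psub r B)
  | lBot => lBot
  | lAnd A B => lAnd (psub r A) (psub r B)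
  | lOr A B => lOr (psub r A) (psub r B)
  | lImp A B => lImp (psub r A) (psub r B)
  | lAll x B => lAll x (psub (upd r x (vt x)) B)
  | lEx x B => lEx x (psub (upd r x (vt x)) B)
  end.

Lemma pst_agree r r' {n} (t : tmL n) :
  (forall v, In v (fvtL t) -> r v = r' v) -> pst r t = pst r' t.
Proof.
  induction t; simpl; intros H; try reflexivity;
    try (apply (H (VN i)); simpl; tauto); try (apply (H (VF k n i)); simpl; tauto);
    f_equal; auto; try (apply IHt1; intros; apply H, in_app_iff; auto);
    (apply IHt2; intros; apply H, in_app_iff; auto).
Qed.

Lemma upd_agree r r' x t y : (y <> x -> r y = r' y) -> upd r x t y = upd r' x t y.
Proof.
  intros H; destruct (lvar_eq_dec x y) as [->|Hn].
  - now rewrite !upd_same.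
  - rewrite !upd_other by assumption; apply H; congruence.
Qed.

Lemma psub_agree A : forall r r',
  (forall v, In v (fvL A) -> r v = r' v) -> psub r A = psub r' A.
Proof.
  induction A; simpl; intros r r' H; auto;
    try (f_equal; try apply pst_agree; try (apply IHA); try apply IHA1; try apply IHA2;
         intros; (apply H, in_app_iff; auto) || (apply upd_agree; intros; apply H, In_fv_bind; auto)).
Qed.

Lemma pst_vt {n} (t : tmL n) : pst vt t = t.
Proof. induction t; simpl; congruence. Qed.

Lemma psub_id A : forall r, (forall v, In v (fvL A) -> r v = vt v) -> psub r A = A.
Proof.
  induction A; simpl; intros r H; auto;
    try (f_equal; try (rewrite <- pst_vt; apply pst_agree); try (apply IHA);
         try apply IHA1; try apply IHA2; intros; apply H, in_app_iff; auto).
  - f_equal; apply IHA; intros v Hv. destruct (lvar_eq_dec x v) as [<-|Hn];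
      [apply upd_same|rewrite upd_other by assumption; apply H, In_fv_bind; auto].
  - f_equal; apply IHA; intros v Hv. destruct (lvar_eq_dec x v) as [<-|Hn];
      [apply upd_same|rewrite upd_other by assumption; apply H, In_fv_bind; auto].
Qed.

Lemma fvtL_pst r {n} (t : tmL n) u :
  In u (fvtL (pst r t)) -> exists v, In v (fvtL t) /\ In u (fvtL (r v)).
Proof.
  induction t; simpl; rewrite ?in_app_iff; intros H; try tauto; eauto;
    destruct H as [H|H]; [apply IHt1 in H|apply IHt2 in H|..];
    try (apply IHt1 in H); try (apply IHt2 in H);
    destruct H as (v & ? & ?); exists v; rewrite in_app_iff; auto.
Qed.

Lemma fvL_psub A : forall r u,
  In u (fvL (psub r A)) -> exists v, In v (fvL A) /\ In u (fvtL (r v)).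
Proof.
  induction A; simpl; intros r w; rewrite ?in_app_iff, ?In_fv_bind; intros H; try tauto;
  try (destruct H as [H|H];
    (apply fvtL_pst in H || apply IHA in H || apply IHA1 in H || apply IHA2 in H);
    destruct H as (v & ? & ?); exists v; rewrite in_app_iff; auto; fail).
  - destruct H as [H Hn]. apply IHA in H as (v & Hv & Hw). exists v.
    destruct (lvar_eq_dec x v) as [<-|Hx].
    + rewrite upd_same, fvtL_vt in Hw; simpl in Hw; intuition congruence.
    + rewrite upd_other in Hw by assumption. rewrite In_fv_bind; auto.
  - destruct H as [H Hn]. apply IHA in H as (v & Hv & Hw). exists v.
    destruct (lvar_eq_dec x v) as [<-|Hx].
    + rewrite upd_same, fvtL_vt in Hw; simpl in Hw; intuition congruence.
    + rewrite upd_other in Hw by assumption. rewrite In_fv_bind; auto.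
Qed.

Lemma substtL_pst x s (r1 r2 : val) {n} (t : tmL n) :
  (forall v, In v (fvtL t) -> substtL x s (r1 v) = r2 v) ->
  substtL x s (pst r1 t) = pst r2 t.
Proof.
  induction t; simpl; intros H; try reflexivity;
    try (apply (H (VN i)); simpl; tauto); try (apply (H (VF k n i)); simpl; tauto);
    f_equal; auto; try (apply IHt1; intros; apply H, in_app_iff; auto);
    (apply IHt2; intros; apply H, in_app_iff; auto).
Qed.

(** Bound names of [C] lie below [N], so they cannot occur in a value whose variables all lie at or
    above [N]; the alternative [r2 v = vt v] lets a fresh variable be renamed back to an original
    name. The last hypothesis serves the binders equal to [x], where [substL] stops: either there
    are none, or both valuations agree away from [x]. *)
Lemma substL_psub N x s C : mxfL C < N -> forall r1 r2 : val,
  (forall v, In v (fvL C) -> substtL x s (r1 v) = r2 v) ->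
  (forall v, In v (fvL C) -> (forall u, In u (fvtL (r2 v)) -> N <= lidx u) \/ r2 v = vt v) ->
  (N <= lidx x \/ forall v, v <> x -> r1 v = r2 v) ->
  substL x s (psub r1 C) = psub r2 C /\ freeforL x s (psub r1 C).
Proof.
  assert (Hbind : forall y B, Nat.max (lidx y) (mxfL B) < N ->
    (mxfL B < N -> forall r1 r2 : val,
      (forall v, In v (fvL B) -> substtL x s (r1 v) = r2 v) ->
      (forall v, In v (fvL B) -> (forall u, In u (fvtL (r2 v)) -> N <= lidx u) \/ r2 v = vt v) ->
      (N <= lidx x \/ forall v, v <> x -> r1 v = r2 v) ->
      substL x s (psub r1 B) = psub r2 B /\ freeforL x s (psub r1 B)) ->
    forall r1 r2 : val,
    (forall v, In v (fvL B) /\ v <> y -> substtL x s (r1 v) = r2 v) ->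
    (forall v, In v (fvL B) /\ v <> y ->
       (forall u, In u (fvtL (r2 v)) -> N <= lidx u) \/ r2 v = vt v) ->
    (N <= lidx x \/ forall v, v <> x -> r1 v = r2 v) ->
    let b1 := psub (upd r1 y (vt y)) B in
    (if lvar_eqb y x then b1 else substL x s b1) = psub (upd r2 y (vt y)) B /\
    (if lvar_eqb y x then True else (In x (fvL b1) -> ~ In y (fvtL s)) /\ freeforL x s b1)).
  { intros y B HN IH r1 r2 H1 H2 H3; simpl.
    destruct (lvar_eqb_spec y x) as [->|Hyx].
    - split; [|exact I]. destruct H3 as [H3|H3]; [lia|].
      apply psub_agree; intros v _. apply upd_agree; auto.
    - destruct (IH ltac:(lia) (upd r1 y (vt y)) (upd r2 y (vt y))) as [E F].
      + intros v Hv. destruct (lvar_eq_dec y v) as [<-|Hn].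
        * rewrite !upd_same. apply substtL_other; congruence.
        * rewrite !upd_other by assumption; apply H1; auto.
      + intros v Hv. destruct (lvar_eq_dec y v) as [<-|Hn].
        * rewrite !upd_same; auto.
        * rewrite !upd_other by assumption; apply H2; auto.
      + destruct H3 as [H3|H3]; [auto|right]. intros v Hv. apply upd_agree; auto.
      + split; [exact E|split; [|exact F]].
        (* A captured [y] would occur in [r2 v] for some free [v] of [B] other than [y], against the
           condition on [r2]. *)
        intros Hx Hy. apply fvL_psub in Hx as (v & Hv & Hx).
        destruct (lvar_eq_dec y v) as [<-|Hn].
        * rewrite upd_same, fvtL_vt in Hx; simpl in Hx; intuition congruence.
        * rewrite upd_other in Hx by assumption.
          pose proof (fvtL_substtL_in x s (r1 v) y Hx Hy) as K.
          rewrite H1 in K by auto. destruct (H2 v) as [G|G]; auto.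
          -- specialize (G y K); lia.
          -- rewrite G, fvtL_vt in K; simpl in K; intuition congruence. }
  induction C; simpl; intros HN r1 r2 H1 H2 H3.
  - rewrite (substtL_pst x s r1 r2 t), (substtL_pst x s r1 r2 u); auto;
      intros; apply H1, in_app_iff; auto.
  - destruct (IHC ltac:(lia) r1 r2) as [E F]; auto; try (intros; (apply H1, in_app_iff || apply H2, in_app_iff); auto).
    rewrite (substtL_pst x s r1 r2 z), E; auto.
    intros; apply H1, in_app_iff; auto.
  - auto.
  - destruct (IHC1 ltac:(lia) r1 r2) as [E1 F1]; auto; try (intros; (apply H1, in_app_iff || apply H2, in_app_iff); auto).
    destruct (IHC2 ltac:(lia) r1 r2) as [E2 F2]; auto; try (intros; (apply H1, in_app_iff || apply H2, in_app_iff); auto).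
    rewrite E1, E2; auto.
  - destruct (IHC1 ltac:(lia) r1 r2) as [E1 F1]; auto; try (intros; (apply H1, in_app_iff || apply H2, in_app_iff); auto).
    destruct (IHC2 ltac:(lia) r1 r2) as [E2 F2]; auto; try (intros; (apply H1, in_app_iff || apply H2, in_app_iff); auto).
    rewrite E1, E2; auto.
  - destruct (IHC1 ltac:(lia) r1 r2) as [E1 F1]; auto; try (intros; (apply H1, in_app_iff || apply H2, in_app_iff); auto).
    destruct (IHC2 ltac:(lia) r1 r2) as [E2 F2]; auto; try (intros; (apply H1, in_app_iff || apply H2, in_app_iff); auto).
    rewrite E1, E2; auto.
  - destruct (Hbind x0 C HN IHC r1 r2) as [E F]; auto;
      try (intros; (apply H1, In_fv_bind || apply H2, In_fv_bind); auto).
    simpl in E, F. destruct (lvar_eqb x0 x); rewrite ?E; auto.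
  - destruct (Hbind x0 C HN IHC r1 r2) as [E F]; auto;
      try (intros; (apply H1, In_fv_bind || apply H2, In_fv_bind); auto).
    simpl in E, F. destruct (lvar_eqb x0 x); rewrite ?E; auto.
Qed.

Lemma tytL_pst s (r : val) {n} (t : tmL n) :
  (forall v, lsort v <= s -> tytL (r v) <= s) -> tytL t <= s -> tytL (pst r t) <= s.
Proof.
  intros Hr; induction t; simpl; intros H; try lia.
  - apply (Hr (VN i)); simpl; lia.
  - apply (Hr (VF k n i)); simpl; lia.
Qed.

Lemma isL_psub A : forall r, isL (psub r A) = isL A.
Proof. induction A; simpl; intros; rewrite ?IHA, ?IHA1, ?IHA2; auto. Qed.

Lemma isL_wfLP A : isL A = true -> wfLP A = true.
Proof.
  induction A; simpl; rewrite ?andb_true_iff; intros; try discriminate; intuition.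
Qed.

Lemma inLP_psub s A : forall r,
  (forall v, lsort v <= s -> tytL (r v) <= s) -> inLP s A -> inLP s (psub r A).
Proof.
  unfold inLP.
  assert (Hu : forall (r : val) x, (forall v, lsort v <= s -> tytL (r v) <= s) ->
     forall v, lsort v <= s -> tytL (upd r x (vt x) v) <= s).
  { intros r x Hr v Hv. destruct (lvar_eq_dec x v) as [<-|Hn].
    - now rewrite upd_same, tytL_vt.
    - rewrite upd_other by assumption; auto. }
  induction A; simpl; intros r Hr [H1 H2]; rewrite ?andb_true_iff in *;
   assert (Ht : forall n (t : tmL n), tytL t <= s -> tytL (pst r t) <= s)
     by (intros; now apply tytL_pst);
   try (split; [reflexivity|]; repeat apply Nat.max_lub; try apply Ht; lia).
  - apply Nat.max_lub_iff in H2 as [Ha Hb].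
    destruct (IHA r Hr (conj (isL_wfLP _ H1) Hb)) as [_ K]. rewrite isL_psub.
    split; [assumption|apply Nat.max_lub; auto].
  - destruct H1 as [Ha Hb]; apply Nat.max_lub_iff in H2 as [Ha' Hb'].
    destruct (IHA1 r Hr (conj Ha Ha')), (IHA2 r Hr (conj Hb Hb')); auto using Nat.max_lub.
  - destruct H1 as [Ha Hb]; apply Nat.max_lub_iff in H2 as [Ha' Hb'].
    destruct (IHA1 r Hr (conj Ha Ha')), (IHA2 r Hr (conj Hb Hb')); auto using Nat.max_lub.
  - destruct H1 as [Ha Hb]; apply Nat.max_lub_iff in H2 as [Ha' Hb'].
    destruct (IHA1 r Hr (conj Ha Ha')), (IHA2 r Hr (conj Hb Hb')); auto using Nat.max_lub.
  - destruct (IHA _ (Hu r x Hr) (conj H1 (Nat.max_lub_r _ _ _ H2))).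
    apply Nat.max_lub_l in H2. auto using Nat.max_lub.
  - destruct (IHA _ (Hu r x Hr) (conj H1 (Nat.max_lub_r _ _ _ H2))).
    apply Nat.max_lub_l in H2. auto using Nat.max_lub.
Qed.

(** * Natural deduction *)

Section Calculus.
Variable s : nat.

Lemma inLP_imp A B : inLP s (lImp A B) <-> inLP s A /\ inLP s B.
Proof. unfold inLP; simpl; rewrite andb_true_iff, Nat.max_lub_iff; tauto. Qed.
Lemma inLP_and A B : inLP s (lAnd A B) <-> inLP s A /\ inLP s B.
Proof. unfold inLP; simpl; rewrite andb_true_iff, Nat.max_lub_iff; tauto. Qed.
Lemma inLP_or A B : inLP s (lOr A B) <-> inLP s A /\ inLP s B.
Proof. unfold inLP; simpl; rewrite andb_true_iff, Nat.max_lub_iff; tauto. Qed.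
Lemma inLP_all x A : inLP s (lAll x A) <-> lsort x <= s /\ inLP s A.
Proof. unfold inLP; simpl; rewrite Nat.max_lub_iff; tauto. Qed.
Lemma inLP_ex x A : inLP s (lEx x A) <-> lsort x <= s /\ inLP s A.
Proof. unfold inLP; simpl; rewrite Nat.max_lub_iff; tauto. Qed.
Lemma inLP_not A : inLP s (lnot A) <-> inLP s A.
Proof. unfold inLP; simpl; rewrite andb_true_r, Nat.max_0_r; tauto. Qed.
Lemma inLP_bot : inLP s lBot.
Proof. split; simpl; [reflexivity|lia]. Qed.
Lemma inLP_eq n t u : inLP s (lEq n t u) <-> n <= s /\ tytL t <= s /\ tytL u <= s.
Proof. unfold inLP; simpl; rewrite !Nat.max_lub_iff; tauto. Qed.

Definition prov : fmL -> Prop := Prf LLP false (inLP s) AxSLP.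

Lemma prov_inLP A : prov A -> inLP s A.
Proof. intros H; destruct H; assumption. Qed.

Lemma prov_mp A B : prov A -> prov (lImp A B) -> prov B.
Proof.
  intros HA HB. apply (p_mp LLP _ _ _ A B HA HB).
  apply prov_inLP, inLP_imp in HB; tauto.
Qed.

Local Ltac solve_in :=
  repeat match goal with
  | H : prov _ |- _ => apply prov_inLP in H
  end; rewrite ?inLP_imp, ?inLP_and, ?inLP_or in *; tauto.

Lemma prov_k C A : inLP s C -> prov A -> prov (lImp C A).
Proof.
  intros HC HA. apply (prov_mp A); [assumption|].
  apply (p_K LLP). solve_in.
Qed.

Lemma prov_s C A B : prov (lImp C (lImp A B)) -> prov (lImp C A) -> prov (lImp C B).
Proof.
  intros H1 H2. apply (prov_mp _ _ H2), (prov_mp _ _ H1), (p_S LLP). solve_in.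
Qed.

Lemma prov_comp A B C : prov (lImp A B) -> prov (lImp B C) -> prov (lImp A C).
Proof. intros H1 H2. apply (prov_s A B C); [apply prov_k|]; solve [assumption|solve_in]. Qed.

Lemma prov_flip A B C : prov (lImp A (lImp B C)) -> prov (lImp B (lImp A C)).
Proof.
  intros H. apply (prov_comp B (lImp A B)).
  - apply (p_K LLP); solve_in.
  - apply (prov_mp _ _ H), (p_S LLP); solve_in.
Qed.

Lemma prov_curry A B C : prov (lImp (lAnd A B) C) -> prov (lImp A (lImp B C)).
Proof.
  intros H. assert (K : prov (lImp A (lImp B (lAnd A B)))) by (apply (p_andI LLP); solve_in).
  apply (prov_comp _ _ _ K).
  apply (prov_mp (lImp B (lImp (lAnd A B) C))); [apply prov_k; [solve_in|assumption]|].
  apply (p_S LLP); solve_in.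
Qed.

Definition top := lImp lBot lBot.
Fixpoint cj (G : list fmL) : fmL :=
  match G with [] => top | A :: G => lAnd A (cj G) end.
(** [Prf] has no contexts. A single implication from the conjunction makes [p_gen] and [p_exE],
    whose side formula stands in an implication, directly usable as quantifier rules under
    hypotheses. *)
Definition pf (G : list fmL) (A : fmL) : Prop := prov (lImp (cj G) A).
Definition wfc (G : list fmL) : Prop := forall A, In A G -> inLP s A.
Definition nfc (x : lvar) (G : list fmL) : Prop := forall A, In A G -> ~ In x (fvL A).
Definition ext (G G' : list fmL) : Prop := incl G G' /\ wfc G'.

Lemma wfc_cj G : wfc G <-> inLP s (cj G).
Proof.
  induction G as [|A G IH]; simpl.
  - split; [intros _; apply inLP_imp; split; apply inLP_bot|intros _ A []].
  - rewrite inLP_and, <- IH. unfold wfc; simpl. split.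
    + intros H; split; auto.
    + intros [H1 H2] B [<-|HB]; auto.
Qed.

Lemma wfc_nil : wfc [].
Proof. intros A []. Qed.
Lemma wfc_cons A G : inLP s A -> wfc G -> wfc (A :: G).
Proof. intros ? ? B [<-|?]; auto. Qed.
Lemma pf_wfc G A : pf G A -> wfc G.
Proof. intros H%prov_inLP. apply wfc_cj. apply inLP_imp in H; tauto. Qed.
Lemma pf_inLP G A : pf G A -> inLP s A.
Proof. intros H%prov_inLP. apply inLP_imp in H; tauto. Qed.
Lemma ext_refl G : wfc G -> ext G G.
Proof. split; [apply incl_refl|assumption]. Qed.
Lemma ext_trans G G' G'' : ext G G' -> ext G' G'' -> ext G G''.
Proof. intros [H _] [H' ?]; split; [eapply incl_tran; eauto|assumption]. Qed.
Lemma ext_wfc G G' : ext G G' -> wfc G'.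
Proof. intros [_ H]; exact H. Qed.
Lemma ext_cons A G : inLP s A -> wfc G -> ext G (A :: G).
Proof. split; [apply incl_tl, incl_refl|now apply wfc_cons]. Qed.
Lemma nfc_nil x : nfc x [].
Proof. intros A []. Qed.
Lemma nfc_cons x A G : ~ In x (fvL A) -> nfc x G -> nfc x (A :: G).
Proof. intros ? ? B [<-|?]; auto. Qed.

Lemma nfc_cj x G : nfc x G -> ~ In x (fvL (cj G)).
Proof.
  induction G as [|A G IH]; simpl; [auto|]. intros H. rewrite in_app_iff.
  intros [K|K]; [apply (H A); simpl; auto|apply IH in K; auto].
  intros B HB; apply H; simpl; auto.
Qed.

Lemma inLP_top : inLP s top.
Proof. apply inLP_imp; split; apply inLP_bot. Qed.

Lemma pf_nil A : pf [] A <-> prov A.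
Proof.
  split; intros H.
  - apply (prov_mp top); [|exact H]. apply (p_efq LLP), inLP_top.
  - apply prov_k; [apply inLP_top|assumption].
Qed.

Lemma pf_hyp G A : In A G -> wfc G -> pf G A.
Proof.
  unfold pf; induction G as [|B G IH]; simpl; [tauto|]. intros H W.
  pose proof (proj1 (wfc_cj _) W) as W'; simpl in W'.
  assert (WA := W A H).
  destruct H as [->|H].
  - apply (p_andE1 LLP). apply inLP_imp; auto.
  - apply (prov_comp _ (cj G)).
    + apply (p_andE2 LLP). apply inLP_imp; split; [assumption|]. apply inLP_and in W'; tauto.
    + apply IH; [assumption|]. intros C HC; apply W; simpl; auto.
Qed.

Lemma pf_prov G A : wfc G -> prov A -> pf G A.
Proof. intros; apply prov_k; [now apply wfc_cj|assumption]. Qed.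

Lemma pf_impI G A B : pf (A :: G) B -> pf G (lImp A B).
Proof. intros H. apply prov_flip, prov_curry, H. Qed.

Lemma pf_impE G A B : pf G (lImp A B) -> pf G A -> pf G B.
Proof. apply prov_s. Qed.

Lemma pf_weak G G' A : ext G G' -> pf G A -> pf G' A.
Proof.
  intros [Hi W] H. revert A H. induction G as [|B G IH]; intros A H.
  - apply pf_prov; [assumption|now apply pf_nil].
  - apply pf_impI in H. apply IH in H; [|intros C HC; apply Hi; simpl; auto].
    apply (pf_impE _ _ _ H), pf_hyp; [apply Hi; simpl; auto|assumption].
Qed.

Lemma pf_weak0 G A : wfc G -> pf [] A -> pf G A.
Proof. intros W. apply pf_weak; split; [intros ? []|assumption]. Qed.

Lemma pf_cut G A B : pf G A -> pf (A :: G) B -> pf G B.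
Proof. intros H1 H2; exact (pf_impE _ _ _ (pf_impI _ _ _ H2) H1). Qed.

Lemma pf_ax G A : AxSLP A -> inLP s A -> wfc G -> pf G A.
Proof. intros. apply pf_prov; [assumption|]. now apply (p_ax LLP). Qed.

Lemma pf_andI G A B : pf G A -> pf G B -> pf G (lAnd A B).
Proof.
  intros H1 H2. eapply pf_impE; [eapply pf_impE; [|exact H1]|exact H2].
  apply pf_prov; [now apply pf_wfc in H1|]. apply (p_andI LLP).
  rewrite !inLP_imp, inLP_and. apply pf_inLP in H1, H2; tauto.
Qed.

Lemma pf_andE1 G A B : pf G (lAnd A B) -> pf G A.
Proof.
  intros H. eapply pf_impE; [|exact H]. apply pf_prov; [now apply pf_wfc in H|].
  apply (p_andE1 LLP). apply pf_inLP in H. rewrite inLP_imp, inLP_and in *; tauto.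
Qed.

Lemma pf_andE2 G A B : pf G (lAnd A B) -> pf G B.
Proof.
  intros H. eapply pf_impE; [|exact H]. apply pf_prov; [now apply pf_wfc in H|].
  apply (p_andE2 LLP). apply pf_inLP in H. rewrite inLP_imp, inLP_and in *; tauto.
Qed.

Lemma pf_orI1 G A B : inLP s B -> pf G A -> pf G (lOr A B).
Proof.
  intros HB H. eapply pf_impE; [|exact H]. apply pf_prov; [now apply pf_wfc in H|].
  apply (p_orI1 LLP). apply pf_inLP in H. rewrite inLP_imp, inLP_or in *; tauto.
Qed.

Lemma pf_orI2 G A B : inLP s A -> pf G B -> pf G (lOr A B).
Proof.
  intros HB H. eapply pf_impE; [|exact H]. apply pf_prov; [now apply pf_wfc in H|].
  apply (p_orI2 LLP). apply pf_inLP in H. rewrite inLP_imp, inLP_or in *; tauto.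
Qed.

Lemma pf_orE G A B C : pf G (lOr A B) -> pf (A :: G) C -> pf (B :: G) C -> pf G C.
Proof.
  intros H H1%pf_impI H2%pf_impI.
  eapply pf_impE; [eapply pf_impE; [eapply pf_impE; [|exact H1]|exact H2]|exact H].
  apply pf_prov; [now apply pf_wfc in H|]. apply (p_orE LLP).
  apply pf_inLP in H, H1, H2. rewrite !inLP_imp, !inLP_or in *; tauto.
Qed.

Lemma pf_efq G A : inLP s A -> pf G lBot -> pf G A.
Proof.
  intros HA H. eapply pf_impE; [|exact H]. apply pf_prov; [now apply pf_wfc in H|].
  apply (p_efq LLP). apply inLP_imp; split; [apply inLP_bot|assumption].
Qed.

Lemma pf_allI G x A : nfc x G -> lsort x <= s -> pf G A -> pf G (lAll x A).
Proof.
  intros Hx Hs H. apply (p_gen LLP); [exact H|now apply nfc_cj|].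
  apply prov_inLP in H. rewrite inLP_imp, inLP_all in *; tauto.
Qed.

Lemma pf_allE G x t A : pf G (lAll x A) -> admL x t -> freeforL x t A -> tytL t <= s ->
  pf G (substL x t A).
Proof.
  intros H Ha Hf Ht. eapply pf_impE; [|exact H]. apply pf_prov; [now apply pf_wfc in H|].
  apply (p_allE LLP); auto. apply pf_inLP, inLP_all in H.
  rewrite inLP_imp, inLP_all; split; [assumption|]. apply inLP_substL; tauto.
Qed.

Lemma admL_vt x : admL x (vt x).
Proof. destruct x as [|[]]; simpl; eauto. Qed.

Lemma pf_allE_id G x A : pf G (lAll x A) -> pf G A.
Proof.
  intros H. rewrite <- (substL_id x A). apply pf_allE; auto using admL_vt, freeforL_id.
  rewrite tytL_vt. apply pf_inLP, inLP_all in H; tauto.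
Qed.

Lemma pf_exI G x t A : lsort x <= s -> inLP s A -> admL x t -> freeforL x t A -> tytL t <= s ->
  pf G (substL x t A) -> pf G (lEx x A).
Proof.
  intros Hs HA Ha Hf Ht H. eapply pf_impE; [|exact H]. apply pf_prov; [now apply pf_wfc in H|].
  apply (p_exI LLP); auto. apply inLP_imp; split; [now apply inLP_substL|].
  now apply inLP_ex.
Qed.

Lemma pf_exI_id G x A : lsort x <= s -> pf G A -> pf G (lEx x A).
Proof.
  intros Hs H. apply (pf_exI G x (vt x)); auto using admL_vt, freeforL_id.
  - now apply pf_inLP in H.
  - now rewrite tytL_vt.
  - now rewrite substL_id.
Qed.

Lemma pf_exE G x A B : pf G (lEx x A) -> nfc x G -> ~ In x (fvL B) ->
  pf (A :: G) B -> pf G B.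
Proof.
  intros H HG HB HAB. apply prov_curry in HAB.
  eapply prov_s; [|exact H]. apply prov_flip.
  apply (p_exE LLP); [exact HAB| |].
  - simpl. rewrite in_app_iff. apply nfc_cj in HG. tauto.
  - apply pf_inLP in H. apply prov_inLP in HAB. simpl in *.
    apply inLP_imp in HAB. apply inLP_imp; tauto.
Qed.

Lemma pf_eqrefl G x t : wfc G -> lsort x <= s -> tytL t <= s -> pf G (lEq (lsort x) t t).
Proof.
  intros. apply pf_prov; [assumption|]. apply (p_eqrefl LLP _ _ _ x t). simpl.
  apply inLP_eq; auto.
Qed.

Lemma pf_eqsub G x t u A : freeforL x t A -> freeforL x u A -> inLP s A ->
  pf G (lEq (lsort x) t u) -> pf G (substL x t A) -> pf G (substL x u A).
Proof.
  intros Ht Hu HA H1 H2. eapply pf_impE; [eapply pf_impE; [|exact H1]|exact H2].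
  apply pf_prov; [now apply pf_wfc in H1|]. apply (p_eqsub LLP); auto. simpl.
  pose proof (pf_inLP _ _ H1) as K. rewrite !inLP_imp. split; [assumption|].
  apply inLP_eq in K. split; apply inLP_substL; tauto.
Qed.

Lemma pf_inst G x t A : wfc G -> pf [] A -> admL x t -> freeforL x t A -> lsort x <= s ->
  tytL t <= s -> pf G (substL x t A).
Proof.
  intros W H Ha Hf Hs Ht. apply pf_weak0; [assumption|].
  apply pf_allE; auto. apply pf_allI; auto using nfc_nil.
Qed.

End Calculus.

(** * Equality and congruence *)

Section Equality.
Variable s : nat.
Notation pf := (pf s).

Lemma tytL_lb {n} (t : tmL n) : n <= tytL t.
Proof. induction t; simpl; lia. Qed.

Lemma pf_eq_leb G n (t u : tmL n) : pf G (lEq n t u) -> tytL t <= s /\ tytL u <= s /\ n <= s.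
Proof. intros H%pf_inLP%inLP_eq; tauto. Qed.

Lemma pf_refl G n (t : tmL n) : wfc s G -> tytL t <= s -> pf G (lEq n t t).
Proof.
  intros W H. pose proof (tytL_lb t).
  destruct n; [apply (pf_eqrefl s G (VN 0))|apply (pf_eqrefl s G (VF kGen n 0))]; simpl; auto; lia.
Qed.

Lemma notin_fresh {n} (t : tmL n) x : mxtL t < lidx x -> ~ In x (fvtL t).
Proof. intros H K%fvtL_idx; lia. Qed.

Lemma notin_freshF A x : mxfL A < lidx x -> ~ In x (fvL A).
Proof. intros H K%fvL_idx; lia. Qed.

(** Replacement is applied to the formula [c[t] = c] in the variable [x]. As [x] does not occur in
    [t], its left side is unaffected, and reflexivity becomes the required equation. *)
Lemma pf_cong_gen G x n (c : tmL n) t u : ~ In x (fvtL t) -> tytL c <= s ->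
  pf G (lEq (lsort x) t u) -> pf G (lEq n (substtL x t c) (substtL x u c)).
Proof.
  intros Hx Hc H. pose proof (pf_eq_leb _ _ _ _ H) as (Ht & Hu & Hs).
  assert (Hct : tytL (substtL x t c) <= s) by now apply tytL_substtL.
  assert (E : forall v, substtL x v (substtL x t c) = substtL x t c).
  { intros v. clear - Hx. induction c; try reflexivity; try (simpl; congruence).
    - destruct (lvar_eq_dec x (VN i)) as [->|Hn].
      + change (lnvar i) with (vt (VN i)). rewrite substtL_same. now apply substtL_notfree.
      + assert (K : forall w, substtL x w (lnvar i) = lnvar i) by (intro w; apply (substtL_other x (VN i) w Hn)).
        now rewrite !K.
    - destruct (lvar_eq_dec x (VF k n i)) as [->|Hn].
      + change (substtL (VF k n i) v (substtL (VF k n i) t (vt (VF k n i)))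
             = substtL (VF k n i) t (vt (VF k n i))).
        rewrite substtL_same. now apply substtL_notfree.
      + assert (K : forall w, substtL x w (lfvar k n i) = lfvar k n i)
          by (intro w; apply (substtL_other x (VF k n i) w Hn)).
        now rewrite !K. }
  assert (K := pf_eqsub s G x t u (lEq n (substtL x t c) c) I I).
  simpl in K. rewrite !E in K. apply K; auto.
  - apply inLP_eq. pose proof (tytL_lb c). split; [lia|tauto].
  - apply pf_refl; [now apply pf_wfc in H|assumption].
Qed.

Lemma pf_sym G n (t u : tmL n) : pf G (lEq n t u) -> pf G (lEq n u t).
Proof.
  assert (K : forall x (t u : tmL (lsort x)), ~ In x (fvtL t) ->
    pf G (lEq (lsort x) t u) -> pf G (lEq (lsort x) u t)).
  { clear t u; intros x t u Hx H. pose proof (pf_eq_leb _ _ _ _ H) as (Ht & Hu & Hs).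
    assert (K := pf_eqsub s G x t u (lEq (lsort x) (vt x) t) I I).
    simpl in K. rewrite !substtL_same, !substtL_notfree in K by assumption.
    apply K; auto.
    - apply inLP_eq. rewrite tytL_vt; auto.
    - apply pf_refl; auto. now apply pf_wfc in H. }
  destruct n; intros H.
  - apply (K (VN (S (mxtL t)))); auto. apply notin_fresh; simpl; lia.
  - apply (K (VF kGen n (S (mxtL t)))); auto. apply notin_fresh; simpl; lia.
Qed.

Lemma pf_trans G n (t u v : tmL n) : pf G (lEq n t u) -> pf G (lEq n u v) -> pf G (lEq n t v).
Proof.
  assert (K : forall x (t u v : tmL (lsort x)), ~ In x (fvtL t) ->
    pf G (lEq (lsort x) t u) -> pf G (lEq (lsort x) u v) -> pf G (lEq (lsort x) t v)).
  { clear t u v; intros x t u v Hx H H'. pose proof (pf_eq_leb _ _ _ _ H) as (Ht & Hu & Hs).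
    assert (K := pf_eqsub s G x u v (lEq (lsort x) t (vt x)) I I).
    simpl in K. rewrite !substtL_same, !substtL_notfree in K by assumption.
    apply K; auto. apply inLP_eq. rewrite tytL_vt; auto. }
  destruct n; intros H.
  - apply (K (VN (S (mxtL t)))); auto. apply notin_fresh; simpl; lia.
  - apply (K (VF kGen n (S (mxtL t)))); auto. apply notin_fresh; simpl; lia.
Qed.

Lemma pf_congN G i n (c : tmL n) t u : mxtL t < i -> tytL c <= s ->
  pf G (lEq 0 t u) -> pf G (lEq n (substtL (VN i) t c) (substtL (VN i) u c)).
Proof. intros Hi. apply (pf_cong_gen G (VN i)). now apply notin_fresh. Qed.

Lemma substtN_same i t : substtL (VN i) t (lnvar i) = t.
Proof. apply (substtL_same (VN i)). Qed.

Lemma pf_succ G t u : pf G (lEq 0 t u) -> pf G (lEq 0 (lsucc t) (lsucc u)).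
Proof.
  intros H. pose proof (pf_congN G (S (mxtL t)) 0 (lsucc (lnvar (S (mxtL t)))) t u) as K.
  cbn [substtL] in K. rewrite Nat.eqb_refl in K. apply K; simpl; auto; lia.
Qed.

Lemma pf_cong2 G (op : tmL 0 -> tmL 0 -> tmL 0) t t' u u' :
  (forall i v a b, substtL (VN i) v (op a b) = op (substtL (VN i) v a) (substtL (VN i) v b)) ->
  (forall a b, tytL (op a b) = Nat.max (tytL a) (tytL b)) ->
  pf G (lEq 0 t t') -> pf G (lEq 0 u u') -> pf G (lEq 0 (op t u) (op t' u')).
Proof.
  intros Hop Hty H H'. pose proof (pf_eq_leb _ _ _ _ H) as (? & ? & _).
  pose proof (pf_eq_leb _ _ _ _ H') as (? & ? & _).
  set (i := S (mxtL t + mxtL u + mxtL t')).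
  apply (pf_trans _ _ _ (op t' u)).
  - pose proof (pf_congN G i 0 (op (lnvar i) u) t t') as K.
    rewrite !Hop, !substtN_same, !(substtL_notfree _ _ u) in K
      by (apply notin_fresh; simpl; unfold i; lia).
    apply K; [unfold i; lia|rewrite Hty; simpl; lia|assumption].
  - pose proof (pf_congN G i 0 (op t' (lnvar i)) u u') as K.
    rewrite !Hop, !substtN_same, !(substtL_notfree _ _ t') in K
      by (apply notin_fresh; simpl; unfold i; lia).
    apply K; [unfold i; lia|rewrite Hty; simpl; lia|assumption].
Qed.

Lemma pf_plus G t t' u u' : pf G (lEq 0 t t') -> pf G (lEq 0 u u') ->
  pf G (lEq 0 (lplus t u) (lplus t' u')).
Proof. apply (pf_cong2 G lplus); reflexivity. Qed.

Lemma pf_times G t t' u u' : pf G (lEq 0 t t') -> pf G (lEq 0 u u') ->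
  pf G (lEq 0 (ltimes t u) (ltimes t' u')).
Proof. apply (pf_cong2 G ltimes); reflexivity. Qed.

Lemma pf_app G n (Z : tmL (S n)) t u : tytL Z <= s -> pf G (lEq 0 t u) ->
  pf G (lEq n (lapp n Z t) (lapp n Z u)).
Proof.
  intros HZ H. set (i := S (mxtL t + mxtL Z)).
  pose proof (pf_congN G i n (lapp n Z (lnvar i)) t u) as K. cbn [substtL] in K.
  rewrite Nat.eqb_refl, !(substtL_notfree _ _ Z) in K by (apply notin_fresh; simpl; unfold i; lia).
  apply K; [unfold i; lia|pose proof (tytL_lb Z); simpl; lia|assumption].
Qed.

(** The successor acts as [N] at type 0, just as [Kc] extends [K] by zero. Membership at type 0 and
    at higher types then has one common form. *)
Definition Nn (n : nat) : tmL n -> tmL n :=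
  match n with 0 => lsucc | S m => lN m end.

Lemma tytL_Nn n (t : tmL n) : tytL (Nn n t) = tytL t.
Proof. pose proof (tytL_lb t). destruct n; simpl; lia. Qed.

Lemma pf_Nn G n (t u : tmL n) : pf G (lEq n t u) -> pf G (lEq n (Nn n t) (Nn n u)).
Proof.
  destruct n; [apply pf_succ|]. intros H. pose proof (pf_eq_leb _ _ _ _ H) as (? & ? & ?).
  set (x := VF kGen n (S (mxtL t))).
  pose proof (pf_cong_gen G x (S n) (lN n (vt x)) t u) as K.
  change (substtL x t (lN n (vt x))) with (lN n (substtL x t (vt x))) in K.
  change (substtL x u (lN n (vt x))) with (lN n (substtL x u (vt x))) in K.
  rewrite !substtL_same in K. apply K; auto.
  - apply notin_fresh; simpl; lia.
  - simpl; lia.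
Qed.

End Equality.

(** * The Kripke model of contexts *)

Section Semantics.
Variables s N : nat.
Notation pf := (pf s).
Notation wfc := (wfc s).
Notation ext := (ext s).

(* Terms whose variables all have index at least [N] can be substituted
   without capture into every formula all of whose indices are below [N]. *)
Definition okt {n} (t : tmL n) : Prop :=
  tytL t <= s /\ forall v, In v (fvtL t) -> N <= lidx v.

Definition okv (r : val) : Prop := forall v, lsort v <= s -> okt (r v).

Lemma okv_upd r x t : okv r -> okt t -> okv (upd r x t).
Proof.
  intros Hr Ht v Hv. destruct (lvar_eq_dec x v) as [<-|Hn].
  - now rewrite upd_same.
  - rewrite upd_other by assumption; auto.
Qed.

Lemma okt_pst r {n} (t : tmL n) : okv r -> tytL t <= s -> okt (pst r t).
Proof.
  intros Hr Ht. split.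
  - apply tytL_pst; [intros v Hv; now apply Hr|assumption].
  - intros v Hv. apply fvtL_pst in Hv as (w & Hw & Hv).
    apply (Hr w); [apply fvtL_sort in Hw; lia|assumption].
Qed.

(** Falsum is forced exactly at inconsistent contexts, so consistency of the theory is not
    presupposed. The domain is the same at all contexts and forcing is monotone, hence the universal
    clause does not look at later contexts. [False] is a default value for connectives outside
    [negF]. *)
Fixpoint sem (A : fmL) (r : val) (G : list fmL) : Prop :=
  match A with
  | lEq n t u => pf G (lEq n (pst r t) (pst r u))
  | lBot => pf G lBot
  | lAnd A B => sem A r G /\ sem B r G
  | lImp A B => forall G', ext G G' -> sem A r G' -> sem B r G'
  | lAll x A => forall t, admL x t -> okt t -> sem A (upd r x t) G
  | _ => False
  end.

Fixpoint negF (A : fmL) : Prop :=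
  match A with
  | lEq _ _ _ | lBot => True
  | lAnd A B | lImp A B => negF A /\ negF B
  | lAll _ A => negF A
  | _ => False
  end.

Lemma sem_mono A : forall r G G', ext G G' -> sem A r G -> sem A r G'.
Proof.
  induction A; simpl; intros r G G' E H; try tauto; eauto using pf_weak.
  - intuition eauto.
  - intros G'' E'. apply H. eapply ext_trans; eauto.
Qed.

Lemma sem_agree A : forall r r' G,
  (forall v, In v (fvL A) -> r v = r' v) -> sem A r G <-> sem A r' G.
Proof.
  induction A; simpl; intros r r' G H; try tauto.
  - rewrite (pst_agree r r' t), (pst_agree r r' u); [tauto|..]; intros; apply H, in_app_iff; auto.
  - rewrite (IHA1 r r'), (IHA2 r r'); [tauto|..]; intros; apply H, in_app_iff; auto.
  - assert (H1 : forall G, sem A1 r G <-> sem A1 r' G)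
      by (intros; apply IHA1; intros; apply H, in_app_iff; auto).
    assert (H2 : forall G, sem A2 r G <-> sem A2 r' G)
      by (intros; apply IHA2; intros; apply H, in_app_iff; auto).
    split; intros K G' E; [rewrite <- H1, <- H2|rewrite H1, H2]; auto.
  - assert (K : forall t, sem A (upd r x t) G <-> sem A (upd r' x t) G).
    { intros t. apply IHA. intros v Hv. apply upd_agree. intros; apply H, In_fv_bind; auto. }
    split; intros K' t Ha Ht; apply K; auto.
Qed.

Lemma fresh_idx (r : val) (G : list fmL) (l : list lvar) : exists k,
  N <= k /\ (forall A, In A G -> mxfL A < k) /\ (forall v, In v l -> mxtL (r v) < k).
Proof.
  assert (H1 : exists k, forall A, In A G -> mxfL A < k).
  { induction G as [|A G [k IH]]; [exists 0; intros A []|]. exists (S (Nat.max k (mxfL A))).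
    intros B [<-|HB]; [lia|]. specialize (IH B HB); lia. }
  assert (H2 : exists k, forall v, In v l -> mxtL (r v) < k).
  { induction l as [|A l [k IH]]; [exists 0; intros A []|]. exists (S (Nat.max k (mxtL (r A)))).
    intros B [<-|HB]; [lia|]. specialize (IH B HB); lia. }
  destruct H1 as [k1 H1], H2 as [k2 H2]. exists (N + k1 + k2). split; [lia|split].
  - intros A HA; specialize (H1 A HA); lia.
  - intros A HA; specialize (H2 A HA); lia.
Qed.

Definition setidx (x : lvar) (k : nat) : lvar :=
  match x with VN _ => VN k | VF c n _ => VF c n k end.

Lemma okv_ty r : okv r -> forall v, lsort v <= s -> tytL (r v) <= s.
Proof. intros H v Hv. now apply H. Qed.

(** A proof is generalised over a fresh index [k] and then instantiated. The instance may be a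
    domain term or the original name [lnvar i], which lies below [N] when bound in a formula
    considered here. *)
Lemma psub_rename r i k C (t : tmL 0) : okv r -> inLP s C -> mxfL C < N -> N <= k ->
  (forall v, In v (fvL C) -> mxtL (r v) < k) -> (okt t \/ t = lnvar i) ->
  let C1 := psub (upd r (VN i) (lnvar k)) C in
  substL (VN k) t C1 = psub (upd r (VN i) t) C /\ freeforL (VN k) t C1.
Proof.
  intros Hr HC HN Hk Hf Ht. apply (substL_psub N); auto.
  - intros v Hv. destruct (lvar_eq_dec (VN i) v) as [<-|Hn].
    + rewrite !upd_same. apply (substtL_same (VN k)).
    + rewrite !upd_other by assumption. apply substtL_notfree, notin_fresh, Hf, Hv.
  - intros v Hv. destruct (lvar_eq_dec (VN i) v) as [<-|Hn].
    + rewrite !upd_same. destruct Ht as [[_ Ht]| ->]; auto.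
    + rewrite !upd_other by assumption. left. apply Hr.
      apply fvL_sort in Hv. destruct HC; lia.
Qed.

Lemma psub_renameF r c n i k C (t : tmL (S n)) : okv r -> inLP s C -> mxfL C < N -> N <= k ->
  (forall v, In v (fvL C) -> mxtL (r v) < k) -> (okt t \/ t = lfvar c n i) ->
  let C1 := psub (upd r (VF c n i) (lfvar c n k)) C in
  substL (VF c n k) t C1 = psub (upd r (VF c n i) t) C /\ freeforL (VF c n k) t C1.
Proof.
  intros Hr HC HN Hk Hf Ht. apply (substL_psub N); auto.
  - intros v Hv. destruct (lvar_eq_dec (VF c n i) v) as [<-|Hn].
    + rewrite !upd_same. apply (substtL_same (VF c n k)).
    + rewrite !upd_other by assumption. apply substtL_notfree, notin_fresh, Hf, Hv.
  - intros v Hv. destruct (lvar_eq_dec (VF c n i) v) as [<-|Hn].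
    + rewrite !upd_same. destruct Ht as [[_ Ht]| ->]; auto.
    + rewrite !upd_other by assumption. left. apply Hr.
      apply fvL_sort in Hv. destruct HC; lia.
Qed.

Lemma okt_var x : N <= lidx x -> lsort x <= s -> okt (vt x).
Proof.
  intros H1 H2; split; [now rewrite tytL_vt|].
  intros v; rewrite fvtL_vt; intros [<-|[]]; assumption.
Qed.

Lemma psub_notin r x t C y : okv r -> inLP s C -> lidx y < N -> ~ In y (fvtL t) ->
  ~ In y (fvL (psub (upd r x t) C)).
Proof.
  intros Hr HC Hy Ht H. apply fvL_psub in H as (v & Hv & H).
  destruct (lvar_eq_dec x v) as [<-|Hn].
  - rewrite upd_same in H; auto.
  - rewrite upd_other in H by assumption. apply Hr in H; [lia|].
    apply fvL_sort in Hv. destruct HC; lia.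
Qed.

(** Change of bound variable: the quantifier is introduced on a name [y] fresh for [G] and then
    exchanged for the name demanded by the target formula. *)
Lemma pf_all_rename G x C1 y (t' : tmL (lsort y)) C :
  pf G C1 -> nfc y G -> lsort y <= s -> admL y t' -> freeforL y t' C1 -> tytL t' <= s ->
  substL y t' C1 = C -> ~ In x (fvL (lAll y C1)) -> lsort x <= s -> pf G (lAll x C).
Proof.
  intros H Hy Hs Ha Hf Ht <- Hx Hsx.
  assert (K : pf G (lAll y C1)) by (apply pf_allI; auto).
  (* [x] may be free in [G]. Generalising over [x] therefore takes place in the context consisting
     of [lAll y C1] alone. *)
  apply (pf_cut s _ _ _ K). apply pf_inLP in K as Hin. apply pf_wfc in K.
  apply (pf_weak s [lAll y C1]).
  - split; [intros ? [<-|[]]; simpl; auto|apply wfc_cons; auto].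
  - apply pf_allI; [apply nfc_cons; auto using nfc_nil|assumption|].
    apply pf_allE; auto. apply pf_hyp; [simpl; auto|]. apply wfc_cons; auto using wfc_nil.
Qed.

(** Both directions have to be proved together, since an implication passes its antecedent through
    the opposite direction. In the step from forcing to derivability the antecedent is added to the
    context, which is a later world. *)
Lemma reify_reflect B : negF B -> inLP s B -> mxfL B < N -> forall r G, okv r -> wfc G ->
  sem B r G <-> pf G (psub r B).
Proof.
  induction B; simpl negF; intros Hn Hin HN r G Hr W; try (exfalso; exact Hn).
  - reflexivity.
  - reflexivity.
  - apply inLP_and in Hin. simpl in HN |- *.
    rewrite IHB1, IHB2 by (auto; tauto || lia). split.
    + intros [? ?]; now apply pf_andI.
    + intros H; split; [eapply pf_andE1|eapply pf_andE2]; eauto.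
  - apply inLP_imp in Hin. simpl in HN |- *. split.
    + intros H. assert (W' : inLP s (psub r B1)) by (apply inLP_psub; [now apply okv_ty|tauto]).
      apply pf_impI. apply IHB2; try tauto; try lia; [apply wfc_cons; auto|].
      apply H; [now apply ext_cons|]. apply IHB1; try tauto; try lia; [now apply wfc_cons|].
      apply pf_hyp; [simpl; auto|now apply wfc_cons].
    + intros H G' E H'. apply IHB2; try tauto; try lia; [now apply ext_wfc in E|].
      apply IHB1 in H'; try tauto; try lia; [|now apply ext_wfc in E].
      eapply pf_impE; [|exact H']. eapply pf_weak; eauto.
  - apply inLP_all in Hin as [Hs HB]. simpl in HN |- *. split.
    (* The bound name lies below [N], so as a term it is outside the domain. The hypothesis is
       evaluated at a fresh variable of index [k] and the name is restored by [pf_all_rename]. *)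
    + intros H. destruct (fresh_idx r G (fvL B)) as (k & Hk & HG & Hf).
      assert (K : nfc (setidx x k) G).
      { intros A HA. apply notin_freshF. specialize (HG A HA). destruct x; simpl; assumption. }
      destruct x as [i|c n i]; simpl in *.
      * destruct (psub_rename r i k B (lnvar i)) as [E F]; auto; try lia.
        assert (Ho : okt (vt (VN k))) by (apply okt_var; simpl; lia).
        specialize (H (lnvar k) I Ho). apply IHB in H; auto; try lia; [|now apply okv_upd].
        eapply (pf_all_rename G (VN i) _ (VN k) (lnvar i)); eauto; simpl; try lia; auto.
        intros Hi%In_fv_bind. destruct Hi as [Hi _]. revert Hi. apply psub_notin; auto; simpl; try lia.
        intros [Q|[]]. injection Q; lia.
      * destruct (psub_renameF r c n i k B (lfvar c n i)) as [E F]; auto; try lia.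
        assert (Ho : okt (vt (VF c n k))) by (apply okt_var; simpl; lia).
        specialize (H (lfvar c n k) (admL_vt (VF c n k)) Ho). apply IHB in H; auto; try lia; [|now apply okv_upd].
        eapply (pf_all_rename G (VF c n i) _ (VF c n k) (lfvar c n i)); eauto; simpl; try lia; auto.
        -- destruct c; simpl; eauto.
        -- intros Hi%In_fv_bind. destruct Hi as [Hi _]. revert Hi. apply psub_notin; auto; simpl; try lia.
           intros [Q|[]]. injection Q; lia.
    + intros H t Ha Ht. apply IHB; auto; try lia; [now apply okv_upd|].
      destruct (substL_psub N x t B ltac:(lia) (upd r x (vt x)) (upd r x t)) as [E F].
      * intros v Hv. destruct (lvar_eq_dec x v) as [<-|Hnv].
        -- rewrite !upd_same. apply substtL_same.
        -- rewrite !upd_other by assumption. apply substtL_notfree. intros Q.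
           apply Hr in Q; [lia|]. apply fvL_sort in Hv. destruct HB; lia.
      * intros v Hv. left. destruct (lvar_eq_dec x v) as [<-|Hnv].
        -- rewrite !upd_same. apply Ht.
        -- rewrite !upd_other by assumption. apply Hr. apply fvL_sort in Hv. destruct HB; lia.
      * right. intros v Hv. now rewrite !upd_other by congruence.
      * rewrite <- E. apply pf_allE; auto. apply Ht.
Qed.

End Semantics.

(** * The model of TI *)

Lemma varT_eqb_spec v w : reflect (v = w) (varT_eqb v w).
Proof.
  destruct v as [n i], w as [m j]; unfold varT_eqb; simpl.
  destruct (Nat.eqb_spec n m), (Nat.eqb_spec i j); simpl; constructor; congruence.
Qed.

Lemma varT_eq_dec (v w : varT) : {v = w} + {v <> w}.
Proof. decide equality; apply Nat.eq_dec. Qed.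

Lemma In_fvT_bind v w l :
  In v (filter (fun u => negb (varT_eqb u w)) l) <-> In v l /\ v <> w.
Proof. rewrite filter_In. destruct (varT_eqb_spec v w); simpl; intuition congruence. Qed.

Lemma trvar_inj v w : trvar v = trvar w -> v = w.
Proof. destruct v as [[|n] i], w as [[|m] j]; simpl; congruence. Qed.

Lemma fvtT_type {n} (t : tmT n) v : In v (fvtT t) -> fst v = n.
Proof.
  induction t; simpl; rewrite ?in_app_iff; intros H; try tauto.
  destruct H as [<-|[]]; reflexivity.
Qed.

Lemma fvtL_trtm {n} (t : tmT n) x : In x (fvtL (trtm t)) -> exists v, x = trvar v /\ In v (fvtT t).
Proof.
  induction t; simpl; rewrite ?in_app_iff; intros H; try tauto.
  - exists (n, i). destruct n; simpl in *; intuition.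
  - destruct H as [H|H]; [apply IHt1 in H|apply IHt2 in H];
      destruct H as (v & ? & ?); exists v; rewrite in_app_iff; auto.
  - destruct H as [H|H]; [apply IHt1 in H|apply IHt2 in H];
      destruct H as (v & ? & ?); exists v; rewrite in_app_iff; auto.
Qed.

Lemma mxtL_trtm {n} (t : tmT n) : mxtL (trtm t) = mxT t.
Proof. induction t; simpl; auto. destruct n; reflexivity. Qed.

Lemma tytL_trtm {n} (t : tmT n) : tytL (trtm t) = n.
Proof. induction t; simpl; try lia. destruct n; reflexivity. Qed.

Lemma prime_fIn n (t : tmT n) u : prime (fIn n t u) =
  lEx (VN (S (mxtL (trtm t))))
    (lEq n (lapp n (trtm u) (nv (S (mxtL (trtm t))))) (Nn n (trtm t))).
Proof. destruct n; reflexivity. Qed.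

Lemma fvtL_Nn n (t : tmL n) : fvtL (Nn n t) = fvtL t.
Proof. destruct n; reflexivity. Qed.

Lemma fvL_negt A : fvL (negt A) = fvL A.
Proof.
  induction A; simpl; rewrite ?app_nil_r; congruence.
Qed.

Lemma fvL_prime A x : In x (fvL (prime A)) -> exists v, x = trvar v /\ In v (fvT A).
Proof.
  revert x.
  assert (Happ : forall l1 l2 x, (exists v, x = trvar v /\ In v l1) \/ (exists v, x = trvar v /\ In v l2)
     -> exists v, x = trvar v /\ In v (l1 ++ l2)).
  { intros l1 l2 x [(v & ? & ?)|(v & ? & ?)]; exists v; rewrite in_app_iff; auto. }
  assert (Hb : forall v B x, (forall x, In x (fvL (prime B)) -> exists v, x = trvar v /\ In v (fvT B)) ->
    In x (filter (fun w => negb (lvar_eqb w (trvar v))) (fvL (prime B))) ->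
    exists w, x = trvar w /\ In w (filter (fun u => negb (varT_eqb u v)) (fvT B))).
  { intros v B x IH [H Hn]%In_fv_bind. apply IH in H as (w & -> & Hw).
    exists w; split; [reflexivity|]. apply In_fvT_bind; split; congruence. }
  induction A; intros x H.
  - simpl in *. apply in_app_iff in H. apply Happ. destruct H as [H|H]; apply fvtL_trtm in H; auto.
  - rewrite prime_fIn in H. apply In_fv_bind in H. destruct H as [H Hn].
    simpl in H. rewrite !in_app_iff in H. simpl. apply Happ.
    rewrite fvtL_Nn in H. destruct H as [[H|H]|H].
    + right; now apply fvtL_trtm.
    + simpl in H; intuition congruence.
    + left; now apply fvtL_trtm.
  - destruct H.
  - simpl in *. apply in_app_iff in H. apply Happ. intuition.
  - simpl in *. apply in_app_iff in H. apply Happ. intuition.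
  - simpl in *. apply in_app_iff in H. apply Happ. intuition.
  - simpl in *. auto.
  - simpl in *. auto.
Qed.

Lemma fvT_approx n : forall (t u : tmT n) v, In v (fvT (approx n t u)) -> In v (fvtT t) \/ In v (fvtT u).
Proof.
  induction n as [|m IH]; intros t u v; cbn [approx fvT].
  - now rewrite in_app_iff.
  - repeat rewrite ?in_app_iff, ?In_fvT_bind. cbn [fvT fvtT].
    repeat rewrite ?in_app_iff, ?In_fvT_bind. simpl.
    intros H; repeat match goal with
    | H : _ \/ _ |- _ => destruct H
    | H : _ /\ _ |- _ => destruct H
    | H : In _ (fvT (approx _ _ _)) |- _ => apply IH in H; simpl in H
    end; intuition congruence.
Qed.

Lemma fvT_star A v : In v (fvT (star A)) -> In v (fvT A).
Proof.
  revert v; induction A; intros w; cbn [star fvT]; cbv zeta;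
    repeat rewrite ?in_app_iff, ?In_fvT_bind; try (intuition; fail).
  - intros H; apply fvT_approx in H; tauto.
  - cbn [fvT fvtT]. simpl. rewrite ?in_app_iff. intros [H Hn].
    destruct H as [[H|H]|H]; [intuition congruence|auto|].
    apply fvT_approx in H; simpl in H; intuition congruence.
Qed.

Lemma fvL_int A x : In x (fvL (int A)) -> exists v, x = trvar v /\ In v (fvT A).
Proof.
  unfold int. rewrite fvL_negt. intros H%fvL_prime. destruct H as (v & ? & ?).
  exists v; split; auto using fvT_star.
Qed.

Lemma isL_prime A : isL (prime A) = true.
Proof.
  induction A; try (simpl; rewrite ?IHA, ?IHA1, ?IHA2; reflexivity).
  now rewrite prime_fIn.
Qed.

Lemma isL_negt A : isL A = true -> isL (negt A) = true.
Proof.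
  induction A; simpl; rewrite ?andb_true_iff; intros; try discriminate; intuition.
Qed.

Lemma negF_negt A : isL A = true -> negF (negt A).
Proof.
  induction A; simpl; rewrite ?andb_true_iff; intros; try discriminate; intuition.
Qed.

Lemma tyFL_negt A : tyFL (negt A) = tyFL A.
Proof. induction A; simpl; rewrite ?Nat.max_0_r; congruence. Qed.

Lemma lsort_trvar v : lsort (trvar v) = fst v.
Proof. destruct v as [[|]]; reflexivity. Qed.

Lemma tyT_eq {n} (t : tmT n) : tyT t = n.
Proof. induction t; simpl; lia. Qed.

Lemma tyFL_prime A : tyFL (prime A) <= tyFT A.
Proof.
  induction A; try (simpl; lia).
  - simpl. rewrite !tytL_trtm, !tyT_eq. lia.
  - rewrite prime_fIn. simpl. rewrite tytL_Nn, !tytL_trtm, !tyT_eq. lia.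
  - simpl. rewrite lsort_trvar; lia.
  - simpl. rewrite lsort_trvar; lia.
Qed.

Lemma tyFT_approx n : forall t u : tmT n, tyFT (approx n t u) <= n.
Proof.
  induction n as [|m IH]; intros t u; cbn [approx tyFT].
  - rewrite !tyT_eq; lia.
  - cbn [tyFT fst]. rewrite !tyT_eq. specialize (IH (tvar m 0) (tvar m 1)). lia.
Qed.

Lemma tyFT_star A : tyFT (star A) <= tyFT A.
Proof.
  induction A; cbn [star tyFT]; cbv zeta; try lia.
  - pose proof (tyFT_approx n t u); lia.
  - cbn [tyFT fst]. rewrite !tyT_eq. pose proof (tyFT_approx n (tvar n (S (mxT t))) t). lia.
Qed.

Lemma inLP_int s A : inTI s A -> inLP s (int A).
Proof.
  intros H; split.
  - apply isL_wfLP, isL_negt, isL_prime.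
  - unfold int. rewrite tyFL_negt. pose proof (tyFL_prime (star A)).
    pose proof (tyFT_star A). unfold inTI in H. lia.
Qed.

(** The types [tmL (fst v)] and [tmL (lsort (trvar v))] become convertible only after splitting on
    whether the type of [v] is 0. *)
Definition castv (v : varT) : tmL (fst v) -> tmL (lsort (trvar v)) :=
  match v with
  | (n, i) => match n return tmL n -> tmL (lsort (trvar (n, i))) with
              | 0 => fun t => t
              | S m => fun t => t
              end
  end.

Definition updT (r : val) (v : varT) (c : tmL (fst v)) : val := upd r (trvar v) (castv v c).

Lemma updT_same r n i c : pst (updT r (n, i) c) (trtm (tvar n i)) = c.
Proof. unfold updT; destruct n; simpl; [apply (upd_same r (VN i))|apply (upd_same r (VF kGen n i))]. Qed.

Lemma updT_other r v c w : v <> w -> updT r v c (trvar w) = r (trvar w).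
Proof. intros H; apply upd_other. intros E; apply H, trvar_inj, E. Qed.

Lemma pst_agreeT r r' {n} (t : tmT n) :
  (forall v, In v (fvtT t) -> r (trvar v) = r' (trvar v)) -> pst r (trtm t) = pst r' (trtm t).
Proof. intros H. apply pst_agree. intros x Hx. apply fvtL_trtm in Hx as (v & -> & Hv). auto. Qed.

Lemma pst_updT_other r v c {n} (t : tmT n) : ~ In v (fvtT t) ->
  pst (updT r v c) (trtm t) = pst r (trtm t).
Proof. intros H. apply pst_agreeT. intros w Hw. apply updT_other. congruence. Qed.

Lemma pst_updT_type r m i c {n} (t : tmT n) : n <> m ->
  pst (updT r (m, i) c) (trtm t) = pst r (trtm t).
Proof. intros H. apply pst_updT_other. intros K%fvtT_type. simpl in K. congruence. Qed.

Lemma pst_subst r v (s : tmT (fst v)) {n} (t : tmT n) :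
  pst r (trtm (substtT v s t)) = pst (updT r v (pst r (trtm s))) (trtm t).
Proof.
  induction t; try (simpl; congruence). cbn [substtT].
  destruct v as [m j]; cbn [fst snd] in *.
  destruct (Nat.eq_dec m n) as [<-|Hn].
  - destruct (Nat.eqb_spec j i) as [<-|Hi].
    + simpl eq_rect. now rewrite updT_same.
    + rewrite pst_updT_other; [reflexivity|]. simpl; intuition congruence.
  - rewrite pst_updT_other; [reflexivity|]. simpl; intuition congruence.
Qed.

Definition lnex (x : lvar) (A : fmL) : fmL := lnot (lAll x (lnot A)).
(** The bound name is a parameter: [prime] derives it from the indices of [t], while the
    comprehension witness needs a name chosen in advance. *)
Definition memF (n y : nat) (t : tmL n) (u : tmL (S n)) : fmL :=
  lnex (VN y) (lnot (lnot (lEq n (lapp n u (nv y)) (Nn n t)))).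

Lemma negt_fIn n (t : tmT n) u :
  negt (prime (fIn n t u)) = memF n (S (mxtL (trtm t))) (trtm t) (trtm u).
Proof. rewrite prime_fIn. reflexivity. Qed.

Section TISem.
Variables s N : nat.
Notation pf := (pf s).
Notation wfc := (wfc s).
Notation ext := (ext s).
Notation sem := (sem s N).
Notation okt := (okt s N).
Notation okv := (okv s N).

(** Double negation in the model, with inconsistent contexts in the role of falsum. It behaves as a
    monad on monotone predicates, and the negative existential and disjunction are [nn] of the
    ordinary ones. *)
Definition nn (Q : list fmL -> Prop) (G : list fmL) : Prop :=
  forall G', ext G G' -> (forall G'', ext G' G'' -> Q G'' -> pf G'' lBot) -> pf G' lBot.
Definition mono (Q : list fmL -> Prop) : Prop := forall G G', ext G G' -> Q G -> Q G'.
Definition stab (Q : list fmL -> Prop) : Prop := forall G, wfc G -> nn Q G -> Q G.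

Lemma nn_mono Q : mono (nn Q).
Proof. intros G G' E H G'' E'. apply H. eapply ext_trans; eauto. Qed.

Lemma nn_ret (Q : list fmL -> Prop) G : mono Q -> Q G -> nn Q G.
Proof. intros M H G' E K. apply K; [apply ext_refl, (ext_wfc _ _ _ E)|eauto]. Qed.

Lemma nn_bind (Q R : list fmL -> Prop) G :
  nn Q G -> (forall G', ext G G' -> Q G' -> nn R G') -> nn R G.
Proof.
  intros H K G' E F. apply H; [assumption|]. intros G'' E' HQ.
  apply (K G''); [eapply ext_trans; eauto|assumption|apply ext_refl, (ext_wfc _ _ _ E')|].
  intros G3 E3. apply F. eapply ext_trans; eauto.
Qed.

Lemma nn_iff (Q R : list fmL -> Prop) G :
  (forall G', ext G G' -> Q G' <-> R G') -> nn Q G <-> nn R G.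
Proof.
  intros H; split; intros K G' E F; apply K; auto; intros G'' E' HQ;
    apply F; auto; apply H; auto; eapply ext_trans; eauto.
Qed.

(** Towards a stable goal a double negation may be dropped from a hypothesis. In this form case
    distinction and existential elimination become available for translated formulas. *)
Lemma stab_bind (Q R : list fmL -> Prop) G : stab R -> mono R -> wfc G ->
  nn Q G -> (forall G', ext G G' -> Q G' -> R G') -> R G.
Proof.
  intros HR M W H K. apply HR; [assumption|]. apply (nn_bind Q); [assumption|].
  intros G' E HQ. apply nn_ret; auto.
Qed.

Lemma mono_pf A : mono (fun G => pf G A).
Proof. intros G G' E. now apply pf_weak. Qed.

(** After [negt], atoms, disjunctions and existential formulas are negations, and every negation is
    stable; the other connectives inherit stability from their parts. *)
Lemma sem_stab A : forall r, stab (sem (negt A) r).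
Proof.
  assert (Hnot : forall B r, stab (sem (lnot B) r)).
  { intros B r G W H G' E HB. apply H; [assumption|].
    intros G'' E' K. apply (K G''); [apply ext_refl, (ext_wfc _ _ _ E')|].
    eapply sem_mono; eauto. }
  induction A; simpl negt; intros r; try apply Hnot.
  - intros G W H. simpl in *. specialize (H G (ext_refl _ _ W)). apply H. auto.
  - intros G W H; simpl; split.
    + apply IHA1; [assumption|]. apply (nn_bind _ _ _ H). intros G' E [H1 _].
      apply nn_ret; [|assumption]. intros ? ?; apply sem_mono.
    + apply IHA2; [assumption|]. apply (nn_bind _ _ _ H). intros G' E [_ H1].
      apply nn_ret; [|assumption]. intros ? ?; apply sem_mono.
  - intros G W H G' E H1. apply IHA2; [apply (ext_wfc _ _ _ E)|].
    apply (nn_bind _ _ _ (nn_mono _ _ _ E H)). intros G'' E' K.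
    apply nn_ret; [intros ? ?; apply sem_mono|]. apply K; [apply ext_refl, (ext_wfc _ _ _ E')|].
    eapply sem_mono; eauto.
  - intros G W H t Ha Ht. apply IHA; [assumption|]. apply (nn_bind _ _ _ H).
    intros G' E K. apply nn_ret; [intros ? ?; apply sem_mono|]. now apply K.
Qed.

Lemma mono_sem A r : mono (sem A r).
Proof. intros G G'; apply sem_mono. Qed.

Lemma sem_and A B r G : sem (lAnd A B) r G <-> sem A r G /\ sem B r G.
Proof. reflexivity. Qed.

Lemma sem_lnex x A r G : sem (lnex x A) r G <->
  nn (fun G => exists t, admL x t /\ okt t /\ sem A (upd r x t) G) G.
Proof.
  split; intros H G' E K; apply H; auto.
  - intros t Ha Ht G'' E' HA. apply K; eauto.
  - intros G'' E' (t & Ha & Ht & HA). apply (K t Ha Ht G'' E' HA).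
Qed.

Lemma sem_allT v A r G : sem (lAll (trvar v) A) r G <->
  forall c : tmL (fst v), okt c -> sem A (updT r v c) G.
Proof.
  destruct v as [[|n] i]; unfold updT; simpl; split; intros H c; auto.
Qed.

Lemma sem_nexT v A r G : sem (lnex (trvar v) A) r G <->
  nn (fun G => exists c : tmL (fst v), okt c /\ sem A (updT r v c) G) G.
Proof.
  rewrite sem_lnex. apply nn_iff; intros G' _.
  destruct v as [[|n] i]; unfold updT; simpl; split.
  - intros (t & ? & ? & ?); eauto.
  - intros (t & ? & ?); exists t; auto.
  - intros (t & ? & ? & ?); eauto.
  - intros (t & ? & ?); exists t; auto.
Qed.

Definition eqn {n} (a b : tmL n) : list fmL -> Prop := nn (fun G => pf G (lEq n a b)).

Definition mem {n} (c : tmL n) (a : tmL (S n)) : list fmL -> Prop :=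
  nn (fun G => exists k, okt k /\ eqn (lapp n a k) (Nn n c) G).

Definition incl_upto {n} (R : tmL n -> tmL n -> list fmL -> Prop) (a b : tmL (S n))
  (G : list fmL) : Prop :=
  forall c, okt c -> forall G', ext G G' -> mem c a G' ->
    nn (fun G'' => exists d, okt d /\ mem d b G'' /\ R c d G'') G'.

Fixpoint apx (n : nat) : tmL n -> tmL n -> list fmL -> Prop :=
  match n with
  | 0 => fun a b => eqn a b
  | S m => fun a b G => incl_upto (apx m) a b G /\ incl_upto (apx m) b a G
  end.

Lemma pst_Nn r n (t : tmL n) : pst r (Nn n t) = Nn n (pst r t).
Proof. destruct n; reflexivity. Qed.

Lemma pst_upd_notin r x c {n} (t : tmL n) : ~ In x (fvtL t) -> pst (upd r x c) t = pst r t.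
Proof. intros H. apply pst_agree. intros v Hv. apply upd_other. congruence. Qed.

Lemma sem_memF n y (t : tmL n) u r G : ~ In (VN y) (fvtL t) -> ~ In (VN y) (fvtL u) ->
  sem (memF n y t u) r G <-> mem (pst r t) (pst r u) G.
Proof.
  intros Ht Hu. unfold memF. rewrite sem_lnex. apply nn_iff. intros G' _.
  assert (E : forall c G, sem (lnot (lnot (lEq n (lapp n u (nv y)) (Nn n t)))) (upd r (VN y) c) G
     <-> eqn (lapp n (pst r u) c) (Nn n (pst r t)) G).
  { intros c G0. simpl. rewrite (upd_same r (VN y)), pst_Nn, !pst_upd_notin by assumption.
    reflexivity. }
  split.
  - intros (k & _ & Hk & H). exists k; split; [assumption|]. now apply E.
  - intros (k & Hk & H). exists k; repeat split; try apply Hk. now apply E.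
Qed.

Lemma sem_fIn n (t : tmT n) u r G :
  sem (negt (prime (fIn n t u))) r G <-> mem (pst r (trtm t)) (pst r (trtm u)) G.
Proof.
  rewrite negt_fIn. apply sem_memF.
  - apply notin_fresh; simpl; lia.
  - intros H. apply fvtL_trtm in H as (v & E & H). apply fvtT_type in H.
    destruct v as [[|] ?]; simpl in *; congruence.
Qed.

(** The fixed bound names 0 and 1 of [approx] are harmless: they have type [m], while the variables
    of [t] and [u] all have type [m + 1]. *)
Lemma sem_approx n : forall (t u : tmT n) r G,
  sem (negt (prime (approx n t u))) r G <-> apx n (pst r (trtm t)) (pst r (trtm u)) G.
Proof.
  induction n as [|m IH]; intros t u r G; [reflexivity|].
  assert (K : forall t u : tmT (S m),
    sem (negt (prime (fAll (m, 0) (fImp (fIn m (tvar m 0) t)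
              (fEx (m, 1) (fAnd (fIn m (tvar m 1) u) (approx m (tvar m 0) (tvar m 1)))))))) r G
    <-> incl_upto (apx m) (pst r (trtm t)) (pst r (trtm u)) G).
  { clear t u; intros t u.
    change (sem (lAll (trvar (m, 0)) (lImp (negt (prime (fIn m (tvar m 0) t)))
       (lnex (trvar (m, 1)) (lAnd (negt (prime (fIn m (tvar m 1) u)))
           (negt (prime (approx m (tvar m 0) (tvar m 1)))))))) r G
     <-> incl_upto (apx m) (pst r (trtm t)) (pst r (trtm u)) G).
    rewrite sem_allT. unfold incl_upto.
    assert (E1 : forall c G, sem (negt (prime (fIn m (tvar m 0) t))) (updT r (m, 0) c) G
       <-> mem c (pst r (trtm t)) G).
    { intros c G'. rewrite sem_fIn, updT_same, pst_updT_type by lia. reflexivity. }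
    assert (E2 : forall c G, sem (lnex (trvar (m, 1)) (lAnd (negt (prime (fIn m (tvar m 1) u)))
           (negt (prime (approx m (tvar m 0) (tvar m 1)))))) (updT r (m, 0) c) G <->
      nn (fun G'' => exists d, okt d /\ mem d (pst r (trtm u)) G'' /\ apx m c d G'') G).
    { intros c G'. rewrite sem_nexT. apply nn_iff; intros G'' _.
      assert (E3 : forall d, sem (lAnd (negt (prime (fIn m (tvar m 1) u)))
           (negt (prime (approx m (tvar m 0) (tvar m 1))))) (updT (updT r (m, 0) c) (m, 1) d) G''
         <-> mem d (pst r (trtm u)) G'' /\ apx m c d G'').
      { intros d. rewrite sem_and, sem_fIn, IH, updT_same, !pst_updT_type by lia.
        rewrite pst_updT_other, updT_same; [reflexivity|]. simpl; intuition congruence. }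
      split; intros (d & Hd & H); exists d; (split; [assumption|]); apply E3; assumption. }
    split.
    - intros H c Hc G' E HM. apply E2. apply (H c Hc); [assumption|]. now apply E1.
    - intros H c Hc G' E HM. apply E2. apply (H c Hc); [assumption|]. now apply E1. }
  change (sem (negt (prime (fAll (m, 0) (fImp (fIn m (tvar m 0) t)
              (fEx (m, 1) (fAnd (fIn m (tvar m 1) u) (approx m (tvar m 0) (tvar m 1)))))))) r G /\
   sem (negt (prime (fAll (m, 0) (fImp (fIn m (tvar m 0) u)
              (fEx (m, 1) (fAnd (fIn m (tvar m 1) t) (approx m (tvar m 0) (tvar m 1)))))))) r G
    <-> apx (S m) (pst r (trtm t)) (pst r (trtm u)) G).
  rewrite !K. reflexivity.
Qed.

Definition inx {n} (t : tmL n) (u : tmL (S n)) : list fmL -> Prop :=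
  nn (fun G => exists z, okt z /\ mem z u G /\ apx n z t G).

(** The bound variable introduced by [star] has the same type as [t], so here the choice of an index
    above all those of [t] matters. *)
Lemma sem_int_fIn n (t : tmT n) u r G :
  sem (int (fIn n t u)) r G <-> inx (pst r (trtm t)) (pst r (trtm u)) G.
Proof.
  set (z := S (mxT t)).
  change (sem (lnex (trvar (n, z)) (lAnd (negt (prime (fIn n (tvar n z) u)))
      (negt (prime (approx n (tvar n z) t))))) r G <-> inx (pst r (trtm t)) (pst r (trtm u)) G).
  rewrite sem_nexT. apply nn_iff. intros G' _.
  assert (E : forall d, sem (lAnd (negt (prime (fIn n (tvar n z) u)))
      (negt (prime (approx n (tvar n z) t)))) (updT r (n, z) d) G' <->
      mem d (pst r (trtm u)) G' /\ apx n d (pst r (trtm t)) G').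
  { intros d. rewrite sem_and, sem_fIn, sem_approx, updT_same, pst_updT_type by lia.
    rewrite pst_updT_other; [reflexivity|]. clear.
    assert (K : forall n (t : tmT n) v, In v (fvtT t) -> snd v <= mxT t).
    { clear. induction t; simpl; intros v H; rewrite ?in_app_iff in H; try tauto.
      - destruct H as [<-|[]]; simpl; lia.
      - now apply IHt.
      - destruct H as [H|H]; [apply IHt1 in H|apply IHt2 in H]; lia.
      - destruct H as [H|H]; [apply IHt1 in H|apply IHt2 in H]; lia. }
    intros H%K. unfold z in H; simpl in H. lia. }
  split; intros (d & Hd & H); exists d; (split; [assumption|]); apply E; assumption.
Qed.

Lemma eqn_refl {n} (a : tmL n) G : wfc G -> okt a -> eqn a a G.
Proof. intros W [H _]. apply nn_ret; [apply mono_pf|now apply pf_refl]. Qed.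

Lemma eqn_sym {n} (a b : tmL n) G : eqn a b G -> eqn b a G.
Proof.
  intros H. apply (nn_bind _ _ _ H). intros G' E K. apply nn_ret; [apply mono_pf|now apply pf_sym].
Qed.

Lemma eqn_trans {n} (a b c : tmL n) G : eqn a b G -> eqn b c G -> eqn a c G.
Proof.
  intros H H'. apply (nn_bind _ _ _ H). intros G' E K.
  apply (nn_bind _ _ _ (nn_mono _ _ _ E H')). intros G'' E' K'.
  apply nn_ret; [apply mono_pf|]. eapply pf_trans; [|exact K']. eapply pf_weak; eauto.
Qed.

Lemma eqn_cong2 (op : tmL 0 -> tmL 0 -> tmL 0) a a' b b' G :
  (forall G, pf G (lEq 0 a a') -> pf G (lEq 0 b b') -> pf G (lEq 0 (op a b) (op a' b'))) ->
  eqn a a' G -> eqn b b' G -> eqn (op a b) (op a' b') G.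
Proof.
  intros Hop H H'. apply (nn_bind _ _ _ H). intros G' E K.
  apply (nn_bind _ _ _ (nn_mono _ _ _ E H')). intros G'' E' K'.
  apply nn_ret; [apply mono_pf|]. apply Hop; [eapply pf_weak; eauto|assumption].
Qed.

Lemma mem_mono {n} (c : tmL n) a : mono (mem c a).
Proof. apply nn_mono. Qed.

Lemma apx_mono n (a b : tmL n) : mono (apx n a b).
Proof.
  destruct n; simpl; [apply nn_mono|].
  intros G G' E [H1 H2]; split; intros c Hc G'' E'; [apply H1|apply H2]; auto;
    eapply ext_trans; eauto.
Qed.

Lemma apx_refl n : forall (a : tmL n) G, wfc G -> okt a -> apx n a a G.
Proof.
  induction n as [|m IH]; intros a G W Ha; simpl; [now apply eqn_refl|].
  assert (K : incl_upto (apx m) a a G); [|split; exact K].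
  intros c Hc G' E H. apply nn_ret.
  - intros G1 G2 E' (d & ? & ? & ?); exists d; repeat split; try apply H0.
    + eapply mem_mono; eauto.
    + eapply apx_mono; eauto.
  - exists c; repeat split; try apply Hc; auto. apply IH; [apply (ext_wfc _ _ _ E)|assumption].
Qed.

Lemma apx_sym n (a b : tmL n) G : apx n a b G -> apx n b a G.
Proof. destruct n; simpl; [apply eqn_sym|tauto]. Qed.

Lemma mono_ex_mem {n} (R : tmL n -> list fmL -> Prop) u : (forall d, mono (R d)) ->
  mono (fun G => exists d, okt d /\ mem d u G /\ R d G).
Proof.
  intros HR G G' E (d & Hd & H1 & H2). exists d. split; [assumption|split].
  - eapply mem_mono; eauto.
  - eapply HR; eauto.
Qed.

Lemma apx_trans n : forall (a b c : tmL n) G, apx n a b G -> apx n b c G -> apx n a c G.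
Proof.
  induction n as [|m IH]; intros a b c G; simpl; [apply eqn_trans|].
  assert (K : forall a b c, incl_upto (apx m) a b G -> incl_upto (apx m) b c G ->
    incl_upto (apx m) a c G).
  { clear a b c; intros a b c H1 H2 d Hd G' E HM.
    apply (nn_bind _ _ _ (H1 d Hd G' E HM)). intros G1 E1 (e & He & Hm & Ha).
    apply (nn_bind _ _ _ (H2 e He G1 (ext_trans _ _ _ _ E E1) Hm)).
    intros G2 E2 (f & Hf & Hm' & Ha').
    apply nn_ret; [apply mono_ex_mem; intro; apply apx_mono|].
    exists f; split; [assumption|split; [assumption|]].
    apply (IH _ e); [|assumption]. eapply apx_mono; eauto. }
  intros [H1 H2] [H3 H4]; split; eapply K; eauto.
Qed.

Definition apxv (r r' : val) (G : list fmL) : Prop :=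
  forall n i, n <= s -> apx n (pst r (trtm (tvar n i))) (pst r' (trtm (tvar n i))) G.

Lemma apxv_tm r r' G n (t : tmT n) : wfc G -> n <= s -> apxv r r' G ->
  apx n (pst r (trtm t)) (pst r' (trtm t)) G.
Proof.
  intros W Hn H; induction t; simpl pst.
  - now apply H.
  - apply (apx_refl 0); [assumption|]. split; [simpl; lia|intros ? []].
  - specialize (IHt Hn). apply (nn_bind _ _ _ IHt). intros G' E K.
    apply nn_ret; [apply mono_pf|now apply pf_succ].
  - apply (eqn_cong2 lplus); [intros; now apply pf_plus|now apply IHt1|now apply IHt2].
  - apply (eqn_cong2 ltimes); [intros; now apply pf_times|now apply IHt1|now apply IHt2].
Qed.

Lemma okt_updT r v c : okv r -> okt c -> okv (updT r v c).
Proof.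
  intros Hr Hc. apply okv_upd; [assumption|]. destruct v as [[|] ?]; exact Hc.
Qed.

Lemma apxv_sym r r' G : apxv r r' G -> apxv r' r G.
Proof. intros H n i Hn. now apply apx_sym, H. Qed.

Lemma apxv_mono r r' G G' : ext G G' -> apxv r r' G -> apxv r' r G' /\ apxv r r' G'.
Proof.
  intros E H. assert (K : apxv r r' G') by (intros n i Hn; eapply apx_mono; eauto).
  split; [now apply apxv_sym|assumption].
Qed.

Lemma apxv_updT r r' v c c' G : apxv r r' G -> apx (fst v) c c' G ->
  apxv (updT r v c) (updT r' v c') G.
Proof.
  intros H Hc n i Hn. destruct v as [m j]. destruct (varT_eq_dec (m, j) (n, i)) as [E|E].
  - injection E; intros <- <-. now rewrite !updT_same.
  - rewrite !pst_updT_other by (simpl; intuition congruence). now apply H.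
Qed.

Lemma apxv_refl r G : wfc G -> okv r -> apxv r r G.
Proof.
  intros W Hr n i Hn. apply apx_refl; [assumption|]. apply okt_pst; [assumption|].
  now rewrite tytL_trtm.
Qed.

Lemma inx_cong n (t t' : tmL n) u u' G : apx n t t' G -> apx (S n) u u' G ->
  inx t u G -> inx t' u' G.
Proof.
  intros Ht [Hu _] H. apply (nn_bind _ _ _ H). intros G1 E1 (z & Hz & Hm & Ha).
  apply (nn_bind _ _ _ (Hu z Hz G1 E1 Hm)). intros G2 E2 (d & Hd & Hm' & Ha').
  apply nn_ret; [apply mono_ex_mem; intro; apply apx_mono|].
  exists d; split; [assumption|split; [assumption|]].
  apply (apx_trans _ _ t); [|eapply apx_mono; [|exact Ht]; eapply ext_trans; eauto].
  apply (apx_trans _ _ z); [now apply apx_sym|]. eapply apx_mono; eauto.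
Qed.

Lemma sem_int_eq n t u r G : sem (int (fEq n t u)) r G <-> apx n (pst r (trtm t)) (pst r (trtm u)) G.
Proof. apply sem_approx. Qed.

Lemma sem_int_all v A r G : sem (int (fAll v A)) r G <->
  forall c, okt c -> sem (int A) (updT r v c) G.
Proof. apply sem_allT. Qed.

Lemma sem_int_ex v A r G : sem (int (fEx v A)) r G <->
  nn (fun G => exists c, okt c /\ sem (int A) (updT r v c) G) G.
Proof. apply sem_nexT. Qed.

Lemma sem_int_or A B r G : sem (int (fOr A B)) r G <->
  nn (fun G => sem (int A) r G \/ sem (int B) r G) G.
Proof.
  split; intros H G' E K; apply H; auto.
  - split; intros G'' E' HA; apply K; auto.
  - intros G'' E' [HA|HB]; destruct K as [K1 K2]; [apply K1|apply K2]; auto.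
Qed.

(** This justifies reading equality as [apx]: it validates the replacement rule and is needed again
    in comprehension. Atoms are invariant because [star] makes membership hold up to [apx]; the
    quantifiers pass because [apx] is reflexive on the domain. *)
Lemma sem_cong A : inTI s A -> forall r r' G, wfc G -> okv r -> okv r' -> apxv r r' G ->
  sem (int A) r G -> sem (int A) r' G.
Proof.
  unfold inTI; induction A; simpl tyFT; intros HA r r' G W Hr Hr' H.
  - rewrite !sem_int_eq. intros K. apply (apx_trans _ _ (pst r (trtm t))).
    + apply apxv_tm; auto using apxv_sym; lia.
    + apply (apx_trans _ _ _ _ _ K), apxv_tm; auto; lia.
  - rewrite !sem_int_fIn. apply inx_cong; apply apxv_tm; auto; lia.
  - auto.
  - intros [H1 H2]; split; [apply (IHA1 ltac:(lia) r)|apply (IHA2 ltac:(lia) r)]; auto.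
  - rewrite !sem_int_or. intros K. apply (nn_bind _ _ _ K). intros G' E K'.
    destruct (apxv_mono _ _ _ _ E H) as [H1 H2]. pose proof (ext_wfc _ _ _ E).
    apply nn_ret; [intros ? ? ? [?|?]; [left|right]; eapply sem_mono; eauto|].
    destruct K' as [K'|K']; [left; apply (IHA1 ltac:(lia) r)|right; apply (IHA2 ltac:(lia) r)]; auto.
  - intros K G' E K'. destruct (apxv_mono _ _ _ _ E H) as [H1 H2]. pose proof (ext_wfc _ _ _ E).
    apply (IHA2 ltac:(lia) r); auto. apply K; [assumption|]. apply (IHA1 ltac:(lia) r'); auto.
  - rewrite !sem_int_all. intros K c Hc. apply (IHA ltac:(lia) (updT r v c)); auto using okt_updT.
    apply apxv_updT; auto. now apply apx_refl.
  - rewrite !sem_int_ex. intros K. apply (nn_bind _ _ _ K). intros G' E (c & Hc & K').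
    destruct (apxv_mono _ _ _ _ E H) as [H1 H2]. pose proof (ext_wfc _ _ _ E).
    apply nn_ret; [intros ? ? ? (d & ? & ?); exists d; split; [assumption|]; eapply sem_mono; eauto|].
    exists c; split; [assumption|]. apply (IHA ltac:(lia) (updT r v c)); auto using okt_updT.
    apply apxv_updT; auto. now apply apx_refl.
Qed.

Lemma sem_agreeT A r r' G : (forall v, In v (fvT A) -> r (trvar v) = r' (trvar v)) ->
  sem (int A) r G <-> sem (int A) r' G.
Proof. intros H. apply sem_agree. intros x Hx. apply fvL_int in Hx as (v & -> & Hv). auto. Qed.

Lemma updT_comm_agree r v w a b x : v <> w ->
  updT (updT r v a) w b (trvar x) = updT (updT r w b) v a (trvar x).
Proof.
  intros H. unfold updT. assert (trvar v <> trvar w) by (intros E; apply H, trvar_inj, E).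
  destruct (lvar_eq_dec (trvar w) (trvar x)) as [<-|].
  - rewrite upd_same, upd_other by assumption. now rewrite upd_same.
  - rewrite upd_other by assumption. destruct (lvar_eq_dec (trvar v) (trvar x)) as [<-|].
    + now rewrite !upd_same.
    + now rewrite !upd_other by assumption.
Qed.

Lemma updT_updT r v a b x : updT (updT r v a) v b (trvar x) = updT r v b (trvar x).
Proof.
  unfold updT. destruct (lvar_eq_dec (trvar v) (trvar x)) as [<-|].
  - now rewrite !upd_same.
  - now rewrite !upd_other by assumption.
Qed.

(** The bound names in [int (substT v t A)] may differ from those in [int A], because [star]
    computes them from the terms substituted. Forcing does not see them, so substitution still
    becomes a change of valuation. *)
Lemma sem_subst v t A : freeforT v t A -> forall r G,
  sem (int (substT v t A)) r G <-> sem (int A) (updT r v (pst r (trtm t))) G.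
Proof.
  assert (Hb : forall w B, freeforT v t (fAll w B) ->
    (freeforT v t B -> forall r G,
        sem (int (substT v t B)) r G <-> sem (int B) (updT r v (pst r (trtm t))) G) ->
    forall r G c, sem (int (if varT_eqb w v then B else substT v t B)) (updT r w c) G <->
      sem (int B) (updT (updT r v (pst r (trtm t))) w c) G).
  { intros w B Hf IH r G c. simpl in Hf. destruct (varT_eqb_spec w v) as [->|Hn].
    - apply sem_agreeT. intros x _. now rewrite updT_updT.
    - destruct Hf as [Hf1 Hf2]. rewrite (IH Hf2).
      (* If [v] is not free in [B], the bound variable [w] may occur in [t], but then the value at
         [v] is irrelevant. *)
      destruct (in_dec varT_eq_dec v (fvT B)) as [Hv|Hv].
      + rewrite pst_updT_other by auto. apply sem_agreeT. intros x _. now apply updT_comm_agree.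
      + apply sem_agreeT. intros x Hx. rewrite (updT_other (updT r w c) v) by congruence.
        apply upd_agree. intros _. symmetry. apply updT_other. congruence. }
  induction A; intros Hf r G.
  - simpl substT. now rewrite !sem_int_eq, !pst_subst.
  - simpl substT. now rewrite !sem_int_fIn, !pst_subst.
  - reflexivity.
  - destruct Hf as [H1 H2]. pose proof (IHA1 H1 r G). pose proof (IHA2 H2 r G).
    change (sem (int (substT v t A1)) r G /\ sem (int (substT v t A2)) r G <->
      sem (int A1) (updT r v (pst r (trtm t))) G /\ sem (int A2) (updT r v (pst r (trtm t))) G).
    tauto.
  - destruct Hf as [H1 H2]. simpl substT. rewrite !sem_int_or. apply nn_iff; intros G' _.
    rewrite IHA1, IHA2 by assumption. reflexivity.
  - destruct Hf as [H1 H2]. simpl substT. split; intros K G' E K'.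
    + apply (IHA2 H2), (K G' E), (IHA1 H1), K'.
    + apply (IHA2 H2), (K G' E), (IHA1 H1), K'.
  - simpl substT. pose proof (Hb v0 A Hf IHA r G) as K.
    destruct (varT_eqb v0 v); rewrite !sem_int_all; split; intros H c Hc; apply K; auto.
  - simpl substT. pose proof (fun G => Hb v0 A Hf IHA r G) as K.
    destruct (varT_eqb v0 v); rewrite !sem_int_ex; apply nn_iff; intros G' _;
      (split; intros (c & Hc & H); exists c; (split; [assumption|]); apply K; auto).
Qed.

End TISem.

(** * Arithmetic *)

Section Arith.
Variable s : nat.
Notation pf := (pf s).
Notation wfc := (wfc s).

Lemma pf_succ0 G t : wfc G -> tytL t <= s -> pf G (lnot (lEq 0 (lsucc t) lzero)).
Proof.
  intros W Ht. apply (pf_inst s G (VN 0) t (lnot (lEq 0 (lsucc (nv 0)) lzero))); simpl; auto; try lia.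
  apply pf_ax; [constructor|split; simpl; auto; lia|apply wfc_nil].
Qed.

Lemma pf_plus0 G t : wfc G -> tytL t <= s -> pf G (lEq 0 (lplus t lzero) t).
Proof.
  intros W Ht. apply (pf_inst s G (VN 0) t (lEq 0 (lplus (nv 0) lzero) (nv 0))); simpl; auto; try lia.
  apply pf_ax; [constructor|split; simpl; auto; lia|apply wfc_nil].
Qed.

Lemma pf_times0 G t : wfc G -> tytL t <= s -> pf G (lEq 0 (ltimes t lzero) lzero).
Proof.
  intros W Ht. apply (pf_inst s G (VN 0) t (lEq 0 (ltimes (nv 0) lzero) lzero)); simpl; auto; try lia.
  apply pf_ax; [constructor|split; simpl; auto; lia|apply wfc_nil].
Qed.

(** The axioms are stated for variables. The first substitution inserts [u] for [j]; with [i] chosen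
    above the indices of [u], the second one leaves [u] unchanged. *)
Lemma pf_inst2 G i j t u A : i <> j -> wfc G -> pf [] A -> tytL t <= s -> tytL u <= s ->
  freeforL (VN j) u A -> freeforL (VN i) t (substL (VN j) u A) ->
  pf G (substL (VN i) t (substL (VN j) u A)).
Proof.
  intros. apply pf_inst; simpl; auto; try lia.
  apply pf_inst; simpl; auto using wfc_nil; lia.
Qed.

Lemma substtN_other i j t : i <> j -> substtL (VN i) t (lnvar j) = lnvar j.
Proof. intros. apply (substtL_other (VN i) (VN j)). congruence. Qed.

Local Ltac inst2 t u A :=
  let K := fresh in
  assert (K := fun G => pf_inst2 G (S (mxtL u)) (S (S (mxtL u))) t u A ltac:(lia));
  unfold nv in K; cbn [substL substtL] in K;
  repeat rewrite ?Nat.eqb_refl, ?(proj2 (Nat.eqb_neq _ _) (n_Sn _)),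
    ?(substtN_same), ?(substtN_other (S (S (mxtL u))) (S (mxtL u))),
    ?(substtL_notfree (VN (S (mxtL u))) t u) in K by (lia || (apply notin_fresh; simpl; lia));
  apply K; simpl; auto;
  apply pf_ax; [constructor|split; simpl; auto; lia|apply wfc_nil].

Lemma pf_succinj G t u : wfc G -> tytL t <= s -> tytL u <= s ->
  pf G (lImp (lEq 0 (lsucc t) (lsucc u)) (lEq 0 t u)).
Proof.
  intros W Ht Hu.
  inst2 t u (lImp (lEq 0 (lsucc (nv (S (mxtL u)))) (lsucc (nv (S (S (mxtL u))))))
               (lEq 0 (nv (S (mxtL u))) (nv (S (S (mxtL u)))))).
Qed.

Lemma pf_plusS G t u : wfc G -> tytL t <= s -> tytL u <= s ->
  pf G (lEq 0 (lplus t (lsucc u)) (lsucc (lplus t u))).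
Proof.
  intros W Ht Hu.
  inst2 t u (lEq 0 (lplus (nv (S (mxtL u))) (lsucc (nv (S (S (mxtL u))))))
               (lsucc (lplus (nv (S (mxtL u))) (nv (S (S (mxtL u))))))).
Qed.

Lemma pf_timesS G t u : wfc G -> tytL t <= s -> tytL u <= s ->
  pf G (lEq 0 (ltimes t (lsucc u)) (lplus (ltimes t u) t)).
Proof.
  intros W Ht Hu.
  inst2 t u (lEq 0 (ltimes (nv (S (mxtL u))) (lsucc (nv (S (S (mxtL u))))))
               (lplus (ltimes (nv (S (mxtL u))) (nv (S (S (mxtL u))))) (nv (S (mxtL u))))).
Qed.

End Arith.

(** * Variables of arbitrary type; tactics for side conditions *)

Definition gvar (n i : nat) : tmL n := trtm (tvar n i).
Arguments gvar : simpl never.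

Lemma fvtL_gvar n i : fvtL (gvar n i) = [trvar (n, i)].
Proof. destruct n; reflexivity. Qed.
Lemma tytL_gvar n i : tytL (gvar n i) = n.
Proof. apply tytL_trtm. Qed.
Lemma mxtL_gvar n i : mxtL (gvar n i) = i.
Proof. apply mxtL_trtm. Qed.
Lemma lidx_trvar n i : lidx (trvar (n, i)) = i.
Proof. destruct n; reflexivity. Qed.

Ltac inl :=
  repeat match goal with
  | |- inLP _ (lImp _ lBot) => apply (proj2 (inLP_not _ _))
  | |- inLP _ (lImp _ _) => apply (proj2 (inLP_imp _ _ _)); split
  | |- inLP _ (lnot _) => apply (proj2 (inLP_not _ _))
  | |- inLP _ (lAnd _ _) => apply (proj2 (inLP_and _ _ _)); split
  | |- inLP _ (lOr _ _) => apply (proj2 (inLP_or _ _ _)); split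
  | |- inLP _ (lAll _ _) => apply (proj2 (inLP_all _ _ _)); split
  | |- inLP _ (lEx _ _) => apply (proj2 (inLP_ex _ _ _)); split
  | |- inLP _ (lle _ _ _) => unfold lle
  | |- inLP _ (llt _ _ _) => unfold llt
  | |- inLP _ lBot => apply inLP_bot
  | |- inLP _ (lEq _ _ _) => apply (proj2 (inLP_eq _ _ _ _)); repeat split
  end; try assumption; simpl; rewrite ?tytL_Nn, ?tytL_gvar, ?lsort_trvar; simpl; try lia.

Ltac wf := repeat (apply wfc_cons; [inl|]); try apply wfc_nil; try assumption.

Ltac hyp := apply pf_hyp; [simpl; tauto|wf].

Ltac nofv :=
  let H := fresh "Hfv" in
  intro H; cbn [fvL fvtL lnot liff lle llt nv lnex memF] in H;
  repeat first
    [ rewrite In_fv_bind in H | rewrite in_app_iff in H | rewrite fvtL_Nn in H | rewrite fvtL_gvar in H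
    | progress cbn [In app] in H
    | match type of H with
      | _ \/ _ => destruct H as [H|H]
      | _ /\ _ => let H' := fresh in destruct H as [H H']
      end ];
  try contradiction; try congruence;
  match type of H with
  | _ = _ => apply (f_equal lidx) in H; rewrite ?lidx_trvar in H; cbn [lidx] in H;
             rewrite ?lidx_trvar in H
  | In _ (fvtL _) => apply fvtL_idx in H; cbn [lidx] in H
  | In _ (fvL _) => apply fvL_idx in H; cbn [lidx] in H
  end; lia.

Ltac fresh_ctx := repeat (apply nfc_cons; [nofv|]); apply nfc_nil.

Section PA.
Variable s : nat.
Notation pf := (pf s).
Notation wfc := (wfc s).

Lemma pf_ind G i A : nfc (VN i) G -> inLP s A -> wfc G ->
  pf G (substL (VN i) lzero A) -> pf (A :: G) (substL (VN i) (lsucc (nv i)) A) ->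
  pf G (lAll (VN i) A).
Proof.
  intros Hi HA W H0 HS. eapply pf_impE.
  - apply pf_ax; [apply (aL_ind i A)| |assumption].
    inl; apply inLP_substL; simpl; auto; lia.
  - apply pf_andI; [assumption|]. apply pf_allI; [assumption|simpl; lia|]. now apply pf_impI.
Qed.

Lemma pf_ind_eq i (l r : tmL 0) : tytL l <= s -> tytL r <= s ->
  pf [] (lEq 0 (substtL (VN i) lzero l) (substtL (VN i) lzero r)) ->
  pf [lEq 0 l r] (lEq 0 (substtL (VN i) (lsucc (nv i)) l) (substtL (VN i) (lsucc (nv i)) r)) ->
  forall G t, wfc G -> tytL t <= s -> pf G (lEq 0 (substtL (VN i) t l) (substtL (VN i) t r)).
Proof.
  intros Hl Hr H0 HS G t W Ht.
  apply (pf_allE s G (VN i) t (lEq 0 l r)); simpl; auto.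
  apply pf_weak0; [assumption|]. apply pf_ind; simpl; auto using nfc_nil, wfc_nil. inl.
Qed.

Local Ltac sub_in K := unfold nv in K; cbn [substL substtL] in K;
  repeat rewrite ?Nat.eqb_refl in K;
  repeat (rewrite substtL_notfree in K by (apply notin_fresh; simpl; lia)).

Lemma pf_plus0l G t : wfc G -> tytL t <= s -> pf G (lEq 0 (lplus lzero t) t).
Proof.
  intros W Ht. apply (pf_ind_eq 0 (lplus lzero (nv 0)) (nv 0)); simpl; auto; try lia.
  - apply pf_plus0; simpl; auto using wfc_nil; lia.
  - eapply pf_trans; [apply pf_plusS; [wf|simpl; lia|simpl; lia]|].
    apply pf_succ. hyp.
Qed.

Lemma pf_plusSl G a b : wfc G -> tytL a <= s -> tytL b <= s ->
  pf G (lEq 0 (lplus (lsucc a) b) (lsucc (lplus a b))).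
Proof.
  intros W Ha Hb. set (i := S (mxtL a)).
  assert (Hi : mxtL a < i) by (unfold i; lia).
  pose proof (fun H1 H2 H3 H4 => pf_ind_eq i (lplus (lsucc a) (nv i)) (lsucc (lplus a (nv i))) H1 H2 H3 H4 G b W Hb) as K.
  sub_in K. apply K; simpl; auto; try lia.
  - eapply pf_trans; [apply pf_plus0; simpl; auto using wfc_nil|].
    apply pf_succ, pf_sym, pf_plus0; auto using wfc_nil.
  - eapply pf_trans; [apply pf_plusS; [wf|simpl; lia|simpl; lia]|].
    apply pf_succ. eapply pf_trans; [|apply pf_sym, pf_plusS; [wf|simpl; lia|simpl; lia]]. hyp.
Qed.

Lemma pf_plusC G a b : wfc G -> tytL a <= s -> tytL b <= s -> pf G (lEq 0 (lplus a b) (lplus b a)).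
Proof.
  intros W Ha Hb. set (i := S (mxtL a)).
  assert (Hi : mxtL a < i) by (unfold i; lia).
  pose proof (fun H1 H2 H3 H4 => pf_ind_eq i (lplus a (nv i)) (lplus (nv i) a) H1 H2 H3 H4 G b W Hb) as K.
  sub_in K. apply K; simpl; auto; try lia.
  - eapply pf_trans; [apply pf_plus0; simpl; auto using wfc_nil|].
    apply pf_sym, pf_plus0l; auto using wfc_nil.
  - eapply pf_trans; [apply pf_plusS; [wf|simpl; lia|simpl; lia]|].
    eapply pf_trans; [|apply pf_sym, pf_plusSl; [wf|simpl; lia|simpl; lia]].
    apply pf_succ. hyp.
Qed.

Lemma pf_plusA G a b c : wfc G -> tytL a <= s -> tytL b <= s -> tytL c <= s ->
  pf G (lEq 0 (lplus (lplus a b) c) (lplus a (lplus b c))).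
Proof.
  intros W Ha Hb Hc. set (i := S (mxtL a + mxtL b)).
  assert (Hi : mxtL a < i) by (unfold i; lia).
  assert (Hi' : mxtL b < i) by (unfold i; lia).
  pose proof (fun H1 H2 H3 H4 => pf_ind_eq i (lplus (lplus a b) (nv i)) (lplus a (lplus b (nv i))) H1 H2 H3 H4 G c W Hc) as K.
  sub_in K. apply K; simpl; auto; try lia.
  - eapply pf_trans; [apply pf_plus0; simpl; auto using wfc_nil; lia|].
    apply pf_plus; [apply pf_refl; auto using wfc_nil|].
    apply pf_sym, pf_plus0; auto using wfc_nil.
  - eapply pf_trans; [apply pf_plusS; [wf|simpl; lia|simpl; lia]|].
    eapply pf_trans; [|apply pf_plus; [apply pf_refl; [wf|assumption]|
      apply pf_sym, pf_plusS; [wf|simpl; lia|simpl; lia]]].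
    eapply pf_trans; [|apply pf_sym, pf_plusS; [wf|simpl; lia|simpl; lia]].
    apply pf_succ. hyp.
Qed.

(** Induction on [t]. In [pf_generic] this separates the arguments below the initial segment from
    the one point where the value is altered. *)
Lemma pf_plusS_neq G t k : wfc G -> tytL t <= s -> tytL k <= s ->
  pf G (lnot (lEq 0 (lplus t (lsucc k)) t)).
Proof.
  intros W Ht Hk. set (i := S (mxtL k)).
  assert (Hi : mxtL k < i) by (unfold i; lia).
  assert (Ex : pf G (lAll (VN i) (lnot (lEq 0 (lplus (nv i) (lsucc k)) (nv i))))).
  { apply pf_weak0; [assumption|].
    apply pf_ind; [apply nfc_nil|inl|apply wfc_nil|unfold lnot, nv; cbn [substL substtL]..];
      rewrite Nat.eqb_refl, substtL_notfree by (apply notin_fresh; simpl; lia).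
    - apply pf_impI. eapply pf_impE.
      + apply (pf_succ0 s _ k); [wf|assumption].
      + eapply pf_trans; [|hyp]. apply pf_sym, pf_plus0l; [wf|simpl; lia].
    - apply pf_impI. eapply pf_impE; [hyp|].
      eapply pf_impE; [apply pf_succinj; [wf|simpl; lia|simpl; lia]|].
      eapply pf_trans; [|hyp]. apply pf_sym, pf_plusSl; [wf|simpl; lia|simpl; lia]. }
  apply (pf_allE s G (VN i) t) in Ex; simpl; auto.
  unfold lnot, nv in Ex; cbn [substL substtL] in Ex.
  rewrite Nat.eqb_refl, substtL_notfree in Ex by (apply notin_fresh; simpl; lia). exact Ex.
Qed.

Lemma pf_zero_or_succ G i k : i <> k -> wfc G ->
  pf G (lOr (lEq 0 (nv i) lzero) (lEx (VN k) (lEq 0 (nv i) (lsucc (nv k))))).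
Proof.
  intros Hik W. apply pf_weak0; [assumption|]. apply pf_allE_id with (x := VN i).
  apply pf_ind; [apply nfc_nil|inl|apply wfc_nil|unfold nv; cbn [substL substtL lvar_eqb]..];
    rewrite !Nat.eqb_refl; destruct (Nat.eqb_spec k i); try congruence.
  - apply pf_orI1; [inl|]. apply pf_refl; [wf|simpl; lia].
  - apply pf_orI2; [inl|]. apply (pf_exI s _ (VN k) (lnvar i)); simpl; try lia; auto; [inl|].
    rewrite Nat.eqb_refl. destruct (Nat.eqb_spec i k); try congruence.
    apply pf_refl; [wf|simpl; lia].
Qed.

(** The logic is intuitionistic, so decidability of numerical equality must be derived before a
    function can be changed at a single argument. *)
Lemma pf_eq_dec G i j : i <> j -> wfc G ->
  pf G (lOr (lEq 0 (nv i) (nv j)) (lnot (lEq 0 (nv i) (nv j)))).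
Proof.
  intros Hij W. set (k := S (i + j)).
  (* The induction is on [i] with [j] universally quantified, so that the hypothesis can be used at
     the predecessor of [j]. *)
  apply pf_weak0; [assumption|]. apply pf_allE_id with (x := VN j). apply pf_allE_id with (x := VN i).
  apply pf_ind; [apply nfc_nil|inl|apply wfc_nil|unfold lnot, nv; cbn [substL substtL lvar_eqb]..];
    rewrite !Nat.eqb_refl; destruct (Nat.eqb_spec j i); try congruence; fold (nv i) (nv j).
  - apply pf_allI; [apply nfc_nil|simpl; lia|].
    apply (pf_orE s _ _ _ _ (pf_zero_or_succ _ j k ltac:(lia) (wfc_nil s))).
    + apply pf_orI1; [inl|]. apply pf_sym. hyp.
    + apply pf_orI2; [inl|]. apply pf_impI.
      apply (pf_exE s _ (VN k) (lEq 0 (nv j) (lsucc (nv k)))); [hyp| |auto|].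
      * fresh_ctx.
      * eapply pf_impE; [apply (pf_succ0 s _ (nv k)); [wf|simpl; lia]|].
        apply pf_sym. eapply pf_trans; hyp.
  - set (E := lAll (VN j) _). assert (HE : inLP s E) by (unfold E; inl).
    apply pf_allI; [|simpl; lia|].
    { apply nfc_cons; auto using nfc_nil. unfold E; nofv. }
    assert (WE : wfc [E]) by wf.
    apply (pf_orE s _ _ _ _ (pf_zero_or_succ _ j k ltac:(lia) WE)).
    + apply pf_orI2; [inl|]. apply pf_impI.
      eapply pf_impE; [apply (pf_succ0 s _ (nv i)); [wf|simpl; lia]|].
      eapply pf_trans; hyp.
    + assert (Hk : ~ In (VN k) (fvL E)).
      { apply notin_freshF. unfold E, k; simpl. lia. }
      eapply pf_exE; [hyp| | |].
      * apply nfc_cons; [nofv|apply nfc_cons; auto using nfc_nil].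
      * nofv.
      * match goal with |- pf ?G _ => assert (HI : pf G E) by hyp end.
        apply (pf_allE s _ (VN j) (nv k)) in HI; simpl; auto; try lia.
        unfold lnot, nv in HI; cbn [substL substtL] in HI. rewrite Nat.eqb_refl in HI.
        destruct (Nat.eqb_spec i j); try congruence. fold (nv i) (nv k) in HI.
        apply (pf_orE s _ _ _ _ HI).
        -- apply pf_orI1; [inl|]. eapply pf_trans; [apply pf_succ|apply pf_sym]; hyp.
        -- apply pf_orI2; [inl|]. apply pf_impI. eapply pf_impE; [hyp|].
           eapply pf_impE; [apply pf_succinj; [wf|simpl; lia|simpl; lia]|].
           eapply pf_trans; hyp.
Qed.

End PA.

(** * Definition by cases, lawless functionals, comprehension *)

Lemma sortL_le A m : (forall v, In v (fvL A) -> lsort v <= m) -> sortL A <= m.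
Proof.
  unfold sortL. induction (fvL A) as [|v l IH]; simpl; intros H; [lia|].
  apply Nat.max_lub; auto.
Qed.

Lemma freeforL_idx x t A : (forall v, In v (fvtL t) -> mxfL A < lidx v) -> freeforL x t A.
Proof.
  induction A; simpl; intros H; auto.
  - apply IHA; intros v Hv; specialize (H v Hv); lia.
  - split; [apply IHA1|apply IHA2]; intros v Hv; specialize (H v Hv); lia.
  - split; [apply IHA1|apply IHA2]; intros v Hv; specialize (H v Hv); lia.
  - split; [apply IHA1|apply IHA2]; intros v Hv; specialize (H v Hv); lia.
  - destruct lvar_eqb; [exact I|]. split.
    + intros _ K. specialize (H _ K); lia.
    + apply IHA; intros v Hv; specialize (H v Hv); lia.
  - destruct lvar_eqb; [exact I|]. split.
    + intros _ K. specialize (H _ K); lia.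
    + apply IHA; intros v Hv; specialize (H v Hv); lia.
Qed.

Definition cases_eq (n : nat) (D : fmL) (u t1 t2 : tmL n) : fmL :=
  lAnd (lImp D (lEq n u t1)) (lImp (lnot D) (lEq n u t2)).

Section Choice.
Variable s : nat.
Notation pf := (pf s).
Notation wfc := (wfc s).

Lemma pf_cases_eq1 G n D t1 t2 : inLP s D -> tytL t1 <= s -> tytL t2 <= s -> pf G D ->
  pf G (cases_eq n D t1 t1 t2).
Proof.
  intros HD H1 H2 H. pose proof (tytL_lb t1). pose proof (pf_wfc _ _ _ H) as W.
  apply pf_andI; apply pf_impI.
  - apply pf_refl; [wf|assumption].
  - apply pf_efq; [inl|]. eapply pf_impE; [hyp|].
    eapply pf_weak; [apply ext_cons; [inl|assumption]|exact H].
Qed.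

Lemma pf_cases_eq2 G n D t1 t2 : inLP s D -> tytL t1 <= s -> tytL t2 <= s -> pf G (lnot D) ->
  pf G (cases_eq n D t2 t1 t2).
Proof.
  intros HD H1 H2 H. pose proof (tytL_lb t1). pose proof (pf_wfc _ _ _ H) as W.
  apply pf_andI; apply pf_impI.
  - apply pf_efq; [inl|]. eapply pf_impE; [|hyp].
    eapply pf_weak; [apply ext_cons; [inl|assumption]|exact H].
  - apply pf_refl; [wf|assumption].
Qed.

Lemma substL_cases_eq n x w D u t1 t2 : ~ In x (fvL D) -> ~ In x (fvtL t1) -> ~ In x (fvtL t2) ->
  substL x w (cases_eq n D u t1 t2) = cases_eq n D (substtL x w u) t1 t2.
Proof.
  intros HD H1 H2. unfold cases_eq; simpl. now rewrite (substL_notfree x w D), (substtL_notfree x w t1), (substtL_notfree x w t2).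
Qed.

Lemma freeforL_cases_eq n x w D u t1 t2 : ~ In x (fvL D) -> freeforL x w (cases_eq n D u t1 t2).
Proof.
  intros HD. pose proof (freeforL_notfree x w D HD). simpl; tauto.
Qed.

Lemma pf_cases_uniq G n D u w t1 t2 : inLP s D ->
  pf G (lOr D (lnot D)) -> pf G (cases_eq n D u t1 t2) -> pf G (cases_eq n D w t1 t2) ->
  pf G (lEq n u w).
Proof.
  intros HD H Hu Hw. pose proof (pf_wfc _ _ _ H) as W.
  assert (E : forall B A, inLP s B -> pf G A -> pf (B :: G) A).
  { intros B A HB. apply pf_weak. now apply ext_cons. }
  apply (pf_orE s _ _ _ _ H).
  - apply (pf_trans s _ _ _ t1); [|apply pf_sym]; (eapply pf_impE; [eapply pf_andE1, E; eauto|hyp]).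
  - assert (inLP s (lnot D)) by inl.
    apply (pf_trans s _ _ _ t2); [|apply pf_sym]; (eapply pf_impE; [eapply pf_andE2, E; eauto|hyp]).
Qed.

(** Decidability of [D] yields a value at each argument, and (C) collects the values. The parameter
    of the choice axioms is 0, so no trailing applications to zero appear: numerical values come
    from (C1), functional values from (C2). The sort hypothesis is the one (C) imposes for a
    functional of type [n + 1]. *)
Lemma pf_choice n x D t1 t2 : S n <= s -> inLP s D -> tytL t1 <= s -> tytL t2 <= s ->
  (forall v, In v (fvL D) \/ In v (fvtL t1) \/ In v (fvtL t2) -> lsort v <= S n) ->
  pf [] (lOr D (lnot D)) ->
  exists f, Nat.max x (Nat.max (mxfL D) (Nat.max (mxtL t1) (mxtL t2))) < f /\
    f <= Nat.max x (Nat.max (mxfL D) (Nat.max (mxtL t1) (mxtL t2))) + 2 /\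
    pf [] (lEx (VF kGen n f) (lAll (VN x)
        (cases_eq n D (lapp n (lfvar kGen n f) (nv x)) t1 t2))).
Proof.
  intros Hs HD H1 H2 Hsort Hdec.
  set (M := Nat.max x (Nat.max (mxfL D) (Nat.max (mxtL t1) (mxtL t2)))).
  set (g := S M).
  assert (ND : forall y, M < lidx y -> ~ In y (fvL D)) by (intros; apply notin_freshF; lia).
  assert (N1 : forall y, M < lidx y -> ~ In y (fvtL t1)) by (intros; apply notin_fresh; lia).
  assert (N2 : forall y, M < lidx y -> ~ In y (fvtL t2)) by (intros; apply notin_fresh; lia).
  destruct n as [|n].
  - set (chi := cases_eq 0 D (nv g) t1 t2).
    assert (Hchi : inLP s chi) by (unfold chi, cases_eq; inl).
    (* The axiom names its functional itself. Here the name evaluates to [S g], that is [M + 2],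
       which is the upper bound claimed for [f]. *)
    assert (Ef : S (Nat.max (Nat.max x g) (mxfL chi)) = S g)
      by (unfold chi, cases_eq; simpl; lia).
    assert (Es : forall w, substL (VN g) w chi = cases_eq 0 D w t1 t2).
    { intros w. unfold chi. rewrite substL_cases_eq by (auto; simpl; lia).
      f_equal. apply (substtL_same (VN g)). }
    assert (Hff : forall w, freeforL (VN g) w chi)
      by (intros; apply freeforL_cases_eq, ND; simpl; lia).
    exists (S g). split; [lia|split; [lia|]].
    eapply pf_impE.
    + pose proof (aL_C1 0 x g chi) as K. unfold C1_ax in K. rewrite Ef in K.
      rewrite Es in K. apply pf_ax; [apply K| |apply wfc_nil].
      * lia.
      * apply sortL_le. intros v Hv. unfold chi, cases_eq in Hv.
        cbn [fvL fvtL nv lnot] in Hv. rewrite !in_app_iff in Hv; simpl in Hv.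
        intuition (subst; simpl; auto).
      * apply Hff.
      * unfold cases_eq; simpl; inl.
    + apply pf_allI; [apply nfc_nil|simpl; lia|]. apply (pf_orE s _ _ _ _ Hdec).
      * apply (pf_exI s _ (VN g) t1); simpl lsort; auto; try lia; [exact I|].
        rewrite Es. apply pf_cases_eq1; auto. hyp.
      * apply (pf_exI s _ (VN g) t2); simpl lsort; auto; try lia; [exact I|].
        rewrite Es. apply pf_cases_eq2; auto. hyp.
  - set (chi := cases_eq (S n) D (lfvar kGen n g) t1 t2).
    assert (Hchi : inLP s chi) by (unfold chi, cases_eq; inl).
    assert (Ef : S (Nat.max (Nat.max g x) (mxfL chi)) = S g)
      by (unfold chi, cases_eq; simpl; lia).
    assert (Es : forall w, substL (VF kGen n g) w chi = cases_eq (S n) D w t1 t2).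
    { intros w. unfold chi. rewrite substL_cases_eq by (auto; simpl; lia).
      f_equal. apply (substtL_same (VF kGen n g)). }
    exists (S g). split; [lia|split; [lia|]].
    eapply pf_impE.
    + pose proof (aL_C2 0 n g x chi) as K. unfold C2_ax in K. rewrite Ef in K.
      cbv zeta in K. rewrite !Es in K. apply pf_ax; [apply K| |apply wfc_nil].
      * apply sortL_le. intros v Hv. unfold chi, cases_eq in Hv.
        cbn [fvL fvtL nv lnot] in Hv. rewrite !in_app_iff in Hv; simpl in Hv.
        intuition (subst; simpl; auto; lia).
      * apply freeforL_cases_eq, ND; simpl; lia.
      * unfold cases_eq; simpl; inl.
    + set (g' := S (S g)).
      (* (C2) asks for unique existence. [B] stands for [D] or its negation, [w] for the value
         selected by it; uniqueness follows by deciding [D] again. *)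
      assert (Hu : forall w, tytL w <= s -> mxtL w <= M ->
        forall B, inLP s B -> pf [B] (cases_eq (S n) D w t1 t2) ->
          (forall y, M < lidx y -> ~ In y (fvL B)) ->
        pf [B] (lEx (VF kGen n g) (lAnd chi (lAll (VF kGen n g')
           (lImp (cases_eq (S n) D (lfvar kGen n g') t1 t2)
              (lEq (S n) (lfvar kGen n g') (lfvar kGen n g))))))).
      { intros w Hw Mw B HB Hc NB.
        assert (Hne : VF kGen n g <> VF kGen n g') by (intros Q; injection Q; unfold g'; lia).
        apply (pf_exI s _ (VF kGen n g) w); simpl lsort; auto; try lia.
        - unfold chi, cases_eq; inl.
        - exact I.
        - cbn [freeforL]. split; [apply freeforL_cases_eq, ND; simpl; lia|].
          destruct (lvar_eqb_spec (VF kGen n g') (VF kGen n g)); [congruence|].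
          split; [|split; [apply freeforL_cases_eq, ND; simpl; lia|exact I]].
          intros _. apply notin_fresh; simpl; lia.
        - cbn [substL]. rewrite Es.
          destruct (lvar_eqb_spec (VF kGen n g') (VF kGen n g)); [congruence|].
          rewrite substL_cases_eq by (auto; simpl; lia).
          assert (Q1 : substtL (VF kGen n g) w (lfvar kGen n g') = lfvar kGen n g')
            by exact (substtL_other (VF kGen n g) (VF kGen n g') w Hne).
          assert (Q2 : substtL (VF kGen n g) w (lfvar kGen n g) = w)
            by exact (substtL_same (VF kGen n g) w).
          rewrite !Q1, Q2.
          apply pf_andI; [assumption|]. apply pf_allI; [|simpl; lia|].
          + apply nfc_cons; [apply NB; simpl; lia|apply nfc_nil].
          + apply pf_impI.
            assert (W : wfc [cases_eq (S n) D (lfvar kGen n g') t1 t2; B])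
              by (unfold cases_eq; simpl; wf).
            apply (pf_cases_uniq _ (S n) D _ _ t1 t2); [assumption| | |].
            * now apply pf_weak0.
            * apply pf_hyp; [simpl; auto|assumption].
            * eapply pf_weak; [|exact Hc]. split; [apply incl_tl, incl_refl|assumption]. }
      assert (ND' : forall y, M < lidx y -> ~ In y (fvL (lnot D))).
      { intros y Hy. simpl. rewrite app_nil_r. auto. }
      apply pf_allI; [apply nfc_nil|simpl; lia|]. apply (pf_orE s _ _ _ _ Hdec).
      * apply (Hu t1); auto; [lia|]. apply pf_cases_eq1; auto. hyp.
      * apply (Hu t2); auto; [lia|inl|]. apply pf_cases_eq2; auto. hyp.
Qed.

End Choice.

Section Generic.
Variable s : nat.
Notation pf := (pf s).
Notation wfc := (wfc s).

(** Giving the value of a term a variable name lets universal hypotheses be used through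
    [pf_allE_id] instead of through substitution. *)
Lemma pf_ex_eq G i t : wfc G -> tytL t <= s -> ~ In (VN i) (fvtL t) ->
  pf G (lEx (VN i) (lEq 0 (nv i) t)).
Proof.
  intros W Ht Hi. apply (pf_exI s _ (VN i) t); simpl; auto; try lia; try solve [inl].
  rewrite Nat.eqb_refl, substtL_notfree by assumption. now apply pf_refl.
Qed.

(** If [y + 1 + e = x], this writes [z + x] as [y] plus a successor, which shows at once that [y] is
    at most [z + x] and different from it. *)
Lemma pf_shift G z y e : wfc G -> tytL z <= s -> tytL y <= s -> tytL e <= s ->
  pf G (lEq 0 (lplus z (lplus (lsucc y) e)) (lplus y (lsucc (lplus z e)))).
Proof.
  intros W Hz Hy He.
  assert (Hr : forall t, tytL t <= s -> pf G (lEq 0 t t)) by (intros; now apply pf_refl).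
  eapply pf_trans; [apply pf_plus; [now apply Hr|apply pf_plusSl; auto]|].
  eapply pf_trans; [apply pf_plusS; simpl; auto; lia|].
  eapply pf_trans; [|apply pf_sym, pf_plusS; simpl; auto; lia].
  apply pf_succ.
  eapply pf_trans; [apply pf_sym, pf_plusA; auto|].
  eapply pf_trans; [|apply pf_plusA; auto].
  apply pf_plus; [now apply pf_plusC|now apply Hr].
Qed.

(* A lawless sequence takes, up to double negation, every value infinitely
   often: a finite initial segment can always be continued by [g]. *)
Lemma pf_generic n b z d h : S n <= s -> z <> d -> z <> b -> d <> b ->
  pf [] (lnot (lAll (VN d) (lnot (lEq n (lapp n (lfvar kLL n h) (lplus (nv z) (nv d))) (gvar n b))))).
Proof.
  intros Hs Hzd Hzb Hdb. apply pf_impI.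
  set (ALL := lAll (VN d) _).
  assert (HALL : inLP s ALL) by (unfold ALL; inl).
  assert (MA : mxfL ALL = Nat.max d (Nat.max (Nat.max h (Nat.max z d)) b)).
  { unfold ALL; simpl. rewrite mxtL_gvar. lia. }
  (* [n0] and the offsets up to 3 repeat the bound names that [LL3_ax] computes for the formula
     [ALL]; only [X] is an additional name. *)
  set (n0 := S (Nat.max h (mxfL ALL))).
  set (x := n0). set (y := n0 + 1). set (gg := n0 + 2). set (e := n0 + 3). set (X := n0 + 4).
  assert (Hb : b < n0) by lia. assert (Hz : z < n0) by lia.
  assert (Hd : d < n0) by lia. assert (Hh : h < n0) by lia.
  set (GG := lfvar kLL n gg). set (HH := lfvar kLL n h).
  set (ALL' := lAll (VN d) (lnot (lEq n (lapp n GG (lplus (nv z) (nv d))) (gvar n b)))).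
  assert (EA : substL (VF kLL n h) GG ALL = ALL').
  { unfold ALL, ALL', nv, lnot. cbn [substL substtL lvar_eqb].
    f_equal. f_equal. f_equal; [f_equal; apply (substtL_same (VF kLL n h))|].
    apply substtL_notfree. rewrite fvtL_gvar. destruct n; simpl; intuition congruence. }
  set (Pre := lAll (VN y) (lImp (llt (nv y) (nv x) e) (lEq n (lapp n GG (nv y)) (lapp n HH (nv y))))).
  set (Hx := lAll (VF kLL n gg) (lImp Pre ALL')).
  assert (HHx : inLP s Hx) by (unfold Hx, Pre, ALL', GG, HH; inl).
  assert (Kx : pf [ALL] (lEx (VN x) Hx)).
  { eapply pf_impE; [|hyp].
    apply pf_ax; [unfold Hx; rewrite <- EA; apply (aL_LL3 n h ALL)| |wf].
    (* The parameter [g] has type [n], one less than [H]. So [h] is the only lawless variable of the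
       type of [H], and no general variable of that type is free. *)
    - intros w Hw. unfold ALL in Hw. cbn [fvL fvtL lnot nv] in Hw.
      rewrite In_fv_bind, fvtL_gvar in Hw. simpl in Hw.
      destruct Hw as [[<-|[<-|[<-|[<-|[]]]]] _]; try (simpl; repeat split; intros; (lia || congruence); fail).
      clear -Hs. destruct n as [|m]; simpl; (split; [lia|split; intros j Q; try congruence]).
      injection Q; lia.
    - inl. }
  apply (pf_exE s _ _ _ _ Kx); [unfold ALL; fresh_ctx|auto|].
  (* [X = z + x] lies outside the initial segment of length [x] and at the same time at or after
     stage [z]. *)
  set (HX := lEq 0 (nv X) (lplus (nv z) (nv x))).
  assert (HHX : inLP s HX) by (unfold HX; inl).
  eapply pf_exE.
  { apply (pf_ex_eq _ X (lplus (nv z) (nv x))); [wf|simpl; lia|]. nofv. }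
  { unfold ALL, Hx, Pre, ALL', GG, HH; fresh_ctx. }
  { auto. }
  fold HX.
  assert (Ech : pf [] (lOr (lEq 0 (nv y) (nv X)) (lnot (lEq 0 (nv y) (nv X)))))
    by (apply pf_eq_dec; [lia|apply wfc_nil]).
  destruct (pf_choice s n y (lEq 0 (nv y) (nv X)) (gvar n b) (lapp n HH (nv y)))
    as (f & Hf & _ & Kf);
    [assumption|inl|rewrite tytL_gvar; lia|unfold HH; simpl; lia| |exact Ech|].
  { intros v Hv. rewrite fvtL_gvar in Hv. unfold HH in Hv. cbn [fvL fvtL nv In app] in Hv.
    assert (lsort (trvar (n, b)) <= S n) by (rewrite lsort_trvar; simpl; lia).
    intuition (subst; simpl; auto; lia). }
  simpl in Hf. rewrite mxtL_gvar in Hf.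
  set (F := lfvar kGen n f).
  (* [F] is [H] with its value at [X] replaced by [g]. *)
  set (Hch := lAll (VN y) (cases_eq n (lEq 0 (nv y) (nv X)) (lapp n F (nv y)) (gvar n b) (lapp n HH (nv y)))).
  assert (HHch : inLP s Hch) by (unfold Hch, cases_eq, F, HH; inl).
  fold F Hch in Kf.
  eapply pf_exE.
  { apply pf_weak0; [wf|exact Kf]. }
  { unfold ALL, Hx, Pre, ALL', GG, HH, HX; fresh_ctx. }
  { auto. }
  (* [e2] is the bound name fixed by (LL1). The lawless functional obtained from (LL1) follows [F]
     up to and including [X]; it reuses the name [gg] that (LL3) quantifies, so the latter can be
     instantiated without substitution. *)
  set (e2 := S (X + y)).
  set (Hle := lAll (VN y) (lImp (lle (nv y) (nv X) e2) (lEq n (lapp n GG (nv y)) (lapp n F (nv y))))).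
  assert (HHle : inLP s Hle) by (unfold Hle, GG, F; inl).
  eapply pf_exE.
  { apply pf_ax; [apply (aL_LL1 n gg f X y); lia| |wf]. fold e2 GG F. inl. }
  { unfold ALL, Hch, cases_eq, Hx, Pre, ALL', GG, HH, HX, F; fresh_ctx. }
  { auto. }
  fold e2 GG F Hle.
  assert (Elle : forall t, substL (VN e2) t (lEq 0 (lplus (nv y) (nv e2)) (nv X))
      = lEq 0 (lplus (nv y) t) (nv X)).
  { intros t. unfold nv; cbn [substL substtL].
    now rewrite Nat.eqb_refl, (proj2 (Nat.eqb_neq y e2)), (proj2 (Nat.eqb_neq X e2)) by lia. }
  assert (W : wfc [Hle; Hch; HX; Hx; ALL]) by wf.
  (* From [y + 1 + e = x] one gets [y + S (z + e) = X]. The witness [S (z + e)] puts [y] in the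
     range of (LL1), and it excludes [y = X]; so the new functional equals [F], and [F] equals [H],
     at [y]. *)
  assert (Kpre : pf [Hle; Hch; HX; Hx; ALL] Pre).
  { apply pf_allI; [unfold ALL, Hle, Hch, cases_eq, Hx, Pre, ALL', GG, HH, HX, F; fresh_ctx|simpl; lia|].
    apply pf_impI. eapply pf_exE; [hyp| | |].
    { unfold ALL, Hle, Hch, cases_eq, Hx, Pre, ALL', GG, HH, HX, F; fresh_ctx. }
    { unfold GG, HH; nofv. }
    set (G1 := _ :: _ :: _).
    assert (W1 : wfc G1) by (unfold G1, GG, HH; wf).
    assert (Hin : forall B, In B G1 -> pf G1 B) by (intros; now apply pf_hyp).
    assert (Heq : pf G1 (lEq 0 (lplus (nv y) (lsucc (lplus (nv z) (nv e)))) (nv X))).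
    { eapply pf_trans; [apply pf_sym, pf_shift; simpl; auto; lia|].
      eapply pf_trans; [|apply pf_sym, Hin; unfold G1; simpl; tauto].
      apply pf_plus; [apply pf_refl; simpl; auto; lia|apply Hin; unfold G1; simpl; tauto]. }
    eapply pf_trans.
    - eapply pf_impE; [eapply pf_allE_id with (x := VN y), Hin; unfold G1; simpl; tauto|].
      apply (pf_exI s _ (VN e2) (lsucc (lplus (nv z) (nv e)))
        (lEq 0 (lplus (nv y) (nv e2)) (nv X))); [simpl; lia|inl|exact I|exact I|simpl; lia|].
      rewrite Elle. exact Heq.
    - eapply pf_impE.
      + eapply pf_andE2. eapply pf_allE_id with (x := VN y), Hin; unfold G1; simpl; tauto.
      + apply pf_impI. assert (W2 : wfc (lEq 0 (nv y) (nv X) :: G1)) by wf.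
        eapply pf_impE; [apply (pf_plusS_neq s _ (nv y) (lplus (nv z) (nv e))); simpl; auto; lia|].
        eapply pf_trans; [eapply pf_weak; [|exact Heq]; split; [apply incl_tl, incl_refl|assumption]|].
        apply pf_sym, pf_hyp; [simpl; auto|assumption]. }
  assert (KA : pf [Hle; Hch; HX; Hx; ALL] ALL').
  { eapply pf_impE; [eapply pf_allE_id with (x := VF kLL n gg); hyp|exact Kpre]. }
  eapply pf_exE.
  { apply (pf_ex_eq _ y (nv X)); [assumption|simpl; lia|nofv]. }
  { unfold ALL, Hle, Hch, cases_eq, Hx, Pre, ALL', GG, HH, HX, F; fresh_ctx. }
  { auto. }
  set (G1 := _ :: _).
  assert (W1 : wfc G1) by (unfold G1; wf).
  assert (Hin : forall B, In B G1 -> pf G1 B) by (intros; now apply pf_hyp).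
  assert (KA1 : pf G1 ALL') by (eapply pf_weak; [|exact KA]; split; [apply incl_tl, incl_refl|assumption]).
  (* Taking [d] to be [x] reaches the argument [X], where the new lawless functional does take the
     value [g]. *)
  apply (pf_allE s _ (VN d) (nv x)) in KA1; simpl; auto; try lia.
  unfold lnot, nv in KA1; cbn [substL substtL] in KA1.
  rewrite Nat.eqb_refl, (proj2 (Nat.eqb_neq z d)) in KA1 by assumption.
  rewrite (substtL_notfree (VN d) _ GG), (substtL_notfree (VN d) _ (gvar n b)) in KA1
    by (unfold GG; nofv).
  eapply pf_impE; [exact KA1|].
  assert (Hy : pf G1 (lEq 0 (nv y) (nv X))) by (apply Hin; unfold G1; simpl; tauto).
  eapply pf_trans; [apply pf_app; [simpl; lia|]|eapply pf_trans].
  - apply pf_sym. eapply pf_trans; [exact Hy|]. apply Hin; unfold G1; simpl; tauto.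
  - eapply pf_impE; [eapply pf_allE_id with (x := VN y), Hin; unfold G1; simpl; tauto|].
    apply (pf_exI s _ (VN e2) lzero
      (lEq 0 (lplus (nv y) (nv e2)) (nv X))); [simpl; lia|inl|exact I|exact I|simpl; lia|].
    rewrite Elle. eapply pf_trans; [apply pf_plus0; simpl; auto; lia|exact Hy].
  - eapply pf_impE; [|exact Hy].
    eapply pf_andE1. eapply pf_allE_id with (x := VN y), Hin; unfold G1; simpl; tauto.
Qed.

End Generic.

Lemma fvtL_substtL x t {n} (u : tmL n) y :
  In y (fvtL (substtL x t u)) -> In y (fvtL u) \/ In y (fvtL t).
Proof.
  induction u; try (simpl; rewrite ?in_app_iff; tauto).
  - destruct (lvar_eq_dec x (VN i)) as [->|Hn].
    + change (lnvar i) with (vt (VN i)). rewrite substtL_same; auto.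
    + assert (E : substtL x t (lnvar i) = lnvar i) by exact (substtL_other x (VN i) t Hn).
      rewrite E; auto.
  - destruct (lvar_eq_dec x (VF k n i)) as [->|Hn].
    + assert (E : substtL (VF k n i) t (lfvar k n i) = t) by exact (substtL_same (VF k n i) t).
      rewrite E; auto.
    + assert (E : substtL x t (lfvar k n i) = lfvar k n i) by exact (substtL_other x (VF k n i) t Hn).
      rewrite E; auto.
Qed.

Lemma fvL_substL x t A y : In y (fvL (substL x t A)) -> In y (fvL A) \/ In y (fvtL t).
Proof.
  induction A; simpl; rewrite ?in_app_iff, ?In_fv_bind; intros H;
    try (repeat match goal with H : _ \/ _ |- _ => destruct H as [H|H] end;
         try (apply fvtL_substtL in H); tauto).
  - destruct lvar_eqb; simpl in H; rewrite In_fv_bind in H; tauto.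
  - destruct lvar_eqb; simpl in H; rewrite In_fv_bind in H; tauto.
Qed.

Lemma notin_substtL x t {n} (u : tmL n) : ~ In x (fvtL t) -> ~ In x (fvtL (substtL x t u)).
Proof.
  intros Ht; induction u; try (simpl; rewrite ?in_app_iff; tauto).
  - destruct (lvar_eq_dec x (VN i)) as [->|Hn].
    + assert (E : substtL (VN i) t (lnvar i) = t) by exact (substtL_same (VN i) t). now rewrite E.
    + assert (E : substtL x t (lnvar i) = lnvar i) by exact (substtL_other x (VN i) t Hn).
      rewrite E; simpl; intuition.
  - destruct (lvar_eq_dec x (VF k n i)) as [->|Hn].
    + assert (E : substtL (VF k n i) t (lfvar k n i) = t) by exact (substtL_same (VF k n i) t).
      now rewrite E.
    + assert (E : substtL x t (lfvar k n i) = lfvar k n i) by exact (substtL_other x (VF k n i) t Hn).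
      rewrite E; simpl; intuition.
Qed.

Lemma notin_substL x t A : ~ In x (fvtL t) -> ~ In x (fvL (substL x t A)).
Proof.
  intros Ht. assert (K : forall n (u : tmL n), ~ In x (fvtL (substtL x t u)))
    by (intros; now apply notin_substtL).
  induction A; simpl; rewrite ?in_app_iff; intros H;
    try (repeat match goal with H : _ \/ _ |- _ => destruct H as [H|H] end;
         try (apply K in H); tauto).
  - destruct (lvar_eqb_spec x0 x); simpl in H; rewrite In_fv_bind in H; intuition.
  - destruct (lvar_eqb_spec x0 x); simpl in H; rewrite In_fv_bind in H; intuition.
Qed.

Lemma mxtL_substtL x t {n} (u : tmL n) : mxtL (substtL x t u) <= Nat.max (mxtL u) (mxtL t).
Proof.
  induction u; try (simpl; lia).
  - destruct (lvar_eq_dec x (VN i)) as [->|Hn].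
    + assert (E : substtL (VN i) t (lnvar i) = t) by exact (substtL_same (VN i) t).
      rewrite E; apply Nat.le_max_r.
    + assert (E : substtL x t (lnvar i) = lnvar i) by exact (substtL_other x (VN i) t Hn).
      rewrite E; lia.
  - destruct (lvar_eq_dec x (VF k n i)) as [->|Hn].
    + assert (E : substtL (VF k n i) t (lfvar k n i) = t) by exact (substtL_same (VF k n i) t).
      rewrite E; apply Nat.le_max_r.
    + assert (E : substtL x t (lfvar k n i) = lfvar k n i) by exact (substtL_other x (VF k n i) t Hn).
      rewrite E; lia.
Qed.

Lemma mxfL_substL x t A : mxfL (substL x t A) <= Nat.max (mxfL A) (mxtL t).
Proof.
  assert (Ht : forall n (u : tmL n), mxtL (substtL x t u) <= Nat.max (mxtL u) (mxtL t))
    by (intros; apply mxtL_substtL).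
  induction A; simpl; try lia.
  - pose proof (Ht n t0). pose proof (Ht n u). lia.
  - pose proof (Ht 0 z). lia.
  - destruct lvar_eqb; simpl; lia.
  - destruct lvar_eqb; simpl; lia.
Qed.

Section Comprehension.
Variable s : nat.
Notation pf := (pf s).
Notation wfc := (wfc s).

Lemma substL_castv_id n b A : substL (trvar (n, b)) (castv (n, b) (gvar n b)) A = A.
Proof. destruct n; [apply (substL_id (VN b))|apply (substL_id (VF kGen n b))]. Qed.

Lemma freeforL_castv_id n b A : freeforL (trvar (n, b)) (castv (n, b) (gvar n b)) A.
Proof. destruct n; [apply (freeforL_id (VN b))|apply (freeforL_id (VF kGen n b))]. Qed.

Lemma fvtL_castv v t : fvtL (castv v t) = fvtL t.
Proof. destruct v as [[|] ?]; reflexivity. Qed.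

Lemma tytL_castv v t : tytL (castv v t) = tytL t.
Proof. destruct v as [[|] ?]; reflexivity. Qed.

Lemma admL_castv v t : admL (trvar v) (castv v t).
Proof. destruct v as [[|] ?]; exact I. Qed.

Lemma pf_eqsubT G v (t u : tmL (fst v)) A :
  freeforL (trvar v) (castv v t) A -> freeforL (trvar v) (castv v u) A -> inLP s A ->
  pf G (lEq (fst v) t u) -> pf G (substL (trvar v) (castv v t) A) ->
  pf G (substL (trvar v) (castv v u) A).
Proof. destruct v as [[|m] i]; apply pf_eqsub. Qed.

Lemma pf_Nn_inj G n b (u : tmL n) : pf G (lEq n (Nn n (gvar n b)) (Nn n u)) -> pf G (lEq n (gvar n b) u).
Proof.
  intros H. pose proof (pf_eq_leb _ _ _ _ _ H) as (H1 & H2 & H3). rewrite tytL_Nn in H1, H2.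
  pose proof (pf_wfc _ _ _ H) as W. eapply pf_impE; [|exact H]. destruct n as [|m].
  - now apply pf_succinj.
  - set (j := S (b + mxtL u)). set (x := VF kGen m j).
    assert (Hne : x <> VF kGen m b) by (intros Q; injection Q; lia).
    pose proof (pf_inst s G x u (lImp (lEq (S m) (lN m (lfvar kGen m b)) (lN m (lfvar kGen m j)))
      (lEq (S m) (lfvar kGen m b) (lfvar kGen m j))) W) as K.
    assert (Q1 : substtL x u (lfvar kGen m b) = lfvar kGen m b)
      by exact (substtL_other x (VF kGen m b) u Hne).
    assert (Q2 : substtL x u (lfvar kGen m j) = u) by exact (substtL_same x u).
    assert (Q3 : forall t, substtL x u (lN m t) = lN m (substtL x u t)) by reflexivity.
    cbn [substL] in K. rewrite !Q3, Q1, Q2 in K.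
    apply K; simpl; auto.
    apply pf_ax; [constructor|inl|apply wfc_nil].
Qed.

Lemma pf_Nn_neq G n b : pf G (lEq n (Nn n (gvar n b)) (Kc n)) -> pf G lBot.
Proof.
  intros H. pose proof (pf_eq_leb _ _ _ _ _ H) as (H1 & H2 & H3).
  pose proof (pf_wfc _ _ _ H) as W. eapply pf_impE; [|exact H]. destruct n as [|m].
  - apply pf_succ0; simpl; auto; lia.
  - apply pf_ax; [apply (aL_N1 m b)|inl|assumption].
Qed.

(* [F] lists [N (H w)] for those [w] at which a proof of [phi (H w)] is known
   by time [w]; since the lawless [H] returns to every value after any given
   stage, every [g] with [phi g] is eventually listed. *)
Lemma pf_comprehension n b phi : S n <= s -> inLP s phi -> isL phi = true ->
  (forall v, In v (fvL phi) -> lsort v <= S n) ->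
  exists f w, let M := Nat.max b (mxfL phi) in
    M < f /\ M < w /\ f <= M + 10 /\ w <= M + 10 /\
    pf [] (lnex (VF kGen n f) (lAll (trvar (n, b))
      (liff (memF n w (gvar n b) (lfvar kGen n f)) (lnot (lnot phi))))).
Proof.
  intros Hs Hphi HL Hsort. set (M := Nat.max b (mxfL phi)).
  (* Indices above [M] are fresh for [phi] and [g]. [pf_choice] puts [f] at most two above [w], so
     [f] and [w] remain within [M + 10]. *)
  set (h := M + 1). set (w := M + 2). set (z := M + 3). set (d := M + 4).
  set (HH := lfvar kLL n h). set (g := gvar n b). set (v := (n, b)).
  set (Hw := lapp n HH (nv w)).
  set (P := lProv (nv w) phi).
  assert (HP : inLP s P) by (split; simpl; [assumption|destruct Hphi; lia]).
  assert (Nphi : forall y, M < lidx y -> ~ In y (fvL phi)) by (intros; apply notin_freshF; lia).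
  set (D := substL (trvar v) (castv v Hw) P).
  assert (THw : tytL Hw <= s) by (unfold Hw, HH; simpl; lia).
  assert (HD : inLP s D) by (apply inLP_substL; [now rewrite tytL_castv|assumption]).
  assert (FD : freeforL (trvar v) (castv v Hw) P).
  { change (freeforL (trvar v) (castv v Hw) phi). apply freeforL_idx.
    rewrite fvtL_castv. unfold Hw, HH; simpl.
    intros y [<-|[<-|[]]]; simpl; lia. }
  (* (CS1) speaks of [phi] at [g]; its instance at [H w] makes the case distinction defining [F]
     decidable. *)
  assert (Hdec : pf [] (lOr D (lnot D))).
  { apply (pf_inst s [] (trvar v) (castv v Hw) (lOr P (lnot P))).
    - apply wfc_nil.
    - apply pf_ax; [now apply aL_CS1|inl|apply wfc_nil].
    - apply admL_castv.
    - simpl; tauto.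
    - rewrite lsort_trvar; simpl; lia.
    - now rewrite tytL_castv. }
  assert (ND : forall y, In y (fvL D) -> In y (fvL phi) \/ y = VN w \/ y = VF kLL n h).
  { intros y Hy. apply fvL_substL in Hy. rewrite fvtL_castv in Hy. unfold P, Hw, HH in Hy.
    simpl in Hy. intuition. }
  assert (MD : mxfL D <= w).
  { pose proof (mxfL_substL (trvar v) (castv v Hw) P) as K. fold D in K.
    assert (mxtL (castv v Hw) = w) by (unfold v, Hw, HH, w, h; clear; destruct n; simpl; lia).
    rewrite H in K. change (mxfL P) with (Nat.max w (mxfL phi)) in K. lia. }
  assert (TK : tytL (Kc n) <= s) by (clear - Hs; destruct n; simpl; lia).
  assert (MK : mxtL (Kc n) = 0) by (clear; destruct n; reflexivity).
  assert (FK : fvtL (Kc n) = []) by (clear; destruct n; reflexivity).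
  assert (MN : mxtL (Nn n Hw) = w) by (unfold Hw, HH, w, h; clear; destruct n; simpl; lia).
  destruct (pf_choice s n w D (Nn n Hw) (Kc n)) as (f & Hf1 & Hf2 & Kf); auto.
  { now rewrite tytL_Nn. }
  { intros y Hy. rewrite FK, fvtL_Nn in Hy. unfold Hw, HH in Hy. simpl in Hy.
    destruct Hy as [Hy|Hy]; [apply ND in Hy|]; intuition (subst; simpl; auto; lia). }
  rewrite MK, MN in Hf1, Hf2.
  exists f, w. cbv zeta. repeat (split; [lia|]).
  set (F := lfvar kGen n f). fold F in Kf.
  set (H := lAll (VN w) (cases_eq n D (lapp n F (nv w)) (Nn n Hw) (Kc n))).
  fold H in Kf.
  assert (HH' : inLP s H) by (unfold H, cases_eq, F; inl).
  set (E := lEq n (lapp n F (nv w)) (Nn n g)).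
  assert (HE : inLP s E) by (unfold E, F, g; inl).
  set (mm := memF n w g F).
  assert (Hmm : inLP s mm) by (unfold mm, memF, lnex; fold E; inl).
  assert (NH : forall y, In y (fvL H) -> In y (fvL phi) \/ y = VF kLL n h \/ y = VF kGen n f).
  { intros y Hy. unfold H, cases_eq in Hy. cbn [fvL lnot fvtL nv] in Hy.
    rewrite In_fv_bind, !in_app_iff, FK, fvtL_Nn in Hy. unfold Hw, HH, F in Hy. simpl in Hy.
    destruct Hy as [Hy Hn].
    assert (Hy' : In y (fvL D) \/ y = VF kLL n h \/ y = VF kGen n f) by (intuition congruence).
    destruct Hy' as [Hy'|]; [|tauto]. apply ND in Hy'. tauto. }
  (* In [D] the variable [g] has been replaced by [H w], so the defining property of [F] does not
     mention it and [g] can be generalised. *)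
  assert (NvH : ~ In (trvar v) (fvL H)).
  { assert (NvHw : ~ In (trvar v) (fvtL Hw)) by (unfold v, Hw, HH; nofv).
    assert (NvD : ~ In (trvar v) (fvL D)) by (apply notin_substL; now rewrite fvtL_castv).
    assert (NvK : ~ In (trvar v) (fvtL (Kc n))) by (rewrite FK; auto).
    unfold H, cases_eq, F. unfold v in *. nofv. }
  assert (Nf : forall i, M < i -> ~ In (VN i) (fvL H)).
  { intros i Hi K. apply NH in K as [K|[K|K]]; try congruence. now apply Nphi in K. }
  assert (Nn2 : forall i, M < i -> ~ In (VN i) (fvL (lnot (lnot phi)))).
  { intros i Hi. simpl. rewrite !app_nil_r. now apply Nphi. }
  assert (Hdec' : forall G, wfc G -> pf G (lOr D (lnot D))) by (intros; now apply pf_weak0).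
  assert (CS3 : forall z, M < z -> forall G, wfc G ->
     pf G (liff (lEx (VN z) (lProv (nv z) phi)) phi)).
  { intros z' Hz' G W. apply pf_ax; [apply aL_CS3; [assumption|now apply Nphi]| |assumption].
    unfold liff; inl; (split; simpl; [assumption|destruct Hphi; lia]). }
  assert (HPz : inLP s (lProv (nv z) phi)) by (split; simpl; [assumption|destruct Hphi; lia]).
  assert (Body : pf [H] (lAll (trvar v) (liff mm (lnot (lnot phi))))).
  { apply pf_allI; [apply nfc_cons; auto using nfc_nil|rewrite lsort_trvar; simpl; lia|].
    apply pf_andI; apply pf_impI; apply pf_impI.
    (* Suppose [F w = N g]. If [D] holds, then [N g = N (H w)], hence [g = H w], and (CS3) turns the
       proof known at [w] into [phi]. If [D] fails, then [N g] would be the constant [K], or zero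
       for numbers, which is excluded. *)
    - eapply pf_impE; [apply (pf_hyp s _ mm); [simpl; auto|wf]|].
      apply pf_allI; [|simpl; lia|].
      { apply nfc_cons; [unfold lnot; simpl; rewrite app_nil_r; apply Nphi; simpl; lia|].
        apply nfc_cons; [unfold mm, F, g; nofv|].
        apply nfc_cons; [apply Nf; lia|apply nfc_nil]. }
      fold E. apply pf_impI. eapply pf_impE; [hyp|]. apply pf_impI.
      set (G1 := E :: _). assert (W1 : wfc G1) by (unfold G1; wf).
      assert (Hc : forall G, incl G1 G -> wfc G ->
        pf G (cases_eq n D (lapp n F (nv w)) (Nn n Hw) (Kc n))).
      { intros G Hi W. apply pf_allE_id with (x := VN w), pf_hyp; [|assumption].
        apply Hi; unfold G1; simpl; tauto. }
      apply (pf_orE s _ _ _ _ (Hdec' G1 W1)).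
      + assert (W2 : wfc (D :: G1)) by (apply wfc_cons; assumption).
        assert (Heq : pf (D :: G1) (lEq n g Hw)).
        { apply pf_Nn_inj. fold g. eapply pf_trans; [apply pf_sym|].
          - apply (pf_hyp s _ E); [simpl; auto|assumption].
          - eapply pf_impE; [eapply pf_andE1, (Hc _ (incl_tl _ (incl_refl _)) W2)|].
            apply pf_hyp; [simpl; auto|assumption]. }
        eapply pf_impE; [apply (pf_hyp s _ (lnot phi)); [unfold G1; simpl; tauto|assumption]|].
        eapply pf_impE; [eapply pf_andE1, (CS3 w); [lia|assumption]|].
        apply pf_exI_id; [simpl; lia|]. fold P.
        rewrite <- (substL_castv_id n b P). apply (pf_eqsubT _ v Hw g P); auto.
        * apply freeforL_castv_id.
        * now apply pf_sym.
        * apply pf_hyp; [simpl; auto|assumption].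
      + assert (W2 : wfc (lnot D :: G1)) by (apply wfc_cons; [inl|assumption]).
        apply (pf_Nn_neq _ n b). fold g. eapply pf_trans; [apply pf_sym|].
        * apply (pf_hyp s _ E); [simpl; auto|assumption].
        * eapply pf_impE; [eapply pf_andE2, (Hc _ (incl_tl _ (incl_refl _)) W2)|].
          apply pf_hyp; [simpl; auto|assumption].
    (* [memF] is a negation, so the goal is falsum and [phi] itself may be assumed. (CS3) then
       supplies a stage [z] at which [phi] is proved. *)
    - fold E. set (Hm := lAll (VN w) (lnot (lnot (lnot E)))).
      assert (HHm : inLP s Hm) by (unfold Hm; inl).
      eapply pf_impE; [hyp|]. apply pf_impI.
      assert (Nm : forall i, M < i -> ~ In (VN i) (fvL Hm)).
      { intros i Hi. unfold Hm, E, F, g. nofv. }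
      eapply pf_exE; [eapply pf_impE; [eapply pf_andE2, (CS3 z); [lia|wf]|hyp]| |auto|].
      { assert (M < z) by lia.
        apply nfc_cons; [now apply Nphi|]. apply nfc_cons; [now apply Nm|].
        apply nfc_cons; [now apply Nn2|]. apply nfc_cons; [now apply Nf|apply nfc_nil]. }
      set (G2 := lProv _ _ :: _). assert (W2 : wfc G2) by (unfold G2; wf).
      assert (NG2 : forall i, M < i -> i <> z -> nfc (VN i) G2).
      { intros i Hi Hiz. apply nfc_cons.
        - simpl. intros [K|K]; [congruence|now apply Nphi in K].
        - apply nfc_cons; [now apply Nphi|]. apply nfc_cons; [now apply Nm|].
          apply nfc_cons; [now apply Nn2|]. apply nfc_cons; [now apply Nf|apply nfc_nil]. }
      (* Since the goal is falsum, a [d] with [H (z + d) = g] may be taken from the double negation;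
         [w] will be [z + d]. *)
      eapply pf_impE; [apply pf_weak0; [assumption|apply (pf_generic s n b z d h); lia]|].
      apply pf_allI; [apply NG2; lia|simpl; lia|].
      fold HH g. set (Q := lEq n _ _). assert (HQ : inLP s Q) by (unfold Q, HH, g; inl).
      apply pf_impI.
      assert (W3 : wfc (Q :: G2)) by (apply wfc_cons; assumption).
      eapply pf_exE.
      { apply (pf_ex_eq s _ w (lplus (nv z) (nv d))); [assumption|simpl; lia|nofv]. }
      { apply nfc_cons; [unfold Q, HH, g; nofv|].
        apply NG2; lia. }
      { auto. }
      set (W0 := lEq 0 _ _). set (G3 := W0 :: Q :: G2).
      assert (HW0 : inLP s W0) by (unfold W0; inl).
      assert (WG3 : wfc G3) by (apply wfc_cons; assumption).
      assert (Hin : forall B, In B G3 -> pf G3 B) by (intros; now apply pf_hyp).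
      assert (KW : pf G3 W0) by (apply Hin; simpl; auto).
      assert (KQ : pf G3 Q) by (apply Hin; simpl; auto).
      (* (CS2) transports the proof from stage [z] to the later stage [w]. Replacing [g] by [H w]
         then gives [D], and so [F w = N (H w) = N g]. *)
      assert (KP : pf G3 P).
      { assert (S1 : substL (VN w) (lplus (nv z) (nv d)) P = lProv (lplus (nv z) (nv d)) phi).
        { unfold P, nv; cbn [substL substtL]. rewrite Nat.eqb_refl, substL_notfree; [reflexivity|].
          apply Nphi; simpl; lia. }
        rewrite <- (substL_id (VN w) P).
        apply (pf_eqsub s _ (VN w) (lplus (nv z) (nv d)) (lnvar w) P); auto.
        - change (freeforL (VN w) (lplus (nv z) (nv d)) phi).
          apply freeforL_notfree, Nphi; simpl; lia.
        - apply (freeforL_id (VN w)).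
        - apply pf_sym. exact KW.
        - rewrite S1. eapply pf_impE; [apply pf_ax; [apply (aL_CS2 z d phi HL)| |assumption]|].
          + inl; (split; simpl; [assumption|destruct Hphi; lia]).
          + apply Hin. unfold G3, G2; simpl; auto. }
      assert (KgH : pf G3 (lEq n g Hw)).
      { apply pf_sym. eapply pf_trans; [apply pf_app; [unfold HH; simpl; lia|exact KW]|exact KQ]. }
      assert (KD : pf G3 D).
      { apply (pf_eqsubT _ v g Hw P); auto; [apply freeforL_castv_id|].
        unfold g, v. now rewrite substL_castv_id. }
      assert (KE : pf G3 E).
      { eapply pf_trans; [|apply pf_Nn, pf_sym, KgH].
        eapply pf_impE; [|exact KD]. eapply pf_andE1.
        apply pf_allE_id with (x := VN w), Hin. unfold G3, G2; simpl; tauto. }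
      eapply pf_impE; [apply pf_allE_id with (x := VN w), Hin; unfold G3, G2; simpl; tauto|].
      apply pf_impI. assert (W4 : wfc (lnot E :: G3)) by (apply wfc_cons; [inl|assumption]).
      eapply pf_impE; [apply (pf_hyp s _ (lnot E)); [simpl; auto|assumption]|].
      eapply pf_weak; [|exact KE]. split; [apply incl_tl, incl_refl|assumption]. }
  set (B := lAll (trvar v) _) in *.
  assert (HB : inLP s B) by now apply pf_inLP in Body.
  apply (pf_exE s _ _ _ _ Kf); [apply nfc_nil|nofv|].
  apply pf_impI. eapply pf_impE; [apply pf_allE_id with (x := VF kGen n f); hyp|].
  eapply pf_weak; [|exact Body]. split; [apply incl_tl, incl_refl|wf].
Qed.

End Comprehension.

(** * Comprehension in the model *)

Definition compT (n a b : nat) (A : fmT) : fmT :=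
  fEx (S n, a) (fAll (n, b) (iffT (fIn n (tvar n b) (tvar (S n) a)) A)).

(* Twenty spare indices leave room for the bound variables of the
   comprehension witness. *)
Definition bnd (A : fmT) : nat := mxfL (int A) + 20.

Section Validity.
Variables s N : nat.
Notation pf := (pf s).
Notation wfc := (wfc s).
Notation ext := (ext s).
Notation sem := (sem s N).
Notation okt := (okt s N).
Notation okv := (okv s N).

Lemma sem_inst B l : forall r G, okv r ->
  (forall x, In x l -> lsort x <= s /\ exists v, x = trvar v) ->
  sem (fold_right lAll B l) r G -> sem B r G.
Proof.
  induction l as [|x l IH]; simpl; intros r G Hr Hl H; [assumption|].
  apply IH; auto. destruct (Hl x) as [Hs [v ->]]; auto.
  assert (Ha : admL (trvar v) (r (trvar v))) by (destruct v as [[|] ?]; exact I).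
  specialize (H _ Ha (Hr _ Hs)). revert H. apply sem_agree. intros y _. symmetry.
  destruct (lvar_eq_dec (trvar v) y) as [<-|Hn]; [apply upd_same|now apply upd_other].
Qed.

(** The free variables of [B] have indices below [N] and are not in the domain. The universal
    closure is left fixed by [psub], so it passes through [reify_reflect]; [sem_inst] then
    specialises it to the given valuation. *)
Lemma sem_of_pf B : pf [] B -> negF B -> mxfL B < N ->
  (forall x, In x (fvL B) -> exists v, x = trvar v) ->
  forall r G, okv r -> wfc G -> sem B r G.
Proof.
  intros HB Hneg HN Hfv r G Hr W. pose proof (pf_inLP _ _ _ HB) as Hin.
  assert (Hsort : forall x, In x (fvL B) -> lsort x <= s).
  { intros x Hx. apply fvL_sort in Hx. destruct Hin; lia. }
  apply (sem_inst B (fvL B)); [assumption|auto|].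
  assert (K : forall l, incl l (fvL B) -> pf [] (fold_right lAll B l) /\
     negF (fold_right lAll B l) /\ mxfL (fold_right lAll B l) < N /\
     (forall x, In x (fvL (fold_right lAll B l)) -> In x (fvL B) /\ ~ In x l)).
  { induction l as [|y l IH]; simpl; intros Hl.
    { auto 10. }
    destruct IH as (H1 & H2 & H3 & H4); [intros ? ?; apply Hl; simpl; auto|].
    assert (Hy : In y (fvL B)) by (apply Hl; simpl; auto).
    repeat split; auto.
    - apply pf_allI; auto using nfc_nil.
    - pose proof (fvL_idx _ _ Hy). lia.
    - apply In_fv_bind in H as [H _]. now apply H4.
    - apply In_fv_bind in H as [H Hn]. apply H4 in H as [_ H]. intuition. }
  destruct (K (fvL B) (incl_refl _)) as (H1 & H2 & H3 & H4).
  apply reify_reflect; auto; [now apply pf_inLP in H1|].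
  rewrite psub_id; [now apply pf_weak0|]. intros x Hx. apply H4 in Hx. tauto.
Qed.

Lemma srtT_le A v : In v (fvT A) -> fst v <= srtT A.
Proof.
  unfold srtT. induction (fvT A) as [|w l IH]; simpl; [tauto|]. intros [<-|H]; [lia|].
  apply IH in H; lia.
Qed.

(** [F] is made for literal membership [mem], whereas the translated axiom concerns [inx],
    membership up to [apx]. For this [F] they coincide, because the defining formula is invariant by
    [sem_cong]. *)
Lemma sem_comp n a b A : srtT A <= S n -> ~ In (S n, a) (fvT A) ->
  inTI s (compT n a b A) -> bnd (compT n a b A) <= N ->
  forall r G, okv r -> wfc G -> sem (int (compT n a b A)) r G.
Proof.
  intros Hsrt Ha HT HN r G Hr W.
  unfold inTI, compT in HT; simpl in HT.
  assert (HA : inTI s A) by (unfold inTI; lia).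
  set (phi := int A).
  assert (Hphi : inLP s phi) by now apply inLP_int.
  destruct (pf_comprehension s n b phi) as (f & w & Hf & Hw & Hf' & Hw' & K).
  { lia. } { assumption. } { apply isL_negt, isL_prime. }
  { intros x Hx. apply fvL_int in Hx as (v & -> & Hv). rewrite lsort_trvar.
    apply srtT_le in Hv. lia. }
  assert (HM : mxfL phi + 20 <= N /\ b + 20 <= N).
  { assert (E : mxfL (int (compT n a b A)) >= Nat.max (lidx (trvar (n, b))) (mxfL phi)).
    { change (int (compT n a b A)) with (lnex (VF kGen n a) (lAll (trvar (n, b))
        (lAnd (lImp (int (fIn n (tvar n b) (tvar (S n) a))) phi)
              (lImp phi (int (fIn n (tvar n b) (tvar (S n) a))))))).
      unfold lnex, lnot. cbn [mxfL].
      generalize (mxfL (int (fIn n (tvar n b) (tvar (S n) a)))). clear. intros. lia. }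
    rewrite lidx_trvar in E. unfold bnd in HN. lia. }
  assert (Hneg : negF phi) by (apply negF_negt, isL_prime).
  set (J := lnex _ _) in K.
  assert (HJ : sem J r G).
  { apply sem_of_pf; auto.
    - simpl. tauto.
    - unfold J, lnex, liff, memF, lnex, lnot, nv. cbn [mxfL mxtL lidx].
      assert (mxtL (Nn n (gvar n b)) = b) by (destruct n; reflexivity).
      rewrite H, lidx_trvar. clear - Hf' Hw' HM.
      assert (f < N /\ w < N) by lia. repeat apply Nat.max_lub_lt; lia.
    - intros x Hx. unfold J, lnex, liff in Hx. cbn [fvL lnot] in Hx.
      rewrite !app_nil_r, !In_fv_bind, !in_app_iff in Hx. destruct Hx as [[Hx Hn] Hn'].
      assert (Hmem : In x (fvL (memF n w (gvar n b) (lfvar kGen n f))) -> False).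
      { revert Hn Hn'. clear. unfold memF, lnex. cbn [fvL lnot fvtL nv].
        rewrite !app_nil_r, In_fv_bind, !in_app_iff, fvtL_Nn, fvtL_gvar. simpl. intuition congruence. }
      assert (Hx' : In x (fvL phi)) by tauto.
      apply fvL_int in Hx' as (v & -> & _). eauto. }
  apply sem_lnex in HJ. apply sem_int_ex. apply (nn_bind s _ _ _ HJ).
  intros G1 E1 (F & _ & HF & Hb). pose proof (ext_wfc _ _ _ E1) as W1.
  rewrite sem_allT in Hb.
  assert (Key : forall d, okt d -> forall G2, ext G1 G2 ->
    mem s N d F G2 <-> sem phi (updT r (n, b) d) G2).
  { intros d Hd G2 E2. destruct (Hb d Hd) as [H1 H2].
    pose proof (ext_wfc _ _ _ E2) as W2.
    set (r1 := updT (upd r (VF kGen n f) F) (n, b) d) in *.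
    assert (Em : sem (memF n w (gvar n b) (lfvar kGen n f)) r1 G2 <-> mem s N d F G2).
    { rewrite sem_memF; [|intros Q; rewrite fvtL_gvar in Q; destruct Q as [Q|[]];
        apply (f_equal lidx) in Q; rewrite lidx_trvar in Q; simpl in Q; lia|simpl; intuition congruence].
      unfold gvar, r1. rewrite updT_same. simpl pst.
      assert (Q : updT (upd r (VF kGen n f) F) (n, b) d (trvar (S n, f)) = F).
      { rewrite updT_other by (intros Q; injection Q; lia). apply (upd_same r (VF kGen n f)). }
      simpl in Q. rewrite Q. reflexivity. }
    assert (Ep : sem phi r1 G2 <-> sem phi (updT r (n, b) d) G2).
    { apply sem_agree. intros x Hx. unfold r1. apply upd_agree. intros _. apply upd_other.
      intros <-. apply fvL_idx in Hx. simpl in Hx. lia. }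
    (* [pf_comprehension] characterises the elements by the double negation of [phi]; stability of
       the translated formula removes it. *)
    rewrite <- Em, <- Ep. split; intros H.
    - apply sem_stab; [assumption|]. apply (H1 G2 E2 H).
    - apply (H2 G2 E2). apply (nn_ret s _ _ (mono_sem s N phi r1) H). }
  apply nn_ret.
  { intros G2 G3 E (c & Hc & H). exists c; split; [assumption|]. eapply sem_mono; eauto. }
  exists F. split; [assumption|]. apply sem_int_all. intros d Hd.
  set (r2 := updT (updT r (S n, a) F) (n, b) d).
  assert (Ep : forall G2, sem phi r2 G2 <-> sem phi (updT r (n, b) d) G2).
  { intros G2. apply sem_agreeT. intros x Hx. apply upd_agree. intros _. apply updT_other.
    intros Q; subst x; contradiction. }
  assert (Ei : forall G2, sem (int (fIn n (tvar n b) (tvar (S n) a))) r2 G2 <-> inx s N d F G2).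
  { intros G2. unfold r2. rewrite sem_int_fIn, updT_same, pst_updT_type, updT_same by lia.
    reflexivity. }
  assert (Hu : okv (updT r (n, b) d)) by now apply okt_updT.
  assert (Main : forall G2, ext G1 G2 -> inx s N d F G2 <-> sem phi (updT r (n, b) d) G2).
  { intros G2 E2. pose proof (ext_wfc _ _ _ E2) as W2. split.
    - intros H. apply (stab_bind s _ _ _ (sem_stab s N _ _) (mono_sem s N _ _) W2 H).
      intros G3 E3 (c & Hc & Hm & Hap). pose proof (ext_wfc _ _ _ E3) as W3.
      apply (Key c Hc) in Hm; [|eapply ext_trans; eauto].
      apply (sem_cong s N A HA (updT r (n, b) c)); auto using okt_updT.
      apply apxv_updT; [now apply apxv_refl|assumption].
    - intros H. apply nn_ret; [apply mono_ex_mem; intro; apply apx_mono|].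
      exists d. split; [assumption|split; [now apply Key|now apply apx_refl]]. }
  split; intros G2 E2 H.
  - apply Ep, Main; [assumption|]. now apply Ei.
  - apply Ei, Main; [assumption|]. now apply Ep.
Qed.

End Validity.

(** * Soundness *)

Lemma tyFT_substT v t A : tyFT (substT v t A) = tyFT A.
Proof.
  induction A; simpl; rewrite ?tyT_eq; try congruence; destruct varT_eqb; simpl; congruence.
Qed.

Section Soundness.
Variables s N : nat.
Notation pf := (pf s).
Notation wfc := (wfc s).
Notation ext := (ext s).
Notation sem := (sem s N).
Notation okt := (okt s N).
Notation okv := (okv s N).
Notation apx := (apx s N).

(** Numbers of the model are terms, so induction cannot be taken from the metatheory. The forced
    formula is reified with a fresh variable [k] in place of [i], and the induction axiom of SLP is
    applied to the result. *)
Lemma sem_ind i A r G : inTI s A -> mxfL (int A) < N -> okv r -> wfc G ->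
  sem (int A) (updT r (0, i) lzero) G ->
  (forall t G', okt t -> ext G G' -> sem (int A) (updT r (0, i) t) G' ->
      sem (int A) (updT r (0, i) (lsucc t)) G') ->
  forall t, okt t -> sem (int A) (updT r (0, i) t) G.
Proof.
  intros HA HN Hr W H0 HS t Ht.
  assert (Hin : inLP s (int A)) by now apply inLP_int.
  assert (Hneg : negF (int A)) by (apply negF_negt, isL_prime).
  assert (Hok0 : okt lzero) by (split; [simpl; lia|intros ? []]).
  assert (HokS : forall t : tmL 0, okt t -> okt (lsucc t)) by (intros u Hu; exact Hu).
  assert (RR : forall t G, okt t -> wfc G ->
    sem (int A) (updT r (0, i) t) G <-> pf G (psub (upd r (VN i) t) (int A))).
  { intros u G' Hu W'. apply reify_reflect with (N := N); auto. now apply (okv_upd s N r (VN i)). }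
  destruct (fresh_idx N r G (fvL (int A))) as (k & Hk & HG & Hf).
  assert (Hokk : okt (lnvar k)) by (split; [simpl; lia|intros v [<-|[]]; simpl; lia]).
  set (phi := psub (upd r (VN i) (lnvar k)) (int A)).
  assert (Hphi : inLP s phi).
  { apply inLP_psub; [|assumption]. apply (okv_ty s N). now apply (okv_upd s N r (VN i)). }
  assert (Hsub : forall t, okt t -> substL (VN k) t phi = psub (upd r (VN i) t) (int A) /\
     freeforL (VN k) t phi).
  { intros u Hu. apply (psub_rename s N); auto. }
  assert (K : pf G (lAll (VN k) phi)).
  { eapply pf_impE.
    - apply pf_ax; [apply (aL_ind k phi)| |assumption].
      rewrite inLP_imp, inLP_and, !inLP_all, inLP_imp. simpl lsort.
      assert (forall t : tmL 0, tytL t <= s -> inLP s (substL (VN k) t phi))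
        by (intros u Hu; now apply inLP_substL).
      auto 10 using Nat.le_0_l.
    - apply pf_andI.
      + rewrite (proj1 (Hsub _ Hok0)). now apply RR.
      + apply pf_allI; [|simpl; lia|].
        * intros B HB. apply notin_freshF. now apply HG.
        * apply pf_impI. unfold nv. rewrite (proj1 (Hsub _ (HokS _ Hokk))).
          assert (E : ext G (phi :: G)) by now apply ext_cons.
          apply RR; [now apply HokS|now apply ext_wfc in E|].
          apply HS; auto. apply RR; [assumption|now apply ext_wfc in E|].
          apply pf_hyp; [simpl; auto|now apply ext_wfc in E]. }
  apply RR; auto. rewrite <- (proj1 (Hsub t Ht)). apply pf_allE; auto.
  - simpl; auto.
  - now apply Hsub.
  - apply Ht.
Qed.

(** The induction axiom substitutes zero and the successor of the induction variable itself. A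
    binder with another name captures neither, and a binder with this name stops the
    substitution. *)
Lemma freeforT_self i (t : tmT 0) A : (forall v, In v (fvtT t) -> v = (0, i)) -> freeforT (0, i) t A.
Proof.
  intros H; induction A; simpl; auto; destruct (varT_eqb_spec v (0, i)) as [|Hn]; auto.
Qed.

Lemma eqn_ax (a b : tmL 0) G : pf G (lEq 0 a b) -> eqn s a b G.
Proof. intros H. apply nn_ret; [apply mono_pf|assumption]. Qed.

Lemma sem_ax A : AxTI A -> inTI s A -> bnd A <= N ->
  forall r G, okv r -> wfc G -> sem (int A) r G.
Proof.
  intros H HA HN r G Hr W; destruct H; unfold inTI in HA; unfold bnd in HN;
    try (assert (Hi : tytL (r (VN i)) <= s) by (apply (Hr (VN i)); simpl; lia));
    try (assert (Hj : tytL (r (VN j)) <= s) by (apply (Hr (VN j)); simpl; lia)).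
  - intros G' E H. apply (H G'); [apply ext_refl, (ext_wfc _ _ _ E)|].
    intros G'' E' K. eapply pf_impE; [|exact K]. apply pf_succ0; [apply (ext_wfc _ _ _ E')|exact Hi].
  - intros G' E H. apply (nn_bind s _ _ _ H). intros G'' E' K. apply nn_ret; [apply mono_pf|].
    eapply pf_impE; [|exact K]. apply pf_succinj; auto. apply (ext_wfc _ _ _ E').
  - apply eqn_ax, pf_plus0; auto.
  - apply eqn_ax, pf_plusS; auto.
  - apply eqn_ax, pf_times0; auto.
  - apply eqn_ax, pf_timesS; auto.
  - simpl in HA. intros G' E [H0 HS]. pose proof (ext_wfc _ _ _ E) as W'.
    apply sem_int_all. intros c Hc.
    apply (sem_subst s N (0, i)) in H0; [|apply freeforT_self; intros ? []].
    pose proof (proj1 (sem_int_all s N (0, i) (fImp A (substT (0, i) (tsucc (tv0 i)) A)) r G') HS)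
      as HS'. clear HS; rename HS' into HS. apply sem_ind; auto.
    + unfold inTI; simpl; lia.
    + simpl in HN. unfold int in *; simpl in HN. lia.
    + intros t G'' Ht E' H. specialize (HS t Ht G'' E' H).
      apply (sem_subst s N (0, i)) in HS; [|apply freeforT_self; intros ? [<-|[]]; reflexivity].
      revert HS. apply sem_agreeT. intros v _. rewrite updT_updT.
      f_equal. simpl. f_equal. symmetry. apply (upd_same r (VN i)).
  - now apply (sem_comp s N).
  - intros G' E H. pose proof (ext_wfc _ _ _ E) as W'. apply sem_int_eq.
    pose proof (proj1 (sem_int_all s N (n, c) (iffT (fIn n (tvar n c) (tvar (S n) a))
      (fIn n (tvar n c) (tvar (S n) b))) r G') H) as H'. clear H; rename H' into H.
    (* Extensionality: a literal element of one set is an element up to [apx] by reflexivity, so the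
       hypothesis puts it in the other set up to [apx], which is what [incl_upto] asks for. *)
    assert (K1 : forall c, okt c -> forall G'', ext G' G'' ->
       inx s N c (pst r (trtm (tvar (S n) a))) G'' <-> inx s N c (pst r (trtm (tvar (S n) b))) G'').
    { intros c' Hc G'' E'. destruct (H c' Hc) as [H1 H2].
      specialize (H1 G'' E'). specialize (H2 G'' E').
      assert (Q : forall d, sem (int (fIn n (tvar n c) (tvar (S n) d))) (updT r (n, c) c') G''
        <-> inx s N c' (pst r (trtm (tvar (S n) d))) G'').
      { intros d. rewrite sem_int_fIn, updT_same, pst_updT_type by lia. reflexivity. }
      split; intros K; apply Q.
      - apply H1. now apply Q.
      - apply H2. now apply Q. }
    assert (K2 : forall (c : tmL n) u, okt c -> forall G'', ext G' G'' -> mem s N c u G'' -> inx s N c u G'').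
    { intros c' u Hc G'' E' HM. apply nn_ret; [apply mono_ex_mem; intro; apply apx_mono|].
      exists c'; split; [assumption|split; [assumption|]]. apply apx_refl; auto. apply (ext_wfc _ _ _ E'). }
    assert (K3 : forall (c : tmL n) u G'', inx s N c u G'' ->
       nn s (fun G => exists d, okt d /\ mem s N d u G /\ apx n c d G) G'').
    { intros c' u G'' K. apply (nn_bind s _ _ _ K). intros G3 E3 (z & Hz & Hm & Ha).
      apply nn_ret; [apply mono_ex_mem; intro; apply apx_mono|].
      exists z; split; [assumption|split; [assumption|now apply apx_sym]]. }
    split; intros c' Hc G'' E' HM; apply K3; apply K1; auto.
Qed.

(** Stability carries the classical part: it is used for disjunction and existential elimination, ex
    falso and double negation elimination. Equality rests on reflexivity of [apx] and on [sem_cong];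
    the index bound enters through induction and comprehension. *)
Theorem sound A :
  Prf LTI true (fun A => inTI s A /\ bnd A <= N) AxTI A ->
  forall r G, okv r -> wfc G -> sem (int A) r G.
Proof.
  assert (Ht : forall (v : varT) (t : tmT (fst v)) r, okv r -> fst v <= s -> okt (pst r (trtm t))).
  { intros v t r Hr Hv. apply okt_pst; [assumption|]. now rewrite tytL_trtm. }
  intros H; induction H; intros r G Hr W; simpl in *.
  - destruct H0. now apply sem_ax.
  - intros G1 E1 HA G2 E2 HB. eapply sem_mono; eauto.
  - intros G1 E1 HA G2 E2 HB G3 E3 HC.
    assert (E13 := ext_trans _ _ _ _ E2 E3). pose proof (ext_wfc _ _ _ E3) as W3.
    apply (HA G3 E13 HC); [now apply ext_refl|]. now apply HB.
  - intros G1 E1 [HA HB]; exact HA.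
  - intros G1 E1 [HA HB]; exact HB.
  - intros G1 E1 HA G2 E2 HB. split; [eapply sem_mono; eauto|assumption].
  - intros G1 E1 HA. apply sem_int_or. apply nn_ret; [|now left].
    intros ? ? ? [?|?]; [left|right]; eapply sem_mono; eauto.
  - intros G1 E1 HA. apply sem_int_or. apply nn_ret; [|now right].
    intros ? ? ? [?|?]; [left|right]; eapply sem_mono; eauto.
  - intros G1 E1 HA G2 E2 HB G3 E3 HC. pose proof (ext_wfc _ _ _ E3) as W3. apply sem_int_or in HC.
    apply (stab_bind s _ _ _ (sem_stab s N _ r) (mono_sem s N _ r) W3 HC).
    intros G4 E4 [K|K].
    + apply (HA G4); [|assumption]. eapply ext_trans; [exact E2|]. eapply ext_trans; eauto.
    + apply (HB G4); [|assumption]. eapply ext_trans; eauto.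
  - intros G1 E1 HB. pose proof (ext_wfc _ _ _ E1) as W1. apply sem_stab; [assumption|].
    intros G2 E2 _. eapply pf_weak; eauto.
  - intros G1 E1 HA. pose proof (ext_wfc _ _ _ E1) as W1. apply sem_stab; [assumption|].
    intros G2 E2 K. apply (HA G2); [assumption|]. exact K.
  - intros G1 E1 HA. destruct H1 as [H1 _]. unfold inTI in H1; simpl in H1.
    apply sem_subst; [assumption|]. apply (proj1 (sem_int_all s N _ _ _ _) HA). apply Ht; auto; lia.
  - intros G1 E1 HA. destruct H1 as [H1 _]. unfold inTI in H1; simpl in H1.
    apply sem_subst in HA; [|assumption]. apply sem_int_ex.
    apply nn_ret; [intros ? ? ? (d & ? & ?); exists d; split; [assumption|]; eapply sem_mono; eauto|].
    eexists; split; [|exact HA]. apply Ht; auto; lia.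
  - apply sem_int_eq, apx_refl; [assumption|]. destruct H as [H _]. unfold inTI in H; simpl in H.
    apply Ht; auto; lia.
  - intros G1 E1 HE G2 E2 HA. destruct H1 as [H1 _]. unfold inTI in H1; simpl in H1.
    pose proof (ext_wfc _ _ _ E2) as W2.
    apply sem_subst; [assumption|]. apply sem_subst in HA; [|assumption].
    apply sem_int_eq in HE. revert HA.
    assert (Hs : fst x <= s) by lia.
    destruct (le_lt_dec (tyFT A) s) as [HA|HA].
    + apply sem_cong; auto; try (apply okt_updT; auto; fail).
      apply apxv_updT; [now apply apxv_refl|]. eapply apx_mono; eauto.
    + rewrite !tyFT_substT in H1. lia.
  - apply (IHPrf2 r G Hr W G); [now apply ext_refl|]. now apply IHPrf1.
  - intros G1 E1 HB. pose proof (ext_wfc _ _ _ E1) as W1. apply sem_int_all. intros c Hc.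
    apply (IHPrf (updT r x c) G1); [now apply okt_updT|assumption|now apply ext_refl|].
    revert HB. apply sem_agreeT. intros v Hv. apply updT_other. congruence.
  - intros G1 E1 HA. pose proof (ext_wfc _ _ _ E1) as W1. apply sem_int_ex in HA.
    apply (stab_bind s _ _ _ (sem_stab s N _ r) (mono_sem s N _ r) W1 HA).
    intros G2 E2 (c & Hc & K). pose proof (ext_wfc _ _ _ E2) as W2.
    pose proof (IHPrf (updT r x c) G2 (okt_updT _ _ _ _ _ Hr Hc) W2 G2 (ext_refl _ _ W2) K) as Q.
    revert Q. apply sem_agreeT. intros v Hv. symmetry; apply updT_other. congruence.
Qed.

Lemma sem_close A : (forall r G, okv r -> wfc G -> sem (int A) r G) ->
  forall l r G, okv r -> wfc G -> sem (int (fold_right fAll A l)) r G.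
Proof.
  intros H; induction l as [|v l IH]; intros r G Hr W; simpl; [auto|].
  apply sem_int_all. intros c Hc. apply IH; [now apply okt_updT|assumption].
Qed.

Lemma fvT_close A : forall l v, In v (fvT (fold_right fAll A l)) -> In v (fvT A) /\ ~ In v l.
Proof.
  induction l as [|w l IH]; simpl; intros v; [tauto|].
  rewrite In_fvT_bind. intros [H Hn]. apply IH in H. intuition.
Qed.

Lemma tyFT_fv A v : In v (fvT A) -> fst v <= tyFT A.
Proof.
  assert (Ht : forall n (t : tmT n), In v (fvtT t) -> fst v = n) by (intros n t; apply fvtT_type).
  induction A; simpl; rewrite ?in_app_iff, ?In_fvT_bind; intros H;
    repeat match goal with
    | H : _ \/ _ |- _ => destruct H
    | H : In _ (fvtT _) |- _ => apply Ht in H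
    end; intuition lia.
Qed.

Lemma inTI_close A : inTI s A -> inTI s (closeT A).
Proof.
  unfold inTI, closeT. intros H.
  assert (K : forall l, (forall v, In v l -> fst v <= s) -> tyFT (fold_right fAll A l) <= s).
  { induction l as [|v l IH]; simpl; intros Hl; [assumption|].
    apply Nat.max_lub; [apply Hl; auto|apply IH; auto]. }
  apply K. intros v Hv%tyFT_fv. lia.
Qed.

Theorem sound_close A : inTI s A -> mxfL (int (closeT A)) < N ->
  Prf LTI true (fun A => inTI s A /\ bnd A <= N) AxTI A -> ProvSLP_s s (int (closeT A)).
Proof.
  intros HA HN H.
  assert (Hr : exists r, okv r).
  { exists (fun x => match x return tmL (lsort x) with VN _ => lnvar N | VF k n _ => lfvar k n N end).
    intros [i|k n i] Hv; (split; [simpl in *; lia|]); intros w [<-|[]]; simpl; lia. }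
  destruct Hr as [r Hr].
  assert (K : sem (int (closeT A)) r []).
  { apply sem_close; auto using wfc_nil. now apply sound. }
  apply (reify_reflect s N) in K; auto using wfc_nil.
  - apply (proj1 (pf_nil s _)) in K. rewrite psub_id in K; [exact K|].
    intros x Hx. apply fvL_int in Hx as (v & _ & Hv). apply fvT_close in Hv. tauto.
  - apply negF_negt, isL_prime.
  - now apply inLP_int, inTI_close.
Qed.

End Soundness.

(** * Bounds along a derivation, and the theorem *)

Lemma Prf_mono L cl (inL inL' : L_Fm L -> Prop) Ax A :
  (forall B, inL B -> inL' B) -> Prf L cl inL Ax A -> Prf L cl inL' Ax A.
Proof.
  intros H D; induction D; try (constructor; auto; fail).
  - apply (p_mp L cl inL' Ax A B); auto.
Qed.

(** A derivation is a finite tree. With [bnd] as measure this yields the threshold [N]; with [tyFT]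
    it places a derivation of TI in some fragment with bounded types. *)
Lemma Prf_bounded L cl (inL : L_Fm L -> Prop) Ax (m : L_Fm L -> nat) A :
  Prf L cl inL Ax A -> exists N, Prf L cl (fun B => inL B /\ m B <= N) Ax A.
Proof.
  assert (M : forall N N' B, N <= N' -> Prf L cl (fun B => inL B /\ m B <= N) Ax B ->
     Prf L cl (fun B => inL B /\ m B <= N') Ax B).
  { intros N N' B H. apply Prf_mono. intros C [? ?]; split; [assumption|lia]. }
  intros D; induction D;
    try (match goal with H : inL ?B |- exists _, Prf _ _ _ _ ?B =>
           exists (m B); constructor; auto; fail end).
  - destruct IHD1 as [N1 H1], IHD2 as [N2 H2]. exists (m B + N1 + N2).
    apply (p_mp L cl _ Ax A B); [apply (M N1); [lia|exact H1]|apply (M N2); [lia|exact H2]|].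
    split; [assumption|lia].
  - destruct IHD as [N1 H1]. exists (m (L_imp L B (L_all L x A)) + N1).
    apply p_gen; [apply (M N1); [lia|exact H1]|assumption|split; [assumption|lia]].
  - destruct IHD as [N1 H1]. exists (m (L_imp L (L_ex L x A) B) + N1).
    apply p_exE; [apply (M N1); [lia|exact H1]|assumption|split; [assumption|lia]].
Qed.

Theorem theorem12p3 :
  (forall (s : nat) (A : fmT), inTI s A -> ProvTI_s s A -> ProvSLP_s s (int (closeT A))) /\
  (forall A : fmT, ProvTI A -> ProvSLP (int (closeT A))).
Proof.
  assert (K : forall s A, inTI s A -> ProvTI_s s A -> ProvSLP_s s (int (closeT A))).
  { intros s A HA D. apply (Prf_bounded LTI _ _ _ bnd) in D as [N D].
    (* The second summand puts the indices of the closed conclusion below the threshold as well, as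
       required to read it off as a derivation. *)
    apply (sound_close s (N + S (mxfL (int (closeT A))))); [assumption|lia|].
    revert D. apply Prf_mono. intros B [? ?]; split; [assumption|lia]. }
  split; [exact K|]. intros A D. apply (Prf_bounded LTI _ _ _ tyFT) in D as [s D].
  assert (D' : ProvTI_s s A) by (revert D; apply Prf_mono; intros B [_ H]; exact H).
  assert (HA : inTI s A) by (destruct D'; assumption).
  generalize (K s A HA D'). apply Prf_mono. intros B [H _]; exact H.
Qed.
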